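(* Let $E_0\in BV(\Omega,\{0,1\})$ be nonempty and bounded, let $\beta\in L^\infty(\partial\Omega)$ be such that $-1\le\beta\le1-2\kappa$ $\mathcal H^n$-a.e. on $\partial\Omega$ for some $\kappa\in(0,\frac12]$, and let $\lambda\ge1$. (a) Let $E^+\in BV(\Omega,\{0,1\})$ be a constrained minimizer of $\mathcal C_\beta(\cdot,\Omega)$ in $\mathcal E(E_0)$. Then every minimizer $E_\lambda$ of $\mathcal A_\beta(\cdot,E_0,\lambda)$ satisfies $E_\lambda\subseteq\overline{E^+}$. (b) Let $E^+\in BV(\Omega,\{0,1\})$ be a bounded constrained minimizer of $\mathcal C_\beta(\cdot,\Omega)$ in $\mathcal E(E^+)$. If $E_0\subseteq E^+$, then every minimizer $E_\lambda$ of $\mathcal A_\beta(\cdot,E_0,\lambda)$ satisfies $E_\lambda\subseteq\overline{E^+}$. Moreover, for any given nonempty bounded $E_0\in BV(\Omega,\{0,1\})$, a bounded set $E^+\in BV(\Omega,\{0,1\})$ with $E^+\supseteq E_0$ that is a constrained minimizer of $\mathcal C_\beta(\cdot,\Omega)$ in $\mathcal E(E^+)$ can be chosen so that $|\overline{E^+}\setminus E^+|=0$.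
   Context: Let $n\ge1$, $\Omega=\mathbb R^n\times(0,+\infty)\subset\mathbb R^{n+1}$, and identify $\partial\Omega$ with $\mathbb R^n$. $BV(\Omega,\{0,1\})$ is the collection of measurable $E\subseteq\Omega$ with $\chi_E\in BV(\Omega)$, and $P(E,\Omega)=\int_\Omega|D\chi_E|$. Each set is identified with its set of points of Lebesgue density one (inclusions are meant accordingly). On $\partial\Omega$, $\chi_E$ denotes the trace of $E$. Capillary functional: $\mathcal C_\beta(E,\Omega)=P(E,\Omega)-\int_{\partial\Omega}\beta\chi_E\,d\mathcal H^n$. For $F\subseteq\Omega$, $d_F(x)=\mathrm{dist}(x,\Omega\cap\partial F)$, and $\mathcal A_\beta(E,E_0,\lambda)=\mathcal C_\beta(E,\Omega)+\lambda\int_{E\Delta E_0}d_{E_0}\,dx$; its minimizers are taken over $BV(\Omega,\{0,1\})$. For $G\in BV(\Omega,\{0,1\})$, $\mathcal E(G)=\{E\in BV(\Omega,\{0,1\}):G\subseteq E\}$. A constrained minimizer of $\mathcal C_\beta(\cdot,\Omega)$ in $\mathcal E(G)$ is a set in $\mathcal E(G)$ minimizing $\mathcal C_\beta(\cdot,\Omega)$ over $\mathcal E(G)$. *)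

(* Defs.v *)
From HB Require Import structures.
From mathcomp Require Import all_boot all_order all_algebra.
From mathcomp Require Import all_classical all_reals all_analysis.

Set Implicit Arguments.
Unset Strict Implicit.
Unset Printing Implicit Defensive.

Import Order.TTheory GRing.Theory Num.Theory.
Import numFieldNormedType.Exports.

Local Open Scope classical_set_scope.
Local Open Scope ring_scope.

Section measurable_row.
Context {d} {T : measurableType d} (n : nat).

Let coord : 'I_n -> 'rV[T]_n -> T := fun i v => v ord0 i.

Let row_set0 : g_sigma_preimage coord set0.
Proof. exact: sigma_algebra0. Qed.

Let row_setC A : g_sigma_preimage coord A -> g_sigma_preimage coord (~` A).
Proof. exact: sigma_algebraC. Qed.

Let row_bigcup (F : (set 'rV[T]_n)^nat) :
  (forall i, g_sigma_preimage coord (F i)) ->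
  g_sigma_preimage coord (\bigcup_i F i).
Proof. exact: sigma_algebra_bigcup. Qed.

(* The product sigma-algebra; for T := R it is the Borel sigma-algebra of the
   topology that the library puts on 'rV[R]_n. *)
HB.instance Definition _ := @isMeasurable.Build (measure_tuple_display d)
  'rV[T]_n (g_sigma_preimage coord) row_set0 row_setC row_bigcup.

End measurable_row.

Section measurable_row_lemmas.
Context {d1 d2} {T1 : measurableType d1} {T2 : measurableType d2}.

Lemma measurable_coord n (i : 'I_n) :
  measurable_fun [set: 'rV[T2]_n] (fun v : 'rV[T2]_n => v ord0 i).
Proof.
move=> _ Y mY; rewrite setTI; apply: sub_sigma_algebra => /=.
rewrite -bigcup_seq/=; exists i => /=; first by rewrite mem_index_enum.
by exists Y => //; rewrite setTI.
Qed.

Lemma measurable_fun_row n (f : T1 -> 'rV[T2]_n) :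
  (forall i, measurable_fun setT (fun x => f x ord0 i)) ->
  measurable_fun setT f.
Proof.
move=> mf _ Y mY; rewrite setTI.
suff : (image_set_system setT f measurable) Y.
  by rewrite /image_set_system/= setTI.
apply: mY; split; first exact/sigma_algebra_image/sigma_algebra_measurable.
rewrite -bigcup_seq/=; apply: bigcup_sub => i _ _ [B mB <-].
by rewrite /image_set_system/= setTI; exact: mf.
Qed.

End measurable_row_lemmas.

Lemma sigma_finite_product d1 d2 (T1 : measurableType d1)
    (T2 : measurableType d2) (R : realType)
    (m1 : {sigma_finite_measure set T1 -> \bar R})
    (m2 : {sigma_finite_measure set T2 -> \bar R}) :
  sigma_finite setT (m1 \x m2)%E.
Proof.
have /sigma_finiteP[F [TF ndF Foo]] := sigma_finiteT m1.
have /sigma_finiteP[G [TG ndG Goo]] := sigma_finiteT m2.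
exists (fun n => F n `*` G n).
  rewrite -setXTT TF TG predeqE => -[x y]; split.
    move=> [/= [n _ Fnx] [k _ Gky]]; exists (maxn n k) => //; split.
    - by move: x Fnx; exact/subsetPset/ndF/leq_maxl.
    - by move: y Gky; exact/subsetPset/ndG/leq_maxr.
  by move=> [n _ []/= ? ?]; split; exists n.
move=> k; have [? ?] := Foo k; have [? ?] := Goo k.
split; first exact: measurableX.
by rewrite product_measure1E// lte_mul_pinfty// ge0_fin_numE.
Qed.

Section lebesgue_line.
Context {R : realType}.

(* lebesgue_measure is declared on the copy [measurableTypeR R] of R, whose
   measurable structure has the same sets as that of R but another display. *)
Definition lebesgue_line : set R -> \bar R := lebesgue_measure.

Let lebesgue_line0 : lebesgue_line set0 = 0%E.
Proof. exact: measure0. Qed.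

Let lebesgue_line_ge0 A : (0 <= lebesgue_line A)%E.
Proof. exact: measure_ge0. Qed.

Let lebesgue_line_sigma_additive : semi_sigma_additive lebesgue_line.
Proof.
by move=> F mF tF mUF; exact: (@measure_semi_sigma_additive _ _ _
  (@lebesgue_measure R) F mF tF mUF).
Qed.

HB.instance Definition _ := isMeasure.Build _ _ _ lebesgue_line
  lebesgue_line0 lebesgue_line_ge0 lebesgue_line_sigma_additive.

Let lebesgue_line_sigma_finite : sigma_finite setT lebesgue_line.
Proof. exact: (sigma_finiteT (@lebesgue_measure R)). Qed.

HB.instance Definition _ := Measure_isSigmaFinite.Build _ _ _ lebesgue_line
  lebesgue_line_sigma_finite.

End lebesgue_line.

Section lebesgue_row.
Context {R : realType}.
Local Open Scope ereal_scope.

Definition row_cons n (p : R * 'rV[R]_n) : 'rV[R]_n.+1 :=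
  row_mx (p.1%:M : 'rV[R]_1) p.2.

Definition row_uncons n (v : 'rV[R]_n.+1) : R * 'rV[R]_n :=
  (v ord0 ord0, \row_j v ord0 (lift ord0 j)).

Lemma row_cons0 n (p : R * 'rV[R]_n) : row_cons p ord0 ord0 = p.1.
Proof.
rewrite /row_cons mxE; case: splitP => [j _|k]; last by [].
by rewrite mxE (ord1 j) eqxx mulr1n.
Qed.

Lemma row_consS n (p : R * 'rV[R]_n) (i : 'I_n) :
  row_cons p ord0 (lift ord0 i) = p.2 ord0 i.
Proof.
rewrite /row_cons mxE; case: splitP => [[[|j]//= Hj] //|k /= Hk].
by congr (p.2 _ _); apply: val_inj; move: Hk; rewrite /bump/= !add1n => -[].
Qed.

Lemma row_consK n : cancel (@row_cons n) (@row_uncons n).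
Proof.
move=> [x v]; rewrite /row_uncons row_cons0; congr pair.
by apply/rowP => j; rewrite mxE row_consS.
Qed.

Lemma measurable_row_cons n : measurable_fun setT (@row_cons n).
Proof.
apply: measurable_fun_row => i; have [j ->|->] := unliftP ord0 i.
- under eq_fun do rewrite row_consS.
  exact: (measurableT_comp (measurable_coord j) measurable_snd).
- by under eq_fun do rewrite row_cons0; exact: measurable_fst.
Qed.

Lemma measurable_row_uncons n : measurable_fun setT (@row_uncons n).
Proof.
apply/measurable_fun_pair; first exact: measurable_coord.
apply: measurable_fun_row => i; under eq_fun do rewrite mxE.
exact: measurable_coord.
Qed.

Section cons_measure.
Context n (m : {sigma_finite_measure set 'rV[R]_n -> \bar R}).

Definition cons_measure (A : set 'rV[R]_n.+1) : \bar R :=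
  (lebesgue_line \x m) (@row_cons n @^-1` A).

Let mcons (A : set 'rV[R]_n.+1) : measurable A ->
  measurable (@row_cons n @^-1` A).
Proof.
by move=> mA; rewrite -[X in measurable X]setTI; exact: measurable_row_cons.
Qed.

Let cons_measure0 : cons_measure set0 = 0.
Proof. by rewrite /cons_measure preimage_set0 measure0. Qed.

Let cons_measure_ge0 A : 0 <= cons_measure A.
Proof. exact: measure_ge0. Qed.

Let cons_measure_sigma_additive : semi_sigma_additive cons_measure.
Proof.
move=> F mF tF mUF; rewrite /cons_measure preimage_bigcup.
apply: measure_semi_sigma_additive.
- by move=> k; exact: mcons.
- apply/trivIsetP => i j _ _ ij; rewrite -preimage_setI.
  by move/trivIsetP : tF => /(_ _ _ _ _ ij) ->//; rewrite preimage_set0.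
- by rewrite -preimage_bigcup; exact: mcons.
Qed.

HB.instance Definition _ := isMeasure.Build _ _ _ cons_measure
  cons_measure0 cons_measure_ge0 cons_measure_sigma_additive.

Let cons_measure_sigma_finite : sigma_finite setT cons_measure.
Proof.
have [F TF Foo] := sigma_finite_product lebesgue_line m.
exists (fun k => @row_uncons n @^-1` F k).
  by rewrite -preimage_bigcup -TF preimage_setT.
move=> k; have [mF Fk] := Foo k; split.
  by rewrite -[X in measurable X]setTI; exact: measurable_row_uncons.
rewrite /cons_measure -comp_preimage (_ : _ \o _ = id) ?preimage_id//.
by apply/funext => p /=; rewrite row_consK.
Qed.

HB.instance Definition _ := Measure_isSigmaFinite.Build _ _ _ cons_measure
  cons_measure_sigma_finite.

End cons_measure.

Fixpoint lebesgue_row n : {sigma_finite_measure set 'rV[R]_n -> \bar R} :=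
  match n with
  | 0%N => dirac (0%R : 'rV[R]_0)
  | n'.+1 => cons_measure (lebesgue_row n')
  end.

End lebesgue_row.

Section lebesgue_row_box.
Context {R : realType}.
Local Open Scope ereal_scope.

Lemma lebesgue_row_box n (A : 'I_n -> set R) : (forall i, measurable (A i)) ->
  lebesgue_row n [set v : 'rV[R]_n | forall i, A i (v ord0 i)] =
  \prod_(i < n) lebesgue_line (A i).
Proof.
elim: n A => [|n IHn] A mA.
  rewrite big_ord0 /= /dirac indicE mem_set//.
  by case.
rewrite big_ord_recl -IHn//= /cons_measure -product_measure1E//; last first.
  rewrite (_ : [set v | _] = \big[setI/setT]_(i < n)
      ((fun v : 'rV[R]_n => v ord0 i) @^-1` A (lift ord0 i))).
    apply: bigsetI_measurable => i _; rewrite -[X in measurable X]setTI.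
    exact: measurable_coord.
  apply/seteqP; split=> v /=; rewrite -bigcap_seq/= => H i.
    by move=> _; exact: H.
  by apply: (H i) => /=; rewrite mem_index_enum.
congr (product_measure1 _ _ _); apply/seteqP; split=> -[x v] /=.
- move=> H; split=> /= [|i]; first by have := H ord0; rewrite row_cons0.
  by have := H (lift ord0 i); rewrite row_consS.
- move=> [Ax Av] i.
  by have [j ->|->] := unliftP ord0 i; rewrite ?row_cons0 ?row_consS//;
    exact: Av.
Qed.

End lebesgue_row_box.

Section capillary.
Context {R : realType} {n : nat}.

(* Omega = R^n x (0, +oo) lies in the following space, and the boundary
   point (y, 0) of Omega is represented by y : 'rV[R]_n.  The norm that the
   library puts on this space is a maximum norm: it gives the right topology
   and the right bounded sets, but balls, distances and the constraint
   |phi| <= 1 need the Euclidean norm [enorm]. *)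
Local Notation space := ('rV[R]_n * R)%type.

Definition vol : {measure set space -> \bar R} :=
  (lebesgue_row n \x lebesgue_line)%E.

Definition Omega : set space := [set x | 0 < x.2].

Definition enorm (x : space) : R :=
  Num.sqrt (\sum_(i < n) x.1 ord0 i ^+ 2 + x.2 ^+ 2).

Definition eball (x : space) (r : R) : set space :=
  [set y | enorm (y - x) < r].

Definition divergence (phi : space -> space) (x : space) : R :=
  \sum_(i < n) 'D_(delta_mx ord0 i, 0) (fun y => (phi y).1 ord0 i) x
  + 'D_(0, 1) (fun y => (phi y).2) x.

Definition C1c_Omega (phi : space -> space) : Prop :=
  [/\ forall x, differentiable phi x,
      forall v, continuous (fun x => 'D_v phi x),
      compact (closure [set x | phi x != 0]) &
      closure [set x | phi x != 0] `<=` Omega].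

Definition variation_Omega (u : space -> R) : \bar R :=
  ereal_sup [set (\int[vol]_(x in Omega) (u x * divergence phi x)%:E)%E
    | phi in [set phi | C1c_Omega phi /\ forall x, enorm (phi x) <= 1]].

Definition BV (u : space -> R) : Prop :=
  vol.-integrable Omega (EFin \o u) /\ (variation_Omega u < +oo)%E.

Definition perimeter (E : set space) : \bar R := variation_Omega \1_E.

Definition density_one (E : set space) : set space :=
  [set x | (vol (E `&` eball x r) / vol (eball x r))%E @[r --> 0^'+] --> 1%E].

(* Identifying a set with its set of points of density one means choosing, in
   each class of sets that differ by null sets, the element that is equal to
   its set of points of density one.  For these representatives, inclusion,
   nonemptiness, boundedness, closure and topological boundary are those of
   the sets themselves. *)
Definition BVset (E : set space) : Prop :=
  [/\ measurable E, E `<=` Omega, density_one E = E & BV \1_E].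

Definition half_ball (y : 'rV[R]_n) (r : R) : set space :=
  Omega `&` eball (y, 0) r.

Definition is_trace (u : space -> R) (T : 'rV[R]_n -> R) : Prop :=
  measurable_fun setT T /\
  {ae lebesgue_row n, forall y,
    ((vol (half_ball y r))^-1 *
      \int[vol]_(x in half_ball y r) `|u x - T y|%:E)%E
    @[r --> 0^'+] --> 0%E}.

(* Every u with BV u has a trace, unique up to null sets (Giusti, Minimal
   Surfaces and Functions of Bounded Variation, Theorem 2.10). *)
Definition trace (u : space -> R) : 'rV[R]_n -> R := get (is_trace u).

Definition capillary (beta : 'rV[R]_n -> R) (E : set space) : \bar R :=
  (perimeter E - \int[lebesgue_row n]_y (beta y * trace \1_E y)%:E)%E.

Definition bd (F : set space) : set space := closure F `\` F°.

Definition dist_bd (F : set space) (x : space) : \bar R :=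
  ereal_inf [set (enorm (x - y))%:E | y in Omega `&` bd F].

Definition ATW (beta : 'rV[R]_n -> R) (E0 : set space) (lambda : R)
    (E : set space) : \bar R :=
  (capillary beta E + lambda%:E * \int[vol]_(x in E `+` E0) dist_bd E0 x)%E.

Definition ATW_minimizer (beta : 'rV[R]_n -> R) (E0 : set space) (lambda : R)
    (E : set space) : Prop :=
  BVset E /\
  forall F, BVset F -> (ATW beta E0 lambda E <= ATW beta E0 lambda F)%E.

Definition supersets (G : set space) : set (set space) :=
  [set E | BVset E /\ G `<=` E].

Definition constrained_minimizer (beta : 'rV[R]_n -> R) (G E : set space) :
    Prop :=
  supersets G E /\
  forall F, supersets G F -> (capillary beta E <= capillary beta F)%E.

End capillary.

(* Main.v *)
(** Perimeter and trace term are submodular, so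
    C(E_l n E+) + C(E_l u E+) <= C(E_l) + C(E+).  Minimality of E+ among its supersets
    gives C(E_l n E+) <= C(E_l), and minimality of E_l then forces the integral of the
    distance to the boundary of E_0 over E_l \ E+ to vanish.  That distance is locally
    bounded below off the closure of E+, where E_l therefore has no density point.
    For the perimeter, test the mollified indicators u, v of two sets with the fields
    v X + (1 - v) Y and u X + (1 - u) Y: after integration by parts the sum is the flux
    of uv through X plus the flux of u + v - uv through Y.

    The bounded barriers are the sets {g < c} in the half-space, where
    g(z, t) = b t + s sqrt(1 + |z|^2), b = 1 - kappa, b^2 + s^2 = 1.  The unit field
    grad g / |grad g| has nonnegative divergence and vertical component at least b, so
    cutting F along {g = c} lowers the perimeter by at least b times the measure of the
    part of the trace that is lost; as beta <= b this does not increase C.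

    Traces are read off vertical slices: finite perimeter bounds the vertical difference
    quotients, so almost every slice is, up to a null set, full or void near height 0,
    and the trace is the indicator of the base points whose slice is full. *)
Require Import Defs.
From HB Require Import structures.
From mathcomp Require Import all_boot all_order all_algebra.
From mathcomp Require Import all_classical all_reals all_analysis measurable_realfun.
From mathcomp Require Import ring lra.

Set Implicit Arguments.
Unset Strict Implicit.
Unset Printing Implicit Defensive.

Import Order.TTheory GRing.Theory Num.Theory.
Import numFieldNormedType.Exports.

Local Open Scope classical_set_scope.
Local Open Scope ring_scope.

(** * Density of measurable sets for products of bases of neighbourhoods *)

(** Every bound on a perimeter comes from inserting explicit fields into the supremum that defines
    it; reduced boundaries and smooth approximation of sets are avoided. Test fields stay above a
    positive height and inside a box, which leaves room to translate them by a mollification radius.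
    Two choices in the definitions shape the rest. [BVset] fixes the density-one representative, so
    unions and intersections become competitors only after passing to [density_one]; this rests on
    the density theorem in the whole space, proved by slicing for dyadic cubes and then carried over
    to Euclidean balls. And [trace] is a choice among all functions with [is_trace], so nothing is
    known about its values before existence and uniqueness almost everywhere are established. The
    function g rounds off the vertex of the cone function b t + s |z|, whose unit gradient has
    vertical component exactly b. The sets {g < c} lie under hyperboloid caps; they are bounded in
    the half-space because b < 1 makes s positive. *)

Lemma preimage_measurable d d' (T : measurableType d) (T' : measurableType d')
    (f : T -> T') (A : set T') :
  measurable_fun setT f -> measurable A -> measurable (f @^-1` A).
Proof. by move=> mf mA; rewrite -[X in measurable X]setTI; exact: mf. Qed.

(* The library's instance making product measures s-finite is keyed on
   subprobabilities, hence a copy of the product measure. *)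
Section sigma_finite_product_measure.
Context d1 d2 (T1 : measurableType d1) (T2 : measurableType d2) (R : realType).
Variable m1 : {sigma_finite_measure set T1 -> \bar R}.
Variable m2 : {sigma_finite_measure set T2 -> \bar R}.

Definition product_copy : set (T1 * T2) -> \bar R := (m1 \x m2)%E.

Let copy0 : product_copy set0 = 0%E. Proof. exact: measure0. Qed.

Let copy_ge0 A : (0 <= product_copy A)%E. Proof. exact: measure_ge0. Qed.

Let copy_sigma_additive : semi_sigma_additive product_copy.
Proof. exact: measure_semi_sigma_additive. Qed.

HB.instance Definition _ := isMeasure.Build _ _ _ product_copy
  copy0 copy_ge0 copy_sigma_additive.

HB.instance Definition _ := Measure_isSigmaFinite.Build _ _ _ product_copy
  (sigma_finite_product m1 m2).

End sigma_finite_product_measure.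

Lemma measurable_set_le d (T : measurableType d) (R : realType) (f g : T -> R) :
  measurable_fun setT f -> measurable_fun setT g ->
  measurable [set x | f x <= g x].
Proof. by move=> mf mg; rewrite -[X in measurable X]setTI; exact: measurable_fun_le. Qed.

Lemma measurable_set_lt d (T : measurableType d) (R : realType) (f g : T -> R) :
  measurable_fun setT f -> measurable_fun setT g ->
  measurable [set x | f x < g x].
Proof.
move=> mf mg; rewrite (_ : mkset _ = ~` [set x | g x <= f x]).
  exact/measurableC/measurable_set_le.
by apply/seteqP; split=> x /=; rewrite ltNge => /negP.
Qed.

Section measure_preserving.
Context d (T : measurableType d) (R : realType).
Local Open Scope ereal_scope.

Definition preserves (m : set T -> \bar R) (f : T -> T) :=
  measurable_fun setT f /\ forall A, measurable A -> m (f @^-1` A) = m A.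

Lemma preserves_integral (m : {measure set T -> \bar R}) (f : T -> T)
    (g : T -> \bar R) : preserves m f -> m.-integrable setT (g \o f) ->
  measurable_fun setT g -> \int[m]_x g (f x) = \int[m]_x g x.
Proof.
move=> [mf fE] ig mg.
rewrite -(@integral_pushforward _ _ _ _ _ f mf m setT)//.
by apply: eq_measure_integral => A mA _ /=; exact: fE.
Qed.

Lemma preserves_ge0_integral (m : {measure set T -> \bar R}) (f : T -> T)
    (g : T -> \bar R) : preserves m f -> (forall x, 0 <= g x) ->
  measurable_fun setT g -> \int[m]_x g (f x) = \int[m]_x g x.
Proof.
move=> [mf fE] g0 mg.
rewrite -(ge0_integral_pushforward mf m measurableT mg)//.
by apply: eq_measure_integral => A mA _ /=; exact: fE.
Qed.

End measure_preserving.

Lemma preserves_prod d1 d2 (T1 : measurableType d1) (T2 : measurableType d2)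
    (R : realType) (m1 : {sigma_finite_measure set T1 -> \bar R})
    (m2 : {sigma_finite_measure set T2 -> \bar R}) f1 f2 :
  preserves m1 f1 -> preserves m2 f2 ->
  preserves (m1 \x m2)%E (fun p : T1 * T2 => (f1 p.1, f2 p.2)).
Proof.
move=> [mf1 f1E] [mf2 f2E].
have mf : measurable_fun setT (fun p : T1 * T2 => (f1 p.1, f2 p.2)).
  by apply/measurable_fun_pair; apply: measurableT_comp.
split=> // A mA; apply/esym.
pose mf_mixin := isMeasurableFun.Build _ _ _ _ _ mf.
pose phi := MeasurableFun.Pack (MeasurableFun.Class mf_mixin).
apply: (@product_measure_unique _ _ _ _ _ m1 m2 (pushforward (m1 \x m2)%E phi)) => //.
move=> B C mB mC; rewrite /pushforward/=.
rewrite -(f1E _ mB) -(f2E _ mC) -product_measure1E//; exact: preimage_measurable.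
Qed.

Section translation.
Context {R : realType}.

Lemma preserves_line (h : R) : preserves lebesgue_line (fun x : R => x + h).
Proof.
have mf : measurable_fun setT (fun x : R => x + h) by exact: measurable_funD.
split=> // A mA; apply/esym.
pose mf' : measurable_fun setT (fun x : measurableTypeR R => (x + h : measurableTypeR R)) := mf.
pose mf_mixin := isMeasurableFun.Build _ _ _ _ _ mf'.
pose phi := MeasurableFun.Pack (MeasurableFun.Class mf_mixin).
apply: (@lebesgue_measure_unique _ (pushforward lebesgue_measure phi)) => //.
move=> _ [[a b] _ <-]/=; rewrite /pushforward/=.
rewrite (_ : _ @^-1` _ = `](a - h), (b - h)]%classic); last first.
  by apply/seteqP; split=> x /=; rewrite !in_itv/= ltrBlDr lerBrDr.
rewrite !lebesgue_measure_itv/= !lte_fin ltrD2r; case: ifP => // _.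
by rewrite -!EFinB; congr EFin; ring.
Qed.

Lemma preserves_row n (h : 'rV[R]_n) :
  preserves (lebesgue_row n) (fun x => x + h).
Proof.
elim: n h => [|n IH] h.
  by rewrite (_ : (fun x => x + h) = id); [split|apply/funext => x; rewrite [h]thinmx0 addr0].
have mf : measurable_fun setT (fun x : 'rV[R]_n.+1 => x + h).
  apply: measurable_fun_row => i; under eq_fun do rewrite mxE.
  by apply: measurable_funD => //; exact: measurable_coord.
split=> // A mA; rewrite /= /cons_measure.
have [_ E] := preserves_prod (preserves_line (row_uncons h).1)
  (IH (row_uncons h).2).
rewrite -(E _ (preimage_measurable (@measurable_row_cons R n) mA)).
congr (product_measure1 _ _ _); apply/seteqP.
suff E' p : row_cons (p.1 + (row_uncons h).1, p.2 + (row_uncons h).2) = row_cons p + h.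
  by split=> p /=; rewrite E'.
apply/rowP => i; rewrite [RHS]mxE; have [j ->|->] := unliftP ord0 i.
  by rewrite !row_consS/= !mxE.
by rewrite !row_cons0.
Qed.

Section space.
Context {n : nat}.
Local Notation space := ('rV[R]_n * R)%type.

(** The same set function as [vol], carrying the sigma-finiteness that measurability of sections and
    Fubini on pairs of points ask for. *)
Definition svol : {sigma_finite_measure set space -> \bar R} :=
  product_copy (lebesgue_row n) lebesgue_line.

Lemma preserves_vol (h : space) : preserves vol (fun x => x + h).
Proof.
exact: (@preserves_prod _ _ _ _ _ (lebesgue_row n) lebesgue_line
  _ _ (preserves_row h.1) (preserves_line h.2)).
Qed.

End space.
End translation.

Lemma xsectionE T1 T2 (A : set (T1 * T2)) x : xsection A x = [set y | A (x, y)].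
Proof. by apply/seteqP; split=> y; rewrite /xsection/= inE. Qed.

Lemma ysectionE T1 T2 (A : set (T1 * T2)) y : ysection A y = [set x | A (x, y)].
Proof. by apply/seteqP; split=> x; rewrite /ysection/= inE. Qed.

Section density_basis.
Context {R : realType}.
Local Open Scope ereal_scope.

(** Only countably many scales are kept, so that the conditions stay measurable, and all sets of one
    scale have the same measure [v j], so that sizes multiply in products. Each [B j] is a set of
    pairs because joint measurability in the centre and the point is needed for slicing. *)
Definition density_basis d (T : measurableType d) (m : set T -> \bar R)
    (B : nat -> set (T * T)) (v : nat -> R) :=
  [/\ forall j, (0 < v j)%R, forall j, measurable (B j),
      forall j x, m (xsection (B j) x) = (v j)%:E &
      forall A, measurable A ->
        {ae m, forall x, A x -> forall e : R, (0 < e)%R ->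
          \forall j \near \oo, m (xsection (B j) x `\` A) <= (e * v j)%:E}].

Lemma product_measureE d1 d2 (T1 : measurableType d1)
    (T2 : measurableType d2) (m1 : {sigma_finite_measure set T1 -> \bar R})
    (m2 : {sigma_finite_measure set T2 -> \bar R}) (A : set (T1 * T2)) :
  measurable A -> (m1 \x m2) A = \int[m2]_y m1 (ysection A y).
Proof.
move=> mA; rewrite (@product_measure_unique _ _ _ _ _ m1 m2 (m1 \x^ m2))//.
by move=> B C mB mC; exact: product_measure2E.
Qed.

Lemma negligible_xsection d1 d2 (T1 : measurableType d1)
    (T2 : measurableType d2) (m1 : {sigma_finite_measure set T1 -> \bar R})
    (m2 : {sigma_finite_measure set T2 -> \bar R}) (A : set (T1 * T2)) :
  measurable A -> (forall x, m2.-negligible (xsection A x)) ->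
  (m1 \x m2).-negligible A.
Proof.
move=> mA A0; exists A; split=> //.
rewrite [LHS]integral0_eq// => x _ /=.
by apply/negligibleP => //; exact: measurable_xsection.
Qed.

Lemma negligible_ysection d1 d2 (T1 : measurableType d1)
    (T2 : measurableType d2) (m1 : {sigma_finite_measure set T1 -> \bar R})
    (m2 : {sigma_finite_measure set T2 -> \bar R}) (A : set (T1 * T2)) :
  measurable A -> (forall y, m1.-negligible (ysection A y)) ->
  (m1 \x m2).-negligible A.
Proof.
move=> mA A0; exists A; split=> //.
rewrite product_measureE// integral0_eq// => x _ /=.
by apply/negligibleP => //; exact: measurable_ysection.
Qed.

Lemma measurable_section_le d1 d2 (T1 : measurableType d1)
    (T2 : measurableType d2) (m2 : {sigma_finite_measure set T2 -> \bar R})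
    (S : set (T1 * T2)) (c : \bar R) :
  measurable S -> measurable [set x | m2 (xsection S x) <= c].
Proof.
move=> mS; have := @measurable_fun_xsection _ _ _ _ _ m2 _ mS.
move=> /emeasurable_fun_infty_c => /(_ measurableT) /(_ c).
by rewrite setTI.
Qed.

Section product_basis.
Context d1 d2 (T1 : measurableType d1) (T2 : measurableType d2).
Variables (m1 : {sigma_finite_measure set T1 -> \bar R}).
Variables (m2 : {sigma_finite_measure set T2 -> \bar R}).
Variables (B1 : nat -> set (T1 * T1)) (B2 : nat -> set (T2 * T2)).
Variables (v1 v2 : nat -> R).
Hypothesis db1 : density_basis m1 B1 v1.
Hypothesis db2 : density_basis m2 B2 v2.

Definition product_basis j : set ((T1 * T2) * (T1 * T2)) :=
  [set p | B1 j (p.1.1, p.2.1) /\ B2 j (p.1.2, p.2.2)].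

Let xsection_basis j x : xsection (product_basis j) x =
  xsection (B1 j) x.1 `*` xsection (B2 j) x.2.
Proof.
by rewrite !xsectionE; apply/seteqP; split => -[a b].
Qed.

Let measurable_basis j : measurable (product_basis j).
Proof.
have [_ mB1 _ _] := db1; have [_ mB2 _ _] := db2.
apply: measurableI.
  apply: (@preimage_measurable _ _ _ _ (fun p : (T1 * T2) * (T1 * T2) => (p.1.1, p.2.1))) => //.
  by apply/measurable_fun_pair; do 2 apply: measurableT_comp => //.
apply: (@preimage_measurable _ _ _ _ (fun p : (T1 * T2) * (T1 * T2) => (p.1.2, p.2.2))) => //.
by apply/measurable_fun_pair; do 2 apply: measurableT_comp => //.
Qed.

Section fixed_set.
Variables (A : set (T1 * T2)) (mA : measurable A).

(* Points around which the horizontal slices of [A] have density close to one,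
   uniformly from the scale [k] on. *)
Definition dense_slice (p k : nat) : set (T1 * T2) := A `&`
  \bigcap_(j in [set j | (k <= j)%N]) [set x |
    m1 (xsection (B1 j) x.1 `\` ysection A x.2) <= (p.+1%:R^-1 * v1 j)%:E].

Lemma measurable_dense_slice p k : measurable (dense_slice p k).
Proof.
have [_ mB1 _ _] := db1.
apply: measurableI => //; apply: bigcap_measurable => [|j _]; first by exists k => /=.
pose S := [set z : (T1 * T2) * T1 | B1 j (z.1.1, z.2) /\ ~ A (z.2, z.1.2)].
have mS : measurable S.
  apply: measurableI.
    apply: (@preimage_measurable _ _ _ _ (fun z : (T1 * T2) * T1 => (z.1.1, z.2))) => //.
    by apply/measurable_fun_pair => //; do 2 apply: measurableT_comp => //.
  apply: (@preimage_measurable _ _ _ _ (fun z : (T1 * T2) * T1 => (z.2, z.1.2)) (~` A)) => //.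
    by apply/measurable_fun_pair => //; do 2 apply: measurableT_comp => //.
  exact: measurableC.
have := measurable_section_le m1 (p.+1%:R^-1 * v1 j)%:E mS.
congr (measurable _); apply/seteqP; split=> x /=; congr (m1 _ <= _).
all: by rewrite !xsectionE ?ysectionE.
Qed.

(** Density is asked of the vertical slice of [dense_slice p k] and not of [A]: at most heights near
    the point the horizontal bound then holds with the same [p] and [k]. *)
Definition dense_slice2 (p k l : nat) : set (T1 * T2) := 
  \bigcap_(j in [set j | (l <= j)%N]) [set x |
    m2 (xsection (B2 j) x.2 `\` xsection (dense_slice p k) x.1) <=
      (p.+1%:R^-1 * v2 j)%:E].

Lemma measurable_dense_slice2 p k l : measurable (dense_slice2 p k l).
Proof.
have [_ mB2 _ _] := db2.
apply: bigcap_measurable => [|j _]; first by exists l => /=.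
pose S := [set z : (T1 * T2) * T2 | B2 j (z.1.2, z.2) /\ ~ dense_slice p k (z.1.1, z.2)].
have mS : measurable S.
  apply: measurableI.
    apply: (@preimage_measurable _ _ _ _ (fun z : (T1 * T2) * T2 => (z.1.2, z.2))) => //.
    by apply/measurable_fun_pair => //; do 2 apply: measurableT_comp => //.
  apply: (@preimage_measurable _ _ _ _ (fun z : (T1 * T2) * T2 => (z.1.1, z.2)) (~` dense_slice p k)) => //.
    by apply/measurable_fun_pair => //; do 2 apply: measurableT_comp => //.
  by apply: measurableC; exact: measurable_dense_slice.
have := measurable_section_le m2 (p.+1%:R^-1 * v2 j)%:E mS.
congr (measurable _); apply/seteqP; split=> x /=; congr (m2 _ <= _).
all: by rewrite !xsectionE ?ysectionE.
Qed.

Lemma ae_dense_slice p :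
  {ae (m1 \x m2), forall x, A x -> exists k, dense_slice p k x}.
Proof.
have [v10 _ _ /(_ _ (measurable_ysection _ mA)) db] := db1.
suff : (m1 \x m2).-negligible (A `\` \bigcup_k dense_slice p k).
  by apply: negligibleS => x /not_implyP[Ax nx]; split=> // -[k _ ?]; apply: nx; exists k.
apply: negligible_ysection.
  apply: measurableD => //; apply: bigcup_measurable => k _.
  exact: measurable_dense_slice.
move=> y; apply: negligibleS (db y) => x; rewrite ysectionE/= => -[Axy nk].
have q0 : (0 < p.+1%:R^-1 :> R)%R by rewrite invr_gt0.
rewrite [X in X x -> _]ysectionE/= => /(_ Axy _ q0)[k _ kP].
apply: nk; exists k => //; split=> // j /=; exact: kP.
Qed.

Lemma ae_dense_slice2 p k :
  {ae (m1 \x m2), forall x, dense_slice p k x -> exists l, dense_slice2 p k l x}.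
Proof.
have [v20 _ _ /(_ _ (measurable_xsection _ (measurable_dense_slice p k))) db] := db2.
suff : (m1 \x m2).-negligible (dense_slice p k `\` \bigcup_l dense_slice2 p k l).
  by apply: negligibleS => x /not_implyP[Ax nx]; split=> // -[l _ ?]; apply: nx; exists l.
apply: negligible_xsection.
  apply: measurableD => //; first exact: measurable_dense_slice.
  by apply: bigcup_measurable => l _; exact: measurable_dense_slice2.
move=> x; apply: negligibleS (db x) => y; rewrite xsectionE/= => -[Dxy nl].
have q0 : (0 < p.+1%:R^-1 :> R)%R by rewrite invr_gt0.
rewrite [X in X y -> _]xsectionE/= => /(_ Dxy _ q0)[l _ lP].
by apply: nl; exists l => // j /= lj; exact: lP.
Qed.

(** Integrate over the heights the part of the horizontal slice that misses [A]. At heights in [D]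
    it is at most [v1 j / p.+1]; the remaining heights have measure at most [v2 j / p.+1] and cost
    at most a whole slice [v1 j] each. Hence the factor 2. *)
Lemma product_basis_bound p k j x :
  m2 (xsection (B2 j) x.2 `\` xsection (dense_slice p k) x.1) <=
      (p.+1%:R^-1 * v2 j)%:E -> (k <= j)%N ->
  (m1 \x m2) (xsection (product_basis j) x `\` A) <=
    (2 * p.+1%:R^-1 * (v1 j * v2 j))%:E.
Proof.
have [v10 mB1 v1E _] := db1; have [v20 mB2 v2E _] := db2.
move=> x2 kj; set D := xsection (dense_slice p k) x.1.
have mD : measurable D by apply: measurable_xsection; exact: measurable_dense_slice.
have mb1 : measurable (xsection (B1 j) x.1) by exact: measurable_xsection.
have mb2 : measurable (xsection (B2 j) x.2) by exact: measurable_xsection.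
rewrite xsection_basis product_measureE; last first.
  by apply: measurableD => //; exact: measurableX.
have mb2D : measurable (xsection (B2 j) x.2 `\` D) by exact: measurableD.
have mI (D' : set T2) (c : R) : measurable D' ->
    measurable_fun setT (fun y => c%:E * (\1_D' y)%:E).
  by move=> mD'; apply: measurable_funeM; exact/measurable_EFinP.
have I0 (D' : set T2) (c : R) y : (0 <= c)%R -> 0 <= c%:E * (\1_D' y)%:E.
  by move=> c0; rewrite mule_ge0// lee_fin.
have iE (D' : set T2) (c : R) : (0 <= c)%R -> measurable D' ->
    \int[m2]_y (c%:E * (\1_D' y)%:E) = c%:E * m2 D'.
  move=> c0 mD'; rewrite ge0_integralZl//; last by exact/measurable_EFinP.
  by rewrite integral_indic// setIT.
have q0 : (0 <= p.+1%:R^-1 * v1 j)%R by rewrite mulr_ge0 ?invr_ge0 1?ltW.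
apply: (@le_trans _ _ (\int[m2]_y ((p.+1%:R^-1 * v1 j)%:E *
    (\1_(xsection (B2 j) x.2) y)%:E
     + (v1 j)%:E * (\1_(xsection (B2 j) x.2 `\` D) y)%:E))).
  apply: ge0_le_integral => //.
  - apply: measurable_fun_ysection; apply: measurableD => //.
    exact: measurableX.
  - by apply: emeasurable_funD; apply: mI.
  move=> y _; have [b2y|b2y] := pselect (xsection (B2 j) x.2 y); last first.
    rewrite ysectionE [X in m1 X](_ : _ = set0).
      by rewrite measure0 adde_ge0// I0// ltW.
    by apply/seteqP; split => // z [[/= _ /b2y]].
  have -> : ysection (xsection (B1 j) x.1 `*` xsection (B2 j) x.2 `\` A) y =
      xsection (B1 j) x.1 `\` ysection A y.
    rewrite !ysectionE; apply/seteqP; split => z [].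
      by case.
    by move=> ? ?; split.
  have [Dy|Dy] := pselect (D y).
    rewrite [leRHS](_ : _ = (p.+1%:R^-1 * v1 j)%:E).
      by move: Dy; rewrite /D xsectionE /= => -[_ /(_ _ kj)].
    rewrite !indicE mem_set// memNset/=; last by case.
    by rewrite mule0 adde0 mule1.
  apply: (@le_trans _ _ (v1 j)%:E).
    rewrite -(v1E j x.1); apply: le_measure; rewrite ?inE//.
    by apply: measurableD => //; exact: measurable_ysection.
  by rewrite !indicE mem_set// mem_set//= !mule1 leeDr.
rewrite ge0_integralD//; last 4 first.
- by move=> y _; exact: I0.
- exact: mI.
- by move=> y _; rewrite I0// ltW.
- exact: mI.
rewrite !iE//; last by rewrite ltW.
rewrite v2E -EFinM.
apply: (@le_trans _ _ ((p.+1%:R^-1 * v1 j * v2 j)%:E +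
    (v1 j)%:E * (p.+1%:R^-1 * v2 j)%:E)).
  by rewrite leeD2l// lee_pmul2l// lte_fin.
rewrite -EFinM -EFinD lee_fin le_eqVlt; apply/orP; left; apply/eqP.
by set q := (p.+1%:R^-1)%R; ring.
Qed.

End fixed_set.

Lemma density_basis_prod :
  density_basis (m1 \x m2) product_basis (fun j => v1 j * v2 j)%R.
Proof.
have [v10 mB1 v1E _] := db1; have [v20 mB2 v2E _] := db2.
split=> [j|//|j x|A mA]; first by rewrite mulr_gt0.
  rewrite xsection_basis product_measure1E.
  - by rewrite EFinM -(v1E j x.1) -(v2E j x.2).
  - exact: measurable_xsection.
  - exact: measurable_xsection.
have H1 := ae_foralln (fun p => ae_dense_slice mA p).
have H2 := ae_foralln (fun p => ae_foralln (fun k => ae_dense_slice2 mA p k)).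
move: H1 H2; apply: filterS2 => x H1 H2 Ax e e0.
pose p := Num.truncn (2 / e).
have pe : (2 * p.+1%:R^-1 <= e)%R.
  rewrite ler_pdivrMr// -ler_pdivrMl// mulrC.
  exact: ltW (truncnS_gt _).
have [k xk] := H1 p Ax.
have [l xl] := H2 p k xk.
exists (maxn k l) => // j /=; rewrite geq_max => /andP[kj lj].
have := product_basis_bound mA (xl j lj) kj.
move=> /le_trans; apply; rewrite lee_fin ler_wpM2r//.
by rewrite mulr_ge0// ltW.
Qed.

End product_basis.
End density_basis.

Lemma near_dyadic (R : realType) (e : R) : 0 < e ->
  \forall j \near \oo, 2 ^- j < e.
Proof.
move=> e0; have := near_infty_natSinv_expn_lt (PosNum e0).
by apply: filterS => j; rewrite div1r.
Qed.

Section cube_basis.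
Context {R : realType}.
Local Open Scope ereal_scope.

Definition line_basis (j : nat) : set (R * R) :=
  [set p | (`|p.2 - p.1| < (2 ^- j))%R].

Definition row_basis n (j : nat) : set ('rV[R]_n * 'rV[R]_n) :=
  [set p | forall i : 'I_n, (`|(p.2 : 'rV[R]_n) ord0 i - (p.1 : 'rV[R]_n) ord0 i| < (2 ^- j))%R].

Let w j : R := (2 * 2 ^- j)%R.

Let w0 j : (0 < w j)%R. Proof. by rewrite mulr_gt0// invr_gt0 exprn_gt0. Qed.

Lemma density_basis_line : density_basis lebesgue_line line_basis w.
Proof.
have bE j x : xsection (line_basis j) x = ball (x : R) (2 ^- j)%R.
  by rewrite xsectionE; apply/seteqP; split => y; rewrite /ball/= distrC.
have r0 j : (0 < 2 ^- j :> R)%R by rewrite invr_gt0 exprn_gt0.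
have vE j x : lebesgue_line (ball (x : R) (2 ^- j)%R) = (w j)%:E.
  by rewrite /lebesgue_line lebesgue_measure_ball ?ltW// /w mulr_natl.
split => // [j|j x|A mA].
- apply: measurable_set_lt => //.
  by apply: measurableT_comp => //; apply: measurable_funB.
- by rewrite bE vE.
have [N [mN N0 NP]] := lebesgue_density mA.
exists N; split=> // x /= nP; apply: NP => + /=.
move=> Ax'; apply: nP => Ax e e0; move: Ax'.
rewrite /= indicE mem_set//= => /fine_cvgP[fin lim].
have e1 : (1 - e < 1)%R by rewrite ltrBlDr ltrDl.
have [/= d1 d10 H1] := fin; have [/= d2 d20 H2] := cvgr_gt _ lim _ e1.
have d120 : (0 < Num.min d1 d2)%R by rewrite lt_min d10 d20.
have := near_dyadic d120; apply: filterS => j; rewrite lt_min => /andP[j1 j2].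
have jj (d : R) : (2 ^- j < d)%R -> ball_ Num.norm 0%R d (2 ^- j).
  by rewrite /ball_/= sub0r normrN gtr0_norm.
have := H1 _ (jj _ j1) (r0 j); have := H2 _ (jj _ j2) (r0 j).
have E1 : lebesgue_measure (ball x (2 ^- j)%R) = (w j)%:E := vE j x.
rewrite bE E1 inver gt_eqF//.
have mb : measurable (ball (x : R) (2 ^- j)%R) by exact: measurable_ball.
have vw : lebesgue_line (A `&` ball (x : R) (2 ^- j)%R) <= (w j)%:E.
  by rewrite -(vE j x); apply: le_measure; rewrite ?inE//; exact: measurableI.
have fA : lebesgue_line (A `&` ball (x : R) (2 ^- j)%R) \is a fin_num.
  by rewrite ge0_fin_numE//; apply: le_lt_trans vw _; rewrite ltry.
have -> : lebesgue_line (ball (x : R) (2 ^- j)%R `\` A) =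
    (w j)%:E - lebesgue_line (A `&` ball (x : R) (2 ^- j)%R).
  rewrite setIC -(vE j x) measureD//.
  by apply: le_lt_trans (ltry (w j)); rewrite -(vE j x).
move: fA vw; rewrite -[lebesgue_line _]/(lebesgue_measure _).
case: (lebesgue_measure _) => //= r _ _.
rewrite ltr_pdivlMr// => h _; rewrite -EFinB lee_fin.
by move: h; rewrite mulrBl mul1r; lra.
Qed.

(** [row_uncons] turns a cube in dimension n + 1 into the product of an interval and a cube and
    respects the measures, so the induction step is [density_basis_prod]. In dimension zero the
    space is a point of mass one. *)
Lemma density_basis_row n :
  density_basis (lebesgue_row n) (@row_basis n) (fun j => w j ^+ n)%R.
Proof.
elim: n => [|n [wn0 mB mBE dB]].
  split=> [j|j|j x|A mA].
  - by rewrite expr0.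
  - by rewrite [X in measurable X](_ : _ = setT)//; apply/seteqP; split => // x _ [].
  - rewrite xsectionE /= /dirac indicE expr0 mem_set//.
    by case.
  - apply: aeW => x /= Ax e e0; near=> j; rewrite /= /dirac indicE memNset/=.
      by rewrite lee_fin mulr_ge0 ?exprn_ge0// ltW.
    by move=> [_]; rewrite [x]thinmx0 in Ax.
have [w1 mB1 mBE1 dB1] := density_basis_prod density_basis_line (And4 wn0 mB mBE dB).
have E j p : xsection (@row_basis n.+1 j) p = @row_uncons R n @^-1` xsection (product_basis line_basis (@row_basis n) j) (row_uncons p).
  rewrite !xsectionE; apply/seteqP; split => q /=; rewrite /product_basis/=.
    by move=> H; split => [|i]; rewrite ?mxE; exact: H.
  move=> [H0 H] i /=; have [k ->|->//] := unliftP ord0 i.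
  by have := H k; rewrite /= !mxE.
have mu := @measurable_row_uncons R n; have mc := @measurable_row_cons R n.
have uK : cancel (@row_uncons R n) (@row_cons R n).
  move=> v; apply/rowP => i; have [k ->|->] := unliftP ord0 i.
    by rewrite row_consS mxE.
  by rewrite row_cons0.
split=> [j|j|j p|A mA].
- by rewrite exprn_gt0.
- rewrite (_ : row_basis j = (fun p => (row_uncons p.1, row_uncons p.2)) @^-1` product_basis line_basis (@row_basis n) j).
    apply: preimage_measurable (mB1 j).
    by apply/measurable_fun_pair; apply: measurableT_comp.
  apply/seteqP; split => -[p q] H.
    have : xsection (row_basis j) p q by rewrite xsectionE.
    by rewrite E xsectionE.
  have : xsection (row_basis j) p q by rewrite E xsectionE.
  by rewrite xsectionE.
- rewrite /= /cons_measure E -comp_preimage (_ : _ \o _ = id).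
    by rewrite preimage_id mBE1 exprS.
  by apply/funext => q /=; rewrite row_consK.
- have [N [mN N0 NP]] := dB1 _ (preimage_measurable mc mA).
  exists (@row_uncons R n @^-1` N); split.
  + exact: preimage_measurable mu mN.
  + rewrite /= /cons_measure -comp_preimage (_ : _ \o _ = id) ?preimage_id//.
    by apply/funext => q /=; rewrite row_consK.
  + move=> p /= nP; apply: NP => H; apply: nP => Ap e e0.
    have /H : (row_cons (n:=n) @^-1` A) (row_uncons p) by rewrite /= uK.
    move=> /(_ _ e0); apply: filterS => j.
    rewrite /= /cons_measure exprS; congr (product_measure1 _ _ _ <= _).
    by rewrite E; apply/seteqP; split=> q /=; rewrite row_consK.
Unshelve. all: by end_near. Qed.

End cube_basis.

Lemma dyadic_bounds (R : realType) (r : R) (N : nat) : 0 < r -> r < 2 ^- N ->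
  exists2 j, (N <= j)%N & 2 ^- j.+1 <= r < 2 ^- j.
Proof.
move=> r0 rN.
have N1 : 2 ^- N <= 1 :> R by rewrite invf_le1 ?exprn_gt0// exprn_ege1// ler1n.
have [j] : exists j, 2 ^- j < r by have [j _ /(_ j (leqnn j))] := near_dyadic r0; exists j.
elim: j => [|j IH] jr.
  by have := lt_le_trans (lt_trans jr rN) N1; rewrite expr0 invr1 ltxx.
have [/IH//|rj] := ltP (2 ^- j) r.
have [jr2|] := ltP r (2 ^- j).
  exists j; last by rewrite jr2 ltW.
  rewrite leqNgt; apply/negP => jN.
  have : 2 ^- N <= 2 ^- j.+1 :> R.
    by rewrite lef_pV2 ?posrE ?exprn_gt0// ler_eXn2l// ltr1n.
  by rewrite leNgt (lt_trans jr).
move=> jr2; have e : r = 2 ^- j by apply/le_anti; rewrite rj.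
case: j e jr IH rj jr2 => [|j] e _ _ _ _.
  by have := lt_le_trans rN N1; rewrite e expr0 invr1 ltxx.
have lt2 : 2 ^- j.+1 < 2 ^- j :> R.
  by rewrite ltf_pV2 ?posrE ?exprn_gt0// exprS ltr_pMl ?exprn_gt0// ltr1n.
exists j; last by rewrite e lexx lt2.
have : (N <= j)%N; last by [].
rewrite leqNgt; apply/negP => jN; move: rN; rewrite e ltNge.
by rewrite lef_pV2 ?posrE ?exprn_gt0// ler_eXn2l ?ltr1n// jN.
Qed.

(** A radius between [2 ^- j.+1] and [2 ^- j] is treated by monotonicity, at the price of a fixed
    factor raised to the power [d]. The constant [c] absorbs the side [2 * 2 ^- j] of a cube. *)
Lemma dyadic_near (R : realType) (g : R -> \bar R) (d : nat) (c : R) : 0 <= c ->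
  {in Num.pos &, {homo g : r s / r <= s >-> (r <= s)%E}} ->
  (forall e, 0 < e -> \forall j \near \oo, (g (2 ^- j) <= (e * (c * 2 ^- j) ^+ d)%:E)%E) ->
  forall e, 0 < e -> \forall r \near 0^'+, (g r <= (e * r ^+ d)%:E)%E.
Proof.
move=> c0 gm H e e0.
(* The summand 1 keeps the divisor positive when [c] is 0. *)
have k0 : 0 < (c * 2 + 1) ^+ d by rewrite exprn_gt0// ltr_wpDl// mulr_ge0.
have [N _ HN] := H _ (divr_gt0 e0 k0).
near=> r.
have r0 : 0 < r by near: r; exact: nbhs_right_gt.
have rN : r < 2 ^- N by near: r; apply: nbhs_right_lt; rewrite invr_gt0 exprn_gt0.
have [j Nj /andP[rj rj2]] := dyadic_bounds r0 rN.
apply: (@le_trans _ _ (g (2 ^- j))).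
  by apply: gm; rewrite ?posrE ?invr_gt0 ?exprn_gt0// ltW.
apply: le_trans (HN _ Nj) _; rewrite lee_fin -mulrA ler_pM2l//.
have h : 2 ^- j <= 2 * r.
  by rewrite -ler_pdivrMl//; apply: le_trans rj; rewrite exprS invfM.
have h2 : c * 2 ^- j <= r * (c * 2 + 1).
  by apply: (@le_trans _ _ (c * (2 * r))); [rewrite ler_wpM2l|lra].
rewrite mulrC ler_pdivrMr// -exprMn; apply: lerXn2r => //.
  by rewrite nnegrE mulr_ge0// invr_ge0 exprn_ge0.
by rewrite nnegrE mulr_ge0 ?addr_ge0 ?mulr_ge0// ltW.
Unshelve. all: by end_near. Qed.

(** * Cubes, Euclidean balls and measurability of open sets *)

Section cubes.
Context {R : realType} {n : nat}.
Local Notation space := ('rV[R]_n * R)%type.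
Local Open Scope ereal_scope.

Definition rcube (z : 'rV[R]_n) (r : R) : set 'rV[R]_n :=
  [set y : 'rV[R]_n | forall i, (`|y ord0 i - z ord0 i| < r)%R].

Definition cube (x : space) (r : R) : set space :=
  [set y | rcube x.1 r y.1 /\ (`|y.2 - x.2| < r)%R].

Lemma measurable_coord_fun d (T : measurableType d) (f : T -> 'rV[R]_n) i :
  measurable_fun setT f -> measurable_fun setT (fun x => f x ord0 i).
Proof. by move=> mf; exact: (measurableT_comp (measurable_coord i) mf). Qed.

Lemma measurable_fun_rowD d (T : measurableType d) (f g : T -> 'rV[R]_n) :
  measurable_fun setT f -> measurable_fun setT g ->
  measurable_fun setT (fun x => f x + g x)%R.
Proof.
move=> mf mg; apply: measurable_fun_row => i; under eq_fun do rewrite mxE.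
by apply: measurable_funD; exact: measurable_coord_fun.
Qed.

Lemma measurable_fun_rowB d (T : measurableType d) (f g : T -> 'rV[R]_n) :
  measurable_fun setT f -> measurable_fun setT g ->
  measurable_fun setT (fun x => f x - g x)%R.
Proof.
move=> mf mg; apply: measurable_fun_row => i; under eq_fun do rewrite !mxE.
by apply: measurable_funB; exact: measurable_coord_fun.
Qed.

Lemma measurable_fun_spaceD d (T : measurableType d) (f g : T -> space) :
  measurable_fun setT f -> measurable_fun setT g ->
  measurable_fun setT (fun x => f x + g x)%R.
Proof.
move=> mf mg; apply/measurable_fun_pair.
  by apply: measurable_fun_rowD; exact: measurableT_comp.
by apply: measurable_funD; exact: measurableT_comp.
Qed.

Lemma measurable_fun_spaceB d (T : measurableType d) (f g : T -> space) :
  measurable_fun setT f -> measurable_fun setT g ->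
  measurable_fun setT (fun x => f x - g x)%R.
Proof.
move=> mf mg; apply/measurable_fun_pair.
  by apply: measurable_fun_rowB; exact: measurableT_comp.
by apply: measurable_funB; exact: measurableT_comp.
Qed.

Lemma measurable_rcube z r : measurable (rcube z r).
Proof.
rewrite (_ : rcube z r = \big[setI/setT]_(i < n) [set y : 'rV[R]_n | (`|y ord0 i - z ord0 i| < r)%R]).
  apply: bigsetI_measurable => i _; apply: measurable_set_lt => //.
  by apply: measurableT_comp => //; apply: measurable_funB => //; exact: measurable_coord.
apply/seteqP; split=> v /=; rewrite -bigcap_seq/= => H i.
  by move=> _; exact: H.
by apply: (H i) => /=; rewrite mem_index_enum.
Qed.

Lemma measurable_cube x r : measurable (cube x r).
Proof.
rewrite (_ : cube x r = rcube x.1 r `*` [set t | `|t - x.2| < r]%R)//.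
apply: measurableX; first exact: measurable_rcube.
by apply: measurable_set_lt => //; apply: measurableT_comp => //; apply: measurable_funB.
Qed.

Lemma lebesgue_line_ball (t r : R) : (0 <= r)%R ->
  lebesgue_line [set s | `|s - t| < r]%R = (2 * r)%:E.
Proof.
move=> r0; rewrite (_ : [set _ | _] = ball (t : R) r).
  by rewrite /lebesgue_line lebesgue_measure_ball// mulr_natl.
by apply/seteqP; split => y; rewrite /ball/= distrC.
Qed.

Lemma lebesgue_row_cube z r : (0 <= r)%R ->
  lebesgue_row n (rcube z r) = ((2 * r) ^+ n)%:E.
Proof.
move=> r0.
have := @lebesgue_row_box R n (fun i => [set s | `|s - z ord0 i| < r]%R).
rewrite -/(rcube z r) => ->.
  under eq_bigr do rewrite lebesgue_line_ball//.
  by rewrite prodEFin prodr_const card_ord.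
by move=> i; apply: measurable_set_lt => //; apply: measurableT_comp => //; apply: measurable_funB.
Qed.

Lemma vol_cube x r : (0 <= r)%R -> vol (cube x r) = ((2 * r) ^+ n.+1)%:E.
Proof.
move=> r0; rewrite (_ : cube x r = rcube x.1 r `*` [set t | `|t - x.2| < r]%R)//.
rewrite [LHS]product_measure1E.
- by rewrite [X in X * _]lebesgue_row_cube// [X in _ * X]lebesgue_line_ball// exprSr.
- exact: measurable_rcube.
- by apply: measurable_set_lt => //; apply: measurableT_comp => //; apply: measurable_funB.
Qed.

Lemma row_density (A : set 'rV[R]_n) : measurable A ->
  {ae lebesgue_row n, forall z, A z -> forall e : R, (0 < e)%R ->
    \forall r \near 0^'+, lebesgue_row n (rcube z r `\` A) <= (e * r ^+ n)%:E}.
Proof.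
move=> mA; have [_ _ _ /(_ _ mA)] := density_basis_row (R := R) n.
apply: filterS => z H Az; apply: (@dyadic_near _ _ _ 2%R) => //.
  move=> r s _ _ rs; apply: le_measure; rewrite ?inE.
  - exact: measurableD (measurable_rcube _ _) mA.
  - exact: measurableD (measurable_rcube _ _) mA.
  - by move=> y [yr nA]; split=> // i; exact: lt_le_trans rs.
move=> e e0; have := H Az _ e0; apply: filterS => j.
by rewrite xsectionE.
Qed.

Lemma space_density (A : set space) : measurable A ->
  {ae vol, forall x, A x -> forall e : R, (0 < e)%R ->
    \forall r \near 0^'+, vol (cube x r `\` A) <= (e * r ^+ n.+1)%:E}.
Proof.
move=> mA.
have [_ _ _ /(_ _ mA)] :=
  density_basis_prod (density_basis_row (R := R) n) density_basis_line.
apply: filterS => x H Ax; apply: (@dyadic_near _ _ _ 2%R) => //.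
  move=> r s _ _ rs; apply: le_measure; rewrite ?inE.
  - exact: measurableD (measurable_cube _ _) mA.
  - exact: measurableD (measurable_cube _ _) mA.
  - move=> y [[yr yr2] nA]; split=> //; split; last exact: lt_le_trans rs.
    by move=> i; exact: lt_le_trans rs.
move=> e e0; have := H Ax _ e0; apply: filterS => j.
by rewrite xsectionE exprSr.
Qed.

Lemma cube_ball (x : space) (r : R) : (0 < r)%R -> cube x r `<=` ball x r.
Proof.
move=> r0 y [y1 y2]; split.
  by split=> // i j; rewrite (ord1 i) /ball/= distrC; exact: y1.
by rewrite /ball/= distrC.
Qed.

Lemma ball_cube (x : space) (r : R) : ball x r `<=` cube x r.
Proof.
move=> y [y1 y2]; split=> [i|].
  have := y1; rewrite /ball/= => -[_ /(_ ord0 i)].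
  by rewrite /ball/= distrC.
by move: y2; rewrite /ball/= distrC.
Qed.

(** The measurable structure is a product structure, so openness has to be converted: an open set is
    the union of the cubes with rational centre and dyadic radius that it contains, enumerated
    through [pickle]. *)
Lemma open_measurable_space (U : set space) : open U -> measurable U.
Proof.
move=> oU.
pose c (q : 'rV[rat]_n * rat * nat) : set space :=
  cube (\row_i (ratr (q.1.1 ord0 i) : R), ratr q.1.2) (2 ^- q.2).
pose F k := if unpickle k is Some q then
  if `[< c q `<=` U >] then c q else set0 else set0.
have -> : U = \bigcup_k F k.
  apply/seteqP; split=> [x Ux|x [k _]]; last first.
    rewrite /F; case: unpickle => [q|//]; case: asboolP => // + cqx; exact.
  have /nbhs_ballP[e /= e0 eU] := open_nbhs_nbhs (conj oU Ux).
  (* Half of [e], since the rational centre may be one radius away from [x] and the cube adds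
     another. *)
  have [j _ /(_ j (leqnn j))/= je] := near_dyadic (divr_gt0 e0 (ltr0Sn _ 1)).
  have j0 : (0 < 2 ^- j :> R)%R by rewrite invr_gt0 exprn_gt0.
  have rr (s : R) : exists q : rat, (`|s - ratr q| < 2 ^- j)%R.
    have /rat_in_itvoo[q] : (s - 2 ^- j < s + 2 ^- j)%R by rewrite ltrD2l gtrN.
    by rewrite in_itv/= => h; exists q; rewrite ltr_norml; lra.
  have [q1 q1P] := choice (fun i => rr (x.1 ord0 i)).
  have [q2 q2P] := rr x.2.
  pose q := (\row_i q1 i, q2, j).
  have qU : c q `<=` U.
    move=> y [y1 y2]; apply/eU/cube_ball => //; split => [i|].
      move: (y1 i) (q1P i); rewrite !mxE; move: (y.1 ord0 i) (x.1 ord0 i) => a b.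
      by rewrite !ltr_norml/=; lra.
    by move: y2 q2P; rewrite /= !ltr_norml; lra.
  exists (pickle q); [exact: I|rewrite /F pickleK asboolT//].
  by split=> [i|//]; rewrite !mxE; exact: q1P.
apply: bigcup_measurable => k _; rewrite /F; case: unpickle => [q|//].
by case: asboolP => // _; exact: measurable_cube.
Qed.

Lemma continuous_measurable_space (f : space -> R) :
  continuous f -> measurable_fun setT f.
Proof.
move=> cf; apply: (measurability _ (RGenOpens.measurableE R)).
move=> _ [_ [a [b ->] <-]]; rewrite setTI; apply: open_measurable_space.
by move/continuousP : cf; apply; exact: interval_open.
Qed.

Definition sqnorm (x : space) : R :=
  (\sum_(i < n) x.1 ord0 i ^+ 2 + x.2 ^+ 2)%R.

Lemma sqnorm_ge0 x : (0 <= sqnorm x)%R.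
Proof. by rewrite addr_ge0 ?sqr_ge0// sumr_ge0// => i _; rewrite sqr_ge0. Qed.

Lemma enorm_lt (x : space) r : (0 < r)%R -> (enorm x < r)%R = (sqnorm x < r ^+ 2)%R.
Proof.
move=> r0; rewrite -[in RHS](sqr_sqrtr (sqnorm_ge0 x)).
by rewrite ltr_pXn2r ?nnegrE ?sqrtr_ge0// ltW.
Qed.

Lemma enorm_le1 (x : space) : (enorm x <= 1)%R = (sqnorm x <= 1)%R.
Proof.
rewrite -[in RHS](sqr_sqrtr (sqnorm_ge0 x)) -[in RHS](expr1n R 2).
by rewrite ler_pXn2r ?nnegrE ?sqrtr_ge0.
Qed.

Lemma coord_le_enorm (x : space) i : (`|x.1 ord0 i| <= enorm x)%R.
Proof.
rewrite -sqrtr_sqr ler_wsqrtr// (bigD1 i)//= -addrA lerDl addr_ge0 ?sqr_ge0//.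
by rewrite sumr_ge0// => j _; rewrite sqr_ge0.
Qed.

Lemma last_le_enorm (x : space) : (`|x.2| <= enorm x)%R.
Proof.
rewrite -sqrtr_sqr ler_wsqrtr// lerDr.
by rewrite sumr_ge0// => j _; rewrite sqr_ge0.
Qed.

Lemma eball_cube (x : space) r : eball x r `<=` cube x r.
Proof.
move=> y; rewrite /eball/= => h; split=> [i|].
  by apply: le_lt_trans h; have := coord_le_enorm (y - x)%R i; rewrite !mxE.
by apply: le_lt_trans h; exact: (last_le_enorm (y - x)%R).
Qed.

Lemma cube_eball (x : space) r : (0 < r)%R ->
  cube x (r / n.+1%:R) `<=` eball x r.
Proof.
move=> r0 y [y1 y2]; rewrite /eball/= enorm_lt//.
set s := (r / n.+1%:R)%R in y1 y2.
have s0 : (0 < s)%R by rewrite divr_gt0.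
have sq (a : R) : (`|a| < s)%R -> (a ^+ 2 < s ^+ 2)%R.
  by move=> h; rewrite -[(a ^+ 2)%R]real_normK ?num_real// ltr_pXn2r ?nnegrE// ltW.
apply: (@lt_le_trans _ _ (n.+1%:R * s ^+ 2)%R).
  rewrite /sqnorm -natr1 mulrDl mul1r ler_ltD//; last exact: sq.
  rewrite mulr_natl -[X in (_ *+ X)%R]card_ord -sumr_const; apply: ler_sum => i _.
  by rewrite ltW// sq//= !mxE; exact: y1.
rewrite /s exprMn mulrCA ler_piMr ?sqr_ge0// expr2 mulrA divff ?mul1r//.
by rewrite invf_le1 ?ler1n.
Qed.

Lemma sqnorm_continuous : continuous (sqnorm : space -> R).
Proof.
move=> x; apply: cvgD.
  apply: cvg_big => [|i _]; first exact: add_continuous.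
  apply: (@cvg_comp _ _ _ (fun y : space => y.1 ord0 i) (fun t => t ^+ 2)%R).
    apply: (@cvg_comp _ _ _ fst (fun z : 'rV[R]_n => z ord0 i)); first exact: cvg_fst.
    exact: coord_continuous.
  exact: exprn_continuous.
apply: (@cvg_comp _ _ _ snd (fun t : R => t ^+ 2)%R); first exact: cvg_snd.
exact: exprn_continuous.
Qed.

Lemma enorm_continuous : continuous (enorm : space -> R).
Proof.
move=> x; apply: (@cvg_comp _ _ _ sqnorm Num.sqrt); first exact: sqnorm_continuous.
exact: sqrt_continuous.
Qed.

End cubes.

(** * Points of density one for Euclidean balls *)

Section density.
Context {R : realType} {n : nat}.
Local Notation space := ('rV[R]_n * R)%type.
Local Open Scope ereal_scope.

Lemma measurable_eball (x : space) r : measurable (eball x r).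
Proof.
apply: measurable_set_lt => //.
apply: (measurableT_comp (continuous_measurable_space enorm_continuous)).
exact: measurable_fun_spaceB.
Qed.

Lemma measurable_Omega : measurable (Omega : set space).
Proof. by apply: measurable_set_lt. Qed.

Lemma vol_eball_le (x : space) r : (0 <= r)%R ->
  vol (eball x r) <= ((2 * r) ^+ n.+1)%:E.
Proof.
move=> r0; rewrite -(vol_cube x r0); apply: le_measure; rewrite ?inE.
- exact: measurable_eball.
- exact: measurable_cube.
- exact: eball_cube.
Qed.

(** Volume of a cube inscribed in the unit ball. Volumes of balls enter only through comparison with
    powers of the radius, so this lower bound replaces the exact constant. *)
Definition ball_const : R := ((2 / n.+1%:R) ^+ n.+1)%R.

Lemma ball_const_gt0 : (0 < ball_const)%R.
Proof. by rewrite exprn_gt0// divr_gt0. Qed.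

Lemma vol_eball_ge (x : space) r : (0 < r)%R ->
  (ball_const * r ^+ n.+1)%:E <= vol (eball x r).
Proof.
move=> r0; rewrite /ball_const -exprMn mulrAC.
rewrite -mulrA -(vol_cube x (divr_ge0 (ltW r0) (ler0n _ n.+1))).
apply: le_measure; rewrite ?inE.
- exact: measurable_cube.
- exact: measurable_eball.
- exact: cube_eball.
Qed.

Lemma vol_eball_gt0 (x : space) r : (0 < r)%R -> 0 < vol (eball x r).
Proof.
move=> r0; apply: lt_le_trans (vol_eball_ge x r0).
by rewrite lte_fin mulr_gt0 ?ball_const_gt0// exprn_gt0.
Qed.

Lemma vol_eball_fin (x : space) r : (0 <= r)%R -> vol (eball x r) \is a fin_num.
Proof.
move=> r0; rewrite ge0_fin_numE//; exact: le_lt_trans (vol_eball_le x r0) (ltry _).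
Qed.

(** The quotient of extended reals becomes an additive bound, which is stable under inclusions and
    changes on null sets. Ball volumes are compared with [r ^+ n.+1] from above by the circumscribed
    cube and from below by [ball_const]. *)
Lemma density_oneP (A : set space) (x : space) : measurable A ->
  density_one A x <-> forall e : R, (0 < e)%R ->
    \forall r \near 0^'+, vol (eball x r `\` A) <= (e * r ^+ n.+1)%:E.
Proof.
move=> mA; have mB r : measurable (eball x r) by exact: measurable_eball.
have split_ball r : (0 < r)%R ->
    vol (eball x r `\` A) = (fine (vol (eball x r)) - fine (vol (A `&` eball x r)))%:E.
  move=> r0; have f := vol_eball_fin x (ltW r0).
  have f' : vol (A `&` eball x r) \is a fin_num.
    rewrite ge0_fin_numE//; apply: le_lt_trans (_ : vol (eball x r) < +oo).
      by apply: le_measure; rewrite ?inE//; exact: measurableI.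
    by rewrite -ge0_fin_numE.
  rewrite measureD//; last by rewrite -ge0_fin_numE.
  by rewrite setIC EFinB !fineK.
have ratio r : (0 < r)%R -> vol (A `&` eball x r) / vol (eball x r) =
    (fine (vol (A `&` eball x r)) / fine (vol (eball x r)))%:E.
  move=> r0; have f := vol_eball_fin x (ltW r0).
  have f' : vol (A `&` eball x r) \is a fin_num.
    rewrite ge0_fin_numE//; apply: le_lt_trans (_ : vol (eball x r) < +oo).
      by apply: le_measure; rewrite ?inE//; exact: measurableI.
    by rewrite -ge0_fin_numE.
  rewrite -{1}(fineK f') -{1}(fineK f) inver gt_eqF// fine_gt0//.
  by rewrite vol_eball_gt0//= -ge0_fin_numE.
have pos r : (0 < r)%R -> (0 < fine (vol (eball x r)))%R.
  move=> r0; rewrite fine_gt0// vol_eball_gt0//= -ge0_fin_numE//.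
  by rewrite vol_eball_fin// ltW.
split=> [|H].
- move=> /fine_cvgP[fin lim] e e0.
  pose e' := (e / 2 ^+ n.+1)%R.
  have e'0 : (0 < e')%R by rewrite divr_gt0// exprn_gt0.
  have e'1 : (1 - e' < 1)%R by rewrite ltrBlDr ltrDl.
  have lim1 := cvgr_gt _ lim _ e'1; near=> r.
  have r0 : (0 < r)%R by near: r; exact: nbhs_right_gt.
  have : (1 - e' < fine (vol (A `&` eball x r) / vol (eball x r)))%R.
    by near: r; exact: lim1.
  rewrite ratio//= ltr_pdivlMr ?pos// split_ball// lee_fin => h.
  apply: (@le_trans _ _ (e' * fine (vol (eball x r)))%R).
    by move: h; rewrite mulrBl mul1r; lra.
  have := vol_eball_le x (ltW r0); rewrite -(fineK (vol_eball_fin x (ltW r0))) lee_fin => h2.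
  apply: (@le_trans _ _ (e' * (2 * r) ^+ n.+1)%R); first by rewrite ler_pM2l.
  by rewrite exprMn mulrA /e' divfK// expf_neq0.
- apply/fine_cvgP; split.
    near=> r; rewrite ratio//; by near: r; exact: nbhs_right_gt.
  apply/cvgrPdist_le => e e0; have k0 := mulr_gt0 e0 ball_const_gt0.
  have H1 := H _ k0; near=> r.
  have r0 : (0 < r)%R by near: r; exact: nbhs_right_gt.
  have : vol (eball x r `\` A) <= (e * ball_const * r ^+ n.+1)%:E by near: r; exact: H1.
  rewrite /comp ratio//= split_ball// lee_fin => h.
  have f := vol_eball_fin x (ltW r0).
  have p := pos _ r0.
  rewrite -[X in (X - _)%R](divff (lt0r_neq0 p)) -mulrBl normrM (gtr0_norm (_ : 0 < _^-1)%R) ?invr_gt0//.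
  rewrite ler_pdivrMr// ger0_norm.
    apply: le_trans h _; rewrite -mulrA ler_pM2l//.
    by have := vol_eball_ge x r0; rewrite -{1}(fineK f) lee_fin.
  rewrite subr_ge0 fine_le//.
    rewrite ge0_fin_numE//; apply: le_lt_trans (_ : vol (eball x r) < +oo).
      by apply: le_measure; rewrite ?inE//; exact: measurableI.
    by rewrite -ge0_fin_numE.
  by apply: le_measure; rewrite ?inE//; exact: measurableI.
Unshelve. all: by end_near. Qed.

Lemma density_one_dyadic (A : set space) (x : space) : measurable A ->
  density_one A x <-> forall e : R, (0 < e)%R ->
    \forall j \near \oo, vol (eball x (2 ^- j) `\` A) <= (e * (2 ^- j) ^+ n.+1)%:E.
Proof.
move=> mA; rewrite density_oneP//; split=> H e e0.
  have [/= d d0 dH] := H _ e0; have := near_dyadic d0; apply: filterS => j jd.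
  have j0 : (0 < 2 ^- j :> R)%R by rewrite invr_gt0 exprn_gt0.
  by apply: dH => //; rewrite /ball_/= sub0r normrN gtr0_norm.
have gm : {in Num.pos &, {homo (fun r => vol (eball x r `\` A)) : r s /
     (r <= s)%R >-> (r <= s)%E}}.
  move=> r s _ _ rs; apply: le_measure; rewrite ?inE.
  - by apply: measurableD => //; exact: measurable_eball.
  - by apply: measurableD => //; exact: measurable_eball.
  - by move=> y [yr nA]; split=> //; exact: lt_le_trans rs.
apply: (dyadic_near (c := 1%R) _ gm) => // e' e'0.
by under eq_near do rewrite mul1r; exact: H.
Qed.

(** With dyadic radii and tolerances [k.+1%:R^-1] all quantifiers are countable, and for a fixed
    radius the volume of the missing part is a measurable function of the centre. *)
Lemma measurable_density_one (A : set space) : measurable A ->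
  measurable (density_one A).
Proof.
move=> mA; pose B k l := \bigcap_(j in [set j | (l <= j)%N]) [set x : space |
  svol (eball x (2 ^- j) `\` A) <= (k.+1%:R^-1 * (2 ^- j) ^+ n.+1)%:E].
have mB k l : measurable (B k l).
  apply: bigcap_measurable => [|j _]; first by exists l => /=.
  pose S := [set z : space * space | (enorm (z.2 - z.1) < 2 ^- j)%R /\ ~ A z.2].
  have mS : measurable S.
    apply: measurableI.
      apply: measurable_set_lt => //.
      apply: (measurableT_comp (continuous_measurable_space enorm_continuous)).
      exact: measurable_fun_spaceB.
    apply: (@preimage_measurable _ _ _ _ (fun z : space * space => z.2) (~` A)).
      exact: measurable_snd.
    exact: measurableC.
  have := measurable_section_le svol (k.+1%:R^-1 * (2 ^- j) ^+ n.+1)%:E mS.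
  by congr (measurable _); apply/seteqP; split=> x /=; rewrite xsectionE.
rewrite (_ : density_one A = \bigcap_k \bigcup_l B k l).
  by apply: bigcap_measurable => // k _; apply: bigcup_measurable => l _.
apply/seteqP; split=> x; rewrite density_one_dyadic//.
  move=> H k _; have k0 : (0 < k.+1%:R^-1 :> R)%R by rewrite invr_gt0.
  have [l _ lH] := H _ k0; exists l => // j /=; exact: lH.
move=> H e e0; have [l _ lH] := H (Num.truncn e^-1) I.
exists l => // j /= /lH /= /le_trans; apply; rewrite lee_fin ler_wpM2r//.
rewrite -[leRHS]invrK lef_pV2 ?posrE ?invr_gt0//.
by rewrite ltW// truncnS_gt.
Qed.

(** Use the density theorem for [A] and for its complement. At a generic point outside [A], density
    one would cover some ball by two pieces of at most a quarter of [ball_const * r ^+ n.+1] each,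
    less than the volume of the ball. *)
Lemma ae_density_one (A : set space) : measurable A ->
  {ae vol, forall x, density_one A x <-> A x}.
Proof.
move=> mA; have H1 := space_density mA; have H2 := space_density (measurableC mA).
move: H1 H2; apply: filterS2 => x H1 H2; split=> [|Ax].
  rewrite density_oneP// => H; apply: contrapT => nAx.
  have k0 : (0 < ball_const / 4)%R by rewrite divr_gt0// ball_const_gt0.
  have F1 := H _ k0; have F2 := H2 nAx _ k0.
  have [r [r0 []]] : exists r : R, (0 < r)%R /\ (vol (eball x r `\` A) <= (ball_const / 4 * r ^+ n.+1)%:E /\ vol (cube x r `\` ~` A) <= (ball_const / 4 * r ^+ n.+1)%:E).
    have [/= d1 d10 {}F1] := F1; have [/= d2 d20 {}F2] := F2.
    pose r := (Num.min d1 d2 / 2)%R.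
    have m0 : (0 < Num.min d1 d2)%R by rewrite lt_min d10 d20.
    have r0 : (0 < r)%R by rewrite divr_gt0.
    have rm : (r < Num.min d1 d2)%R by rewrite ltr_pdivrMr// ltr_pMr// ltr1n.
    have rb d : (Num.min d1 d2 <= d)%R -> ball_ Num.norm 0%R d r.
      by move=> md; rewrite /ball_/= sub0r normrN gtr0_norm// (lt_le_trans rm).
    exists r; split=> //; split.
      by apply: F1 => //; apply: rb; rewrite ge_min lexx.
    by apply: F2 => //; apply: rb; rewrite ge_min lexx orbT.
  move=> h1 h2; have := vol_eball_ge x r0.
  apply/negP; rewrite -ltNge.
  have mB := measurable_eball x r.
  rewrite (measureDI _ mB mA).
  have h3 : vol (eball x r `&` A) <= (ball_const / 4 * r ^+ n.+1)%:E.
    apply: le_trans h2; apply: le_measure; rewrite ?inE.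
    - exact: measurableI.
    - by rewrite setDE setCK; apply: measurableI => //; exact: measurable_cube.
    - by move=> y [/eball_cube ? ?]; split=> //; exact.
  apply: le_lt_trans (leeD h1 h3) _; rewrite -EFinD lte_fin.
  have : (0 < ball_const * r ^+ n.+1)%R by rewrite mulr_gt0 ?ball_const_gt0 ?exprn_gt0.
  by rewrite -!mulrA [(4^-1 * _)%R]mulrC !mulrA; lra.
rewrite density_oneP// => e e0; have := H1 Ax _ e0; apply: filterS => r.
apply: le_trans; apply: le_measure; rewrite ?inE.
- exact: measurableD (measurable_eball _ _) mA.
- exact: measurableD (measurable_cube _ _) mA.
- by move=> y [/eball_cube].
Qed.

End density.

(** * Differential calculus *)

Lemma eq_continuous (T U : topologicalType) (f g : T -> U) :
  f =1 g -> continuous f -> continuous g.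
Proof. by move=> /funext ->. Qed.

Section continuously_differentiable.
Context {R : realType}.
Implicit Types V : normedModType R.

(** Continuity is asked in each fixed direction, as in [C1c_Omega], so that no topology on spaces of
    linear maps is involved. *)
Definition C1 V (f : V -> R) :=
  (forall x, differentiable f x) /\ forall v, continuous (fun x => 'D_v f x).

Lemma C1_continuous V (f : V -> R) : C1 f -> continuous f.
Proof. by move=> [df _] x; exact: differentiable_continuous. Qed.

Lemma C1_derivable V (f : V -> R) x v : C1 f -> derivable f x v.
Proof. by move=> [df _]; exact: diff_derivable. Qed.

Lemma eq_C1 V (f g : V -> R) : f =1 g -> C1 f -> C1 g.
Proof. by move=> /funext ->. Qed.

Lemma C1_cst V (c : R) : C1 (fun _ : V => c).
Proof.
split=> [x|v]; first exact: differentiable_cst.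
apply: (@eq_continuous _ _ (cst 0)) => y; last exact: cvg_cst.
by rewrite -[RHS]/('D_v (cst c) y) derive_cst.
Qed.

Lemma deriveD_C1 V (f g : V -> R) x v : C1 f -> C1 g ->
  'D_v (fun y => f y + g y) x = 'D_v f x + 'D_v g x.
Proof. by move=> cf cg; rewrite -deriveD//; exact: C1_derivable. Qed.

Lemma deriveM_C1 V (f g : V -> R) x v : C1 f -> C1 g ->
  'D_v (fun y => f y * g y) x = f x * 'D_v g x + g x * 'D_v f x.
Proof. by move=> cf cg; rewrite -deriveM//; exact: C1_derivable. Qed.

Lemma C1D V (f g : V -> R) : C1 f -> C1 g -> C1 (fun x => f x + g x).
Proof.
move=> cf cg; split=> [x|v].
  by apply: differentiableD; [exact: cf.1|exact: cg.1].
apply: (@eq_continuous _ _ (fun y => 'D_v f y + 'D_v g y)) => y.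
  by rewrite deriveD_C1.
by apply: cvgD; [exact: cf.2|exact: cg.2].
Qed.

Lemma C1M V (f g : V -> R) : C1 f -> C1 g -> C1 (fun x => f x * g x).
Proof.
move=> cf cg; split=> [x|v].
  by apply: differentiableM; [exact: cf.1|exact: cg.1].
apply: (@eq_continuous _ _ (fun y => f y * 'D_v g y + g y * 'D_v f y)) => y.
  by rewrite deriveM_C1.
by apply: cvgD; apply: cvgM; [exact: C1_continuous|exact: cg.2|
  exact: C1_continuous|exact: cf.2].
Qed.

Lemma C1N V (f : V -> R) : C1 f -> C1 (fun x => - f x).
Proof.
move=> cf; apply: eq_C1 (C1M (C1_cst V (-1)) cf) => x.
by rewrite mulN1r.
Qed.

Lemma deriveN_C1 V (f : V -> R) x v : C1 f -> 'D_v (fun y => - f y) x = - 'D_v f x.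
Proof. by move=> cf; rewrite -deriveN//; exact: C1_derivable. Qed.

Lemma C1B V (f g : V -> R) : C1 f -> C1 g -> C1 (fun x => f x - g x).
Proof. by move=> cf cg; apply: C1D => //; exact: C1N. Qed.

Lemma deriveE_C1 V (f : V -> R) x v : C1 f -> 'D_v f x = 'd f x v.
Proof. by move=> cf; rewrite deriveE//; exact: cf.1. Qed.

Lemma derive_comp_C1 V (g : R -> R) (f : V -> R) x v : C1 g -> C1 f ->
  'D_v (fun y => g (f y)) x = 'D_1 g (f x) * 'D_v f x.
Proof.
move=> cg cf; have dg := cg.1 (f x); have df := cf.1 x.
rewrite deriveE; last exact: differentiable_comp.
rewrite (@diff_comp _ _ _ _ f g x df dg)/= !deriveE//.
rewrite -[in LHS](mulr1 ('d f x v)) -[LHS]/('d g (f x) ('d f x v *: 1)).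
by rewrite linearZ/= mulrC.
Qed.

Lemma C1_comp V (g : R -> R) (f : V -> R) : C1 g -> C1 f -> C1 (fun x => g (f x)).
Proof.
move=> cg cf; split=> [x|v].
  exact: (differentiable_comp (cf.1 x) (cg.1 (f x))).
apply: (@eq_continuous _ _ (fun y => 'D_1 g (f y) * 'D_v f y)) => y.
  by rewrite (derive_comp_C1 _ _ cg cf).
apply: cvgM; last exact: cf.2.
apply: (@cvg_comp _ _ _ f (fun t => 'D_1 g t)); last exact: cg.2.
exact: C1_continuous.
Qed.

Lemma derive_translate V (f : V -> R) (h x v : V) :
  'D_v (fun y => f (y + h)) x = 'D_v f (x + h).
Proof. by rewrite /derive/=; under eq_fun do rewrite -addrA. Qed.

Lemma C1_translate V (f : V -> R) (h : V) : C1 f -> C1 (fun x => f (x + h)).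
Proof.
move=> cf; split=> [x|v].
  apply: (@differentiable_comp _ _ _ _ (fun y => y + h) f); last exact: cf.1.
  by apply: differentiableD => //; exact: differentiable_cst.
apply: (@eq_continuous _ _ (fun y => 'D_v f (y + h))) => y.
  by rewrite derive_translate.
apply: (@cvg_comp _ _ _ (fun y => y + h) (fun y => 'D_v f y)); last exact: cf.2.
by apply: cvgD; [exact: cvg_id|exact: cvg_cst].
Qed.

Lemma C1_scale_add V (f : V -> R) (L : V -> V -> R) (C : R) :
  (forall x, linear (L x)) -> (forall x, continuous (L x)) ->
  (forall x h, `|h| <= 1 -> `|f (x + h) - f x - L x h| <= C * `|h| ^+ 2) ->
  forall x, differentiable f x /\ 'd f x = L x :> (V -> R).
Proof.
move=> lL cL H x.
pose glM := GRing.isLinear.Build _ _ _ _ _ (lL x).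
pose gL : {linear V -> R} := HB.pack (L x) glM.
have E : f \o shift x = cst (f x) + gL +o_ 0 id.
  apply/eqaddoP => _/posnumP[e]; near=> h.
  rewrite /= !fctE/= opprD addrA [h + x]addrC.
  have h1 : `|h| <= 1.
    near: h; apply/nbhs_normP; exists 1 => //= y /=.
    by rewrite sub0r normrN => /ltW.
  apply: le_trans (H x h h1) _.
  have C0 : 0 < `|C| + 1 by rewrite ltr_wpDl.
  have he : `|h| <= e%:num / (`|C| + 1).
    near: h; apply/nbhs_normP; exists (e%:num / (`|C| + 1)) => /=.
      by rewrite divr_gt0.
    by move=> y /=; rewrite sub0r normrN => /ltW.
  rewrite expr2 mulrA ler_wpM2r//.
  apply: (@le_trans _ _ ((`|C| + 1) * `|h|)).
    by rewrite ler_wpM2r// (le_trans (ler_norm _))// lerDl.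
  by rewrite mulrC -ler_pdivlMr.
have dE : 'd f x = gL :> (V -> R) by apply: diff_unique => //; exact: cL.
split=> //; apply/diff_locallyP; rewrite dE; split=> //; exact: cL.
Unshelve. all: by end_near. Qed.

(** The remainder bound is uniform in [x]. It therefore gives the derivative and also its
    continuity: [L y v] is a uniform limit of difference quotients in [y], which are continuous.
    This replaces differentiation under the integral sign for mollified functions. *)
Lemma C1_of_taylor V (f : V -> R) (L : V -> V -> R) (C : R) :
  (forall x, linear (L x)) -> (forall x, continuous (L x)) ->
  (forall x h, `|h| <= 1 -> `|f (x + h) - f x - L x h| <= C * `|h| ^+ 2) ->
  C1 f /\ forall x v, 'D_v f x = L x v.
Proof.
move=> lL cL H; have dH := C1_scale_add lL cL H.
have DE x v : 'D_v f x = L x v by rewrite deriveE ?(dH x).2//; exact: (dH x).1.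
split=> //; split=> [x|v]; first exact: (dH x).1.
apply: (@eq_continuous _ _ (L ^~ v)) => [y|x]; first by rewrite DE.
have cf : continuous f by move=> y; apply: differentiable_continuous; exact: (dH y).1.
pose v1 := `|v| + 1; have v10 : 0 < v1 by rewrite ltr_wpDl.
pose C' := `|C| + 1; have C0 : 0 < C' by rewrite ltr_wpDl.
apply/cvgrPdist_le => e e0.
(* [L y v] is uniformly close to a difference quotient with fixed step. *)
pose t := Num.min v1^-1 (e / (3 * C' * v1 ^+ 2)).
have t0 : 0 < t.
  by rewrite lt_min invr_gt0 v10 divr_gt0// !mulr_gt0// exprn_gt0.
have tv : `|t *: v| <= 1.
  rewrite normrZ gtr0_norm//; apply: (@le_trans _ _ (v1^-1 * `|v|)).
    by rewrite ler_wpM2r// ge_min lexx.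
  by rewrite mulrC ler_pdivrMr// mul1r lerDl.
have q y : `|(f (y + t *: v) - f y) / t - L y v| <= e / 3.
  have := H y _ tv; have [_ Lt] : True /\ L y (t *: v) = t * L y v.
    split=> //; have := lL y t v 0; rewrite addr0 => ->.
    have := lL y 0 v 0; rewrite scale0r add0r => /esym/eqP.
    by rewrite scale0r add0r => _; have := lL y (-1) 0 0; rewrite scaler0 addr0 scaleN1r addNr => ->; rewrite addr0.
  rewrite Lt => h.
  have -> : (f (y + t *: v) - f y) / t - L y v = (f (y + t *: v) - f y - t * L y v) / t.
    by field; rewrite gt_eqF.
  rewrite normrM normfV (gtr0_norm t0) ler_pdivrMr//; apply: le_trans h _.
  rewrite normrZ (gtr0_norm t0) exprMn.
  apply: (@le_trans _ _ (C' * (t ^+ 2 * v1 ^+ 2))).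
    apply: (@le_trans _ _ (C' * (t ^+ 2 * `|v| ^+ 2))).
      by rewrite ler_wpM2r ?mulr_ge0 ?exprn_ge0 ?(ltW t0)// (le_trans (ler_norm _))// lerDl.
    rewrite ler_pM2l// ler_pM2l ?exprn_gt0//.
    by apply: lerXn2r; rewrite ?nnegrE ?lerDl// ltW.
  have : t <= e / (3 * C' * v1 ^+ 2) by rewrite ge_min lexx orbT.
  rewrite ler_pdivlMr ?mulr_gt0 ?exprn_gt0// => h2.
  have : t * (t * (3 * C' * v1 ^+ 2)) <= t * e by rewrite ler_pM2l.
  by lra.
have cq : (fun y => (f (y + t *: v) - f y) / t) @ x --> (f (x + t *: v) - f x) / t.
  apply: cvgM; last exact: cvg_cst.
  apply: cvgB; last exact: cf.
  apply: (@cvg_comp _ _ _ (fun y => y + t *: v) f); last exact: cf.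
  by apply: cvgD; [exact: cvg_id|exact: cvg_cst].
have e30 : 0 < e / 3 by rewrite divr_gt0.
have /cvgrPdist_le/(_ _ e30) := cq; apply: filterS => y hy.
have := q x; have := q y; move: hy.
set a := (f (x + _) - _) / t; set b := (f (y + _) - _) / t.
by rewrite !ler_norml; lra.
Qed.

(** A C1 function that vanishes on a half-line and has a global quadratic Taylor bound with constant
    1. The mollifier and the ramp are both assembled from it. *)
Definition sqpos (t : R) : R := Num.max t 0 ^+ 2.

Lemma sqpos_taylor (t h : R) :
  `|sqpos (t + h) - sqpos t - 2 * Num.max t 0 * h| <= 1 * `|h| ^+ 2.
Proof.
rewrite mul1r real_normK ?num_real// /sqpos.
by rewrite ler_norml; case: (ltP t 0) => t0; case: (ltP (t + h) 0) => th0; apply/andP; split; nra.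
Qed.

Lemma C1_sqpos : C1 sqpos /\ forall t v, 'D_v sqpos t = 2 * Num.max t 0 * v.
Proof.
apply: (@C1_of_taylor _ sqpos (fun t v => 2 * Num.max t 0 * v) 1) => //.
- by move=> t a u v /=; rewrite /GRing.scale/=; ring.
- by move=> t; exact: mulrl_continuous.
move=> t h _; exact: sqpos_taylor.
Qed.

End continuously_differentiable.

Lemma integrable_cst_indic d (T : measurableType d) (R : realType)
    (m : {measure set T -> \bar R}) (C : R) (A : set T) : measurable A ->
  (m A < +oo)%E -> m.-integrable setT (EFin \o (fun x => C * \1_A x)).
Proof.
move=> mA Afin; rewrite (_ : EFin \o _ = fun x => (C%:E * (\1_A x)%:E)%E)//.
apply: integrableZl => //; apply/integrableP; split; first exact/measurable_EFinP.
under eq_integral do rewrite gee0_abs ?lee_fin//.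
by rewrite integral_indic// setIT.
Qed.

(** * Supports in boxes and integrals of derivatives *)

Section space_calculus.
Context {R : realType} {n : nat}.
Local Notation space := ('rV[R]_n * R)%type.

Lemma coord_le_norm (x : space) : (forall i, `|x.1 ord0 i| <= `|x|) /\ `|x.2| <= `|x|.
Proof.
have H e : 0 < e -> cube (0 : space) (`|x| + e) x.
  by move=> e0; apply: ball_cube; rewrite -ball_normE/= sub0r normrN ltrDl.
split=> [i|]; apply/ler_addgt0Pr => e e0; have [h1 h2] := H _ e0.
  by have := h1 i; rewrite mxE subr0 => /ltW.
by move: h2; rewrite subr0 => /ltW.
Qed.

Lemma C1_coord i : C1 (fun x : space => x.1 ord0 i) /\
  forall x v, 'D_v (fun x : space => x.1 ord0 i) x = v.1 ord0 i.
Proof.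
apply: (@C1_of_taylor _ _ _ (fun _ (v : space) => v.1 ord0 i) 0).
- by move=> _ a u v; rewrite !mxE.
- move=> _ x; apply: (@cvg_comp _ _ _ fst (fun z : 'rV[R]_n => z ord0 i)).
    exact: cvg_fst.
  exact: coord_continuous.
- by move=> x h _; rewrite !mxE (_ : _ - _ - _ = 0) ?normr0 ?mul0r//; ring.
Qed.

Lemma C1_last : C1 (fun x : space => x.2) /\
  forall x v, 'D_v (fun x : space => x.2) x = v.2.
Proof.
apply: (@C1_of_taylor _ _ _ (fun _ (v : space) => v.2) 0).
- by move=> _ a u v.
- by move=> _ x; exact: cvg_snd.
- by move=> x h _; rewrite /= (_ : _ - _ - _ = 0) ?normr0 ?mul0r//; ring.
Qed.

Definition box (M : R) : set space :=
  [set x : space | (forall i, `|x.1 ord0 i| <= M) /\ `|x.2| <= M].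

Lemma norm_box (x : space) : box `|x| x.
Proof. exact: coord_le_norm. Qed.

Lemma box_le (M N : R) : M <= N -> box M `<=` box N.
Proof. by move=> MN x [h1 h2]; split=> [i|]; apply: le_trans MN. Qed.

Lemma box_cube M : box M `<=` cube (0 : space) (M + 1).
Proof.
move=> x [h1 h2]; split=> [i|].
  by rewrite mxE subr0 (le_lt_trans (h1 i))// ltrDl.
by rewrite subr0 (le_lt_trans h2)// ltrDl.
Qed.

Lemma boxD M N (x y : space) : box M x -> box N y -> box (M + N) (x + y).
Proof.
move=> [x1 x2] [y1 y2]; split=> [i|].
  by rewrite mxE (le_trans (ler_normD _ _))// lerD.
by rewrite (le_trans (ler_normD _ _))// lerD.
Qed.

Lemma boxN M (x : space) : box M x -> box M (- x).
Proof. by move=> [x1 x2]; split=> [i|]; rewrite ?mxE normrN. Qed.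

Lemma compact_box M : compact (box M).
Proof.
rewrite (_ : box M = [set v : 'rV[R]_n | forall i, `[- M, M]%classic (v ord0 i)] `*` `[- M, M]%classic).
  apply: compact_setX; last exact: segment_compact.
  by apply: (@rV_compact _ _ (fun=> `[- M, M]%classic)) => _; exact: segment_compact.
apply/seteqP; split=> x /=.
  by move=> [h1 h2]; split=> [i|]; rewrite in_itv/= -ler_norml.
move=> [h1 h2]; split=> [i|].
  by have := h1 i; rewrite in_itv/= -ler_norml.
by move: h2; rewrite in_itv/= -ler_norml.
Qed.

Lemma closed_box M : closed (box M).
Proof. by apply: compact_closed; [exact: norm_hausdorff|exact: compact_box]. Qed.

Lemma measurable_box M : measurable (box M).
Proof.
rewrite -[X in measurable X]setCK; apply: measurableC.
by apply: open_measurable_space; apply: closed_openC; exact: closed_box.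
Qed.

Lemma vol_box_fin M : (vol (box M) < +oo)%E.
Proof.
have [M0|M0] := leP 0 (M + 1); last first.
  rewrite (_ : box M = set0) ?measure0//; apply/seteqP; split => // x [_].
  by move=> h; have := le_trans (normr_ge0 _) h; lra.
apply: (@le_lt_trans _ _ (vol (cube (0 : space) (M + 1)))).
  apply: le_measure; rewrite ?inE; [exact: measurable_box|exact: measurable_cube|exact: box_cube].
by rewrite vol_cube// ltry.
Qed.

(** Vanishing off a closed box stands in for compact support; the explicit radius is easy to follow
    under translations. *)
Definition supp_in (M : R) (f : space -> R) := forall x, f x <> 0 -> box M x.

Lemma supp_in_le M N f : M <= N -> supp_in M f -> supp_in N f.
Proof. by move=> MN sf x /sf; exact: box_le. Qed.

Lemma supp_in0 M f x : supp_in M f -> ~ box M x -> f x = 0.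
Proof. by move=> sf nb; apply: contrapT => /sf. Qed.

Lemma bounded_supp M f : continuous f -> supp_in M f ->
  exists2 C, 0 <= C & forall x, `|f x| <= C.
Proof.
move=> cf sf.
have [b0|/set0P/negP] := pselect (box M !=set0); last first.
  move=> /negPn/eqP b0; exists 0 => // x.
  by rewrite (supp_in0 sf) ?normr0// b0.
have cf' : {within box M, continuous (fun x => `|f x|)}.
  by apply: continuous_subspaceT => x; apply: cvg_norm; exact: cf.
have [c _ cmax] := compact_EVT_max b0 (@compact_box M) cf'.
exists `|f c| => // x; have [bx|bx] := pselect (box M x).
  by apply: cmax; rewrite inE.
by rewrite (supp_in0 sf) ?normr0.
Qed.

Lemma integrable_supp M (C : R) (f : space -> R) : measurable_fun setT f ->
  (forall x, `|f x| <= C) -> supp_in M f -> vol.-integrable setT (EFin \o f).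
Proof.
move=> mf fC sf.
apply: (@le_integrable _ _ _ vol _ measurableT _ (EFin \o (fun x => C * \1_(box M) x))).
- exact/measurable_EFinP.
- move=> x _; rewrite /= lee_fin indicE; have [bx|bx] := pselect (box M x).
    by rewrite mem_set// mulr1 (le_trans (fC x))// ler_norm.
  by rewrite (supp_in0 sf)// memNset// mulr0.
- by apply: integrable_cst_indic; [exact: measurable_box|exact: vol_box_fin].
Qed.

Lemma integrable_cont_supp M f : continuous f -> supp_in M f ->
  vol.-integrable setT (EFin \o f).
Proof.
move=> cf sf; have [C _ fC] := bounded_supp cf sf.
by apply: (integrable_supp _ fC sf); exact: continuous_measurable_space.
Qed.

Lemma derive_supp M f v : supp_in M f -> supp_in M ('D_v f).
Proof.
move=> sf x; apply: contra_notP => nb.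
have : \near x, f x = cst 0 x.
  have : nbhs x (~` box M) by apply: open_nbhs_nbhs; split=> //; apply: closed_openC; exact: closed_box.
  by apply: filterS => y; exact: supp_in0.
by move=> /near_eq_derive ->; rewrite derive_cst.
Qed.

Lemma derive_line (f : space -> R) (x v : space) (t : R) : C1 f ->
  is_derive t (1 : R) (fun s : R => f (x + s *: v)) ('D_v f (x + t *: v)).
Proof.
move=> cf.
have E : (fun h : R => h^-1 *: (f (x + (h *: (1 : R) + t) *: v) - f (x + t *: v))) =
    (fun h : R => h^-1 *: (f (h *: v + (x + t *: v)) - f (x + t *: v))).
  apply/funext => h; congr (_ *: (f _ - _)).
  by rewrite scalerDl [h *: (1 : R)]mulr1 addrCA.
have := C1_derivable (x := x + t *: v) (v := v) cf; rewrite /derivable -E => dg.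
apply: DeriveDef; first exact: dg.
by rewrite /derive -E.
Qed.

Lemma increment_bound (f : space -> R) (x v : space) C h : C1 f -> 0 < h ->
  (forall y, `|'D_v f y| <= C) -> `|f (x + h *: v) - f x| <= C * h.
Proof.
move=> cf h0 DC.
have [t _] := @MVT _ (fun s : R => f (x + s *: v)) (fun t => 'D_v f (x + t *: v)) _ _ h0
  (fun t _ => derive_line x v t cf) (continuous_subspaceT (fun t =>
    differentiable_continuous ((derivable1_diffP _ _).1 (@ex_derive _ _ _ _ _ _ _ (derive_line x v t cf))))).
by rewrite scale0r addr0 subr0 => ->; rewrite normrM (gtr0_norm h0) ler_pM2r.
Qed.

Lemma integral_translate (h : space) (f : space -> R) : measurable_fun setT f ->
  vol.-integrable setT (EFin \o (fun x => f (x + h))) ->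
  (\int[vol]_x (f (x + h))%:E = \int[vol]_x (f x)%:E)%E.
Proof.
move=> mf i1.
apply: (@preserves_integral _ _ _ vol (fun x => x + h) (EFin \o f)) => //.
  exact: preserves_vol.
exact/measurable_EFinP.
Qed.

(** The difference quotients in direction [v] have integral zero by translation invariance. The mean
    value theorem bounds them by the supremum of the derivative on a box enlarged by [|v|], so
    dominated convergence applies. *)
Lemma integral_derive0 M (f : space -> R) v : C1 f -> supp_in M f ->
  \int[vol]_x 'D_v f x = 0.
Proof.
move=> cf sf; have cD := cf.2 v; have sD := derive_supp (v := v) sf.
have [C C0 DC] := bounded_supp cD sD.
pose h k : R := k.+1%:R^-1.
have h0 k : 0 < h k by rewrite invr_gt0.
pose g k x := (f (x + h k *: v) - f x) / h k.
pose N := M + `|v|.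
have sh k : supp_in N (fun x => f (x + h k *: v)).
  move=> x /sf b; rewrite -(addrK (h k *: v) x); apply: boxD => //; apply: boxN.
  apply: box_le (norm_box _); rewrite normrZ gtr0_norm// ler_piMl//.
  by rewrite invf_le1// ler1n.
have ct k : continuous (fun x => f (x + h k *: v)).
  exact: C1_continuous (C1_translate _ cf).
have sfN : supp_in N f by apply: supp_in_le sf; rewrite lerDl.
have sg k : supp_in N (g k).
  move=> x; apply: contra_notP => nb.
  by rewrite /g (supp_in0 (sh k))// (supp_in0 sfN)// subrr mul0r.
have gC k x : `|g k x| <= C.
  by rewrite normrM normfV (gtr0_norm (h0 k)) ler_pdivrMr//; exact: increment_bound.
have mg k : measurable_fun setT (g k).
  apply: continuous_measurable_space => x; apply: cvgM; last exact: cvg_cst.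
  by apply: cvgB; [exact: ct|exact: C1_continuous].
have ig0 k : (\int[vol]_x (g k x)%:E = 0)%E.
  have i1 : vol.-integrable setT (EFin \o (fun x => f (x + h k *: v))).
    exact: integrable_cont_supp (ct k) (sh k).
  have i2 : vol.-integrable setT (EFin \o f).
    exact: integrable_cont_supp (C1_continuous cf) sf.
  under eq_integral do rewrite /g EFinM EFinB muleC.
  rewrite integralZl//; last exact: integrableB.
  rewrite integralB//.
  rewrite integral_translate//; last first.
    by apply: continuous_measurable_space; exact: C1_continuous.
  rewrite subee ?mule0//; exact: integrable_fin_num.
have [||||//|_ _] := @dominated_convergence _ _ _ vol setT measurableT
  (fun k => EFin \o g k) (EFin \o 'D_v f) (EFin \o (fun x => C * \1_(box N) x)).
- by move=> k; exact/measurable_EFinP.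
- apply/measurable_EFinP; exact: continuous_measurable_space.
- apply: aeW => x _; apply/cvg_EFin; first exact: nearW.
  have := C1_derivable (x := x) (v := v) cf.
  rewrite /derivable => L.
  have hcv : h @ \oo --> 0^'.
    move=> A nA; have nA' : nbhs (0 : R) [set y | y != 0 -> A y] := nA.
    have [K _ HK] : \forall k \near \oo, [set y | y != 0 -> A y] (harmonic k).
      exact: cvg_harmonic nA'.
    by exists K => // k /= Kk; apply: (HK k Kk); rewrite gt_eqF// h0.
  rewrite [X in X @ _ --> _](_ : _ = (fun t : R => t^-1 *: (f (t *: v + x) - f x)) \o h).
    exact: cvg_comp hcv L.
  by apply/funext => k; rewrite /g /= mulrC [x + _]addrC.
- by apply: integrable_cst_indic; [exact: measurable_box|exact: vol_box_fin].
- apply: aeW => x k _; rewrite /= lee_fin indicE; have [bx|bx] := pselect (box N x).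
    by rewrite mem_set// mulr1.
  by rewrite (supp_in0 (sg k))// memNset// mulr0 normr0.
rewrite (_ : [sequence _]_n = cst 0%E); last by apply/funext => k; exact: ig0.
move=> L; have E := cvg_unique (@ereal_hausdorff R) L (cvg_cst _).
exact: (congr1 fine (E _ _)).
Qed.

End space_calculus.

(** * Mollification *)

Lemma lipschitz_linear_continuous (R : realType) (V : normedModType R)
    (f : V -> R) (C : R) :
  linear f -> (forall v, `|f v| <= C * `|v|) -> continuous f.
Proof.
move=> lf fC x; pose C' := `|C| + 1; have C0 : 0 < C' by rewrite ltr_wpDl.
have fB u v : f (u - v) = f u - f v.
  by rewrite addrC -scaleN1r lf /= scaleN1r addrC.
apply/cvgrPdist_le => e e0; have eC : 0 < e / C' by rewrite divr_gt0.
near=> y; rewrite -fB; apply: le_trans (fC _) _.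
apply: (@le_trans _ _ (C' * `|x - y|)).
  by rewrite ler_wpM2r// (le_trans (ler_norm _))// lerDl.
by rewrite mulrC -ler_pdivlMr//; near: y; exact: cvgr_dist_le.
Unshelve. all: by end_near. Qed.

Lemma linear_scale (R : realType) (V : normedModType R) (f : V -> R) a v :
  linear f -> f (a *: v) = a * f v.
Proof.
move=> lf; have f0 : f 0 = 0 by have := lf (-1) 0 0; rewrite scaler0 addr0 scaleN1r addNr.
by have := lf a v 0; rewrite addr0 f0 addr0.
Qed.

Section mollifier.
Context {R : realType} {n : nat}.
Local Notation space := ('rV[R]_n * R)%type.
Implicit Types x h v y : space.

Definition dot (x y : space) : R :=
  \sum_(i < n) x.1 ord0 i * y.1 ord0 i + x.2 * y.2.

Lemma sqnormD (x h : space) : sqnorm (x + h) = sqnorm x + 2 * dot x h + sqnorm h.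
Proof.
rewrite /sqnorm /dot mulrDr mulr_sumr.
under eq_bigr do rewrite mxE.
rewrite (eq_bigr (fun i => x.1 ord0 i ^+ 2 + 2 * (x.1 ord0 i * h.1 ord0 i) + h.1 ord0 i ^+ 2)).
  by rewrite !big_split/=; ring.
by move=> i _; ring.
Qed.

Lemma dot_linear (x : space) : linear (dot x).
Proof.
move=> a u v; rewrite /dot /= mulrDr (mulrCA x.2) /GRing.scale/= mulrDr mulr_sumr addrACA.
rewrite -big_split/=; congr (_ + _); apply: eq_bigr => i _.
by rewrite !mxE; ring.
Qed.

Lemma dotN (x h : space) : dot x (- h) = - dot x h.
Proof.
rewrite /dot/= mulrN opprD -sumrN; congr (_ + _); apply: eq_bigr => i _.
by rewrite mxE mulrN.
Qed.

Lemma sum_const_le (f : 'I_n -> R) c : (forall i, f i <= c) -> \sum_(i < n) f i <= n%:R * c.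
Proof.
move=> fc; rewrite mulr_natl -[X in _ *+ X]card_ord -sumr_const.
by apply: ler_sum => i _; exact: fc.
Qed.

Lemma dot_bound M (x h : space) : box M x -> `|dot x h| <= n.+1%:R * M * `|h|.
Proof.
move=> [x1 x2]; have [h1 h2] := coord_le_norm h.
rewrite -natr1 mulrDl mulrDl mul1r -mulrA (le_trans (ler_normD _ _))//.
apply: lerD; last by rewrite normrM ler_pM.
rewrite (le_trans (ler_norm_sum _ _ _))//; apply: sum_const_le => i.
by rewrite normrM ler_pM.
Qed.

Lemma sqnorm_bound (h : space) : sqnorm h <= n.+1%:R * `|h| ^+ 2.
Proof.
have [h1 h2] := coord_le_norm h; rewrite -natr1 mulrDl mul1r; apply: lerD.
  apply: sum_const_le => i; rewrite -[X in X <= _]real_normK ?num_real//.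
  by rewrite lerXn2r// nnegrE.
by rewrite -[X in X <= _]real_normK ?num_real// lerXn2r// nnegrE.
Qed.

Lemma dot_continuous v : continuous (fun x => dot x v).
Proof.
apply: (@eq_continuous _ _ (dot v)) => [x|].
  by rewrite /dot mulrC; congr (_ + _); apply: eq_bigr => i _; rewrite mulrC.
apply: (@lipschitz_linear_continuous _ _ _ (n.+1%:R * `|v|)).
  exact: dot_linear.
by move=> h; apply: dot_bound; exact: norm_box.
Qed.

Lemma C1_sqnorm : C1 (sqnorm : space -> R) /\
  forall x v, 'D_v (sqnorm : space -> R) x = 2 * dot x v.
Proof.
apply: (@C1_of_taylor _ _ _ (fun x v => 2 * dot x v) n.+1%:R).
- by move=> x a u v; rewrite dot_linear /GRing.scale/=; ring.
- move=> x; apply: (@lipschitz_linear_continuous _ _ _ (2 * (n.+1%:R * `|x|))).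
    by move=> a u v; rewrite dot_linear /GRing.scale/=; ring.
  move=> v; rewrite normrM ger0_norm// -mulrA ler_pM2l//.
  by apply: dot_bound; exact: norm_box.
- move=> x h _; rewrite sqnormD (_ : _ - _ - _ = sqnorm h); last by ring.
  by rewrite ger0_norm ?sqnorm_ge0// sqnorm_bound.
Qed.

Lemma sqnorm_lt_box (e : R) (x : space) : 0 < e -> sqnorm x < e ^+ 2 -> box e x.
Proof.
move=> e0; rewrite -enorm_lt// => h.
by split=> [i|]; apply/ltW; apply: le_lt_trans h; [exact: coord_le_enorm|exact: last_le_enorm].
Qed.

Section kernel.
Variable e : R.
Hypothesis e0 : 0 < e.

(** The unnormalised kernel (e^2 - |x|^2)_+^2, supported in a Euclidean ball. One derivative is all
    that is asked of it, and as a polynomial on its support it has explicit Taylor constants;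
    [dmollifier] is its differential. *)
Definition mollifier (x : space) : R := sqpos (e ^+ 2 - sqnorm x).

Definition dmollifier (x v : space) : R :=
  - (4 * Num.max (e ^+ 2 - sqnorm x) 0) * dot x v.

Lemma mollifier_ge0 x : 0 <= mollifier x. Proof. exact: sqr_ge0. Qed.

Lemma mollifier_continuous : continuous mollifier.
Proof.
apply: C1_continuous; apply: (@C1_comp _ _ sqpos); first exact: C1_sqpos.1.
by apply: C1B; [exact: C1_cst|exact: C1_sqnorm.1].
Qed.

Lemma dmollifier_continuous v : continuous (dmollifier ^~ v).
Proof.
have c0 : continuous (fun t : R => Num.max t 0).
  by move=> t; apply: (@continuous_max _ _ _ _ t) => //; exact: cst_continuous.
move=> x; apply: cvgM.
  apply: cvgN; apply: cvgM; first exact: cvg_cst.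
  apply: (@cvg_comp _ _ _ (fun x => e ^+ 2 - sqnorm x) (fun t => Num.max t 0)).
    by apply: cvgB; [exact: cvg_cst|exact: sqnorm_continuous].
  exact: c0.
exact: dot_continuous.
Qed.

Lemma mollifier_out x : ~ sqnorm x < e ^+ 2 -> Num.max (e ^+ 2 - sqnorm x) 0 = 0.
Proof. by move=> /negP; rewrite -leNgt => h; apply/max_idPr; rewrite subr_le0. Qed.

Lemma mollifier_supp : supp_in e mollifier.
Proof.
move=> x; apply: contra_notP => nb; rewrite /mollifier /sqpos mollifier_out ?expr0n//.
by move=> /(sqnorm_lt_box e0).
Qed.

Lemma dmollifier_supp v : supp_in e (dmollifier ^~ v).
Proof.
move=> x; apply: contra_notP => nb; rewrite /dmollifier mollifier_out ?mulr0 ?oppr0 ?mul0r//.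
by move=> /(sqnorm_lt_box e0).
Qed.

Lemma mollifier_le x : mollifier x <= e ^+ 4.
Proof.
rewrite /mollifier /sqpos (_ : e ^+ 4 = (e ^+ 2) ^+ 2); last by rewrite -exprM.
rewrite lerXn2r ?nnegrE ?sqr_ge0 ?le_max ?lexx ?orbT//.
by rewrite ge_max sqr_ge0 lerBlDr lerDl sqnorm_ge0.
Qed.

(** On [box (e + 1)] and for |h| at most 1, |x|^2 changes by at most (n + 1)(2(e + 1) + 1)|h|, which
    enters squared. The second term is the quadratic part |h|^2 of that change, weighted by the
    slope 2 e^2. *)
Definition taylor_const : R :=
  (n.+1%:R * (2 * e + 3)) ^+ 2 + 2 * e ^+ 2 * n.+1%:R.

(** Compose the Taylor bound of [sqpos] with the exact expansion of [sqnorm]. The indicator on the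
    right keeps the bound integrable when it is averaged over translates. *)
Lemma mollifier_taylor x h : `|h| <= 1 ->
  `|mollifier (x + h) - mollifier x - dmollifier x h| <=
    taylor_const * `|h| ^+ 2 * \1_(box (e + 1)) x.
Proof.
move=> h1; rewrite indicE; have [bx|nbx] := pselect (box (e + 1) x); last first.
  rewrite memNset// mulr0 (supp_in0 mollifier_supp)//; last first.
    move=> b; apply: nbx; rewrite -(addrK h x); apply: boxD => //; apply: boxN.
    exact: box_le h1 _ (norm_box h).
  have nb : ~ box e x by move=> b; apply: nbx; apply: box_le b; rewrite lerDl.
  by rewrite (supp_in0 mollifier_supp)// (supp_in0 (dmollifier_supp (v := h)))// !subr0 normr0.
rewrite mem_set// mulr1 /mollifier sqnormD.
set t := e ^+ 2 - sqnorm x; set d := - (2 * dot x h + sqnorm h).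
have -> : e ^+ 2 - (sqnorm x + 2 * dot x h + sqnorm h) = t + d by rewrite /t /d; ring.
have t0 : 0 <= Num.max t 0 by rewrite le_max lexx orbT.
have te : Num.max t 0 <= e ^+ 2.
  by rewrite ge_max sqr_ge0 /t lerBlDr lerDl sqnorm_ge0.
have h0 := normr_ge0 h; have n0 : (0 : R) <= n.+1%:R by [].
have dd : `|d| <= n.+1%:R * (2 * e + 3) * `|h|.
  rewrite normrN (le_trans (ler_normD _ _))// normrM ger0_norm//.
  rewrite (ger0_norm (sqnorm_ge0 _)).
  have := dot_bound h bx; have := sqnorm_bound h.
  have : n.+1%:R * `|h| ^+ 2 <= n.+1%:R * `|h|.
    by rewrite ler_wpM2l// expr2 ler_piMr.
  by lra.
have -> : sqpos (t + d) - sqpos t - dmollifier x h =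
   (sqpos (t + d) - sqpos t - 2 * Num.max t 0 * d) - 2 * Num.max t 0 * sqnorm h.
  by rewrite /dmollifier -/t /d; ring.
apply: (le_trans (ler_normB _ _)); rewrite /taylor_const [leRHS]mulrDl; apply: lerD.
  apply: le_trans (sqpos_taylor t d) _; rewrite mul1r -exprMn.
  by rewrite lerXn2r// nnegrE ?mulr_ge0// addr_ge0// mulr_ge0// ltW.
rewrite ger0_norm; last by rewrite !mulr_ge0// sqnorm_ge0.
have sb := sqnorm_bound h.
rewrite -(mulrA 2) -(mulrA (2 * e ^+ 2)) -(mulrA 2) ler_pM2l//.
by apply: ler_pM => //; exact: sqnorm_ge0.
Qed.

Lemma mollifier_integrable : vol.-integrable setT (EFin \o mollifier).
Proof. exact: integrable_cont_supp mollifier_continuous mollifier_supp. Qed.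

Definition mass : R := \int[vol]_x mollifier x.

(** On the ball of half the radius the kernel is at least (3/4 e^2)^2. *)
Lemma mass_ge : 9 / 16 * e ^+ 4 * (ball_const (R := R) (n := n) * (e / 2) ^+ n.+1) <= mass.
Proof.
have e20 : 0 < e / 2 by rewrite divr_gt0.
have mB := measurable_eball (0 : space) (e / 2).
have vB := vol_eball_fin (0 : space) (ltW e20).
apply: (@le_trans _ _ (\int[vol]_x (9 / 16 * e ^+ 4 * \1_(eball (0 : space) (e / 2)) x))).
  rewrite RintegralZl//; last first.
    have := integrable_cst_indic (m := vol) 1 mB; rewrite -ge0_fin_numE// vB => /(_ isT).
    by under eq_fun do rewrite mul1r.
  rewrite ler_pM2l; last by rewrite mulr_gt0// exprn_gt0.
  rewrite /Rintegral integral_indic// setIT -lee_fin fineK//.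
  exact: vol_eball_ge.
apply: le_Rintegral => //.
- by apply: integrable_cst_indic => //; rewrite -ge0_fin_numE.
- exact: mollifier_integrable.
move=> x _; rewrite indicE; have [bx|nbx] := pselect (eball (0 : space) (e / 2) x); last first.
  by rewrite memNset// mulr0 mollifier_ge0.
rewrite mem_set// mulr1; move: bx; rewrite /eball/= subr0 enorm_lt// => bx.
rewrite /mollifier /sqpos (_ : 9 / 16 * e ^+ 4 = (3 / 4 * e ^+ 2) ^+ 2); last by field.
have h0 : 0 <= 3 / 4 * e ^+ 2 by rewrite mulr_ge0 ?sqr_ge0.
rewrite lerXn2r ?nnegrE//; first by rewrite le_max lexx orbT.
rewrite le_max; apply/orP; left; move: bx; rewrite exprMn; lra.
Qed.

Lemma mass_gt0 : 0 < mass.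
Proof.
apply: lt_le_trans mass_ge.
by rewrite !mulr_gt0 ?exprn_gt0 ?ball_const_gt0 ?divr_gt0.
Qed.

Definition mollifier_const : R := 16 / 9 * 2 ^+ n.+1 / ball_const (R := R) (n := n).

(** Maximum e^4 of the kernel against the lower bound of its mass. The scaling [e ^+ n.+1] is
    exactly what lets smallness of volume in a ball bound the mollified indicator. *)
Lemma mollifier_mass_le x : mollifier x / mass <= mollifier_const / e ^+ n.+1.
Proof.
have b0 := @ball_const_gt0 R n; have p0 : 0 < e ^+ n.+1 by rewrite exprn_gt0.
have q0 : (0 : R) < 2 ^+ n.+1 by rewrite exprn_gt0.
rewrite ler_pdivrMr ?mass_gt0// mulrAC ler_pdivlMr//.
apply: (@le_trans _ _ (e ^+ 4 * e ^+ n.+1)); first by rewrite ler_pM2r// mollifier_le.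
apply: (@le_trans _ _ (mollifier_const * (9 / 16 * e ^+ 4 * (ball_const (R := R) (n := n) * (e / 2) ^+ n.+1)))).
  rewrite le_eqVlt; apply/orP; left; apply/eqP; rewrite /mollifier_const exprMn exprVn.
  by field; rewrite !gt_eqF.
rewrite ler_pM2l ?mass_ge// /mollifier_const.
by rewrite divr_gt0// !mulr_gt0.
Qed.

Lemma mollifier_const_gt0 : 0 < mollifier_const.
Proof.
by rewrite /mollifier_const divr_gt0 ?ball_const_gt0// !mulr_gt0// exprn_gt0.
Qed.

Section smoothing.
Variables (A : set space) (mA : measurable A).

Definition smooth (x : space) : R := mass^-1 * \int[vol]_y (\1_A y * mollifier (y - x)).

(** The minus sign arises because [x] enters the kernel through [y - x]. *)
Definition dsmooth (x v : space) : R :=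
  - (mass^-1 * \int[vol]_y (\1_A y * dmollifier (y - x) v)).

Lemma shift_continuous (x : space) : continuous (fun y : space => y - x).
Proof. by move=> y; apply: cvgB; [exact: cvg_id|exact: cvg_cst]. Qed.

Lemma integrable_shift (g : space -> R) M (x : space) : continuous g ->
  supp_in M g -> vol.-integrable setT (EFin \o (fun y => \1_A y * g (y - x))).
Proof.
move=> cg sg; have [C C0 gC] := bounded_supp cg sg.
apply: (@integrable_supp _ _ (M + `|x|) C).
- apply: measurable_funM; first exact: measurable_indic.
  apply: continuous_measurable_space => y.
  apply: (@cvg_comp _ _ _ (fun y => y - x) g); first exact: shift_continuous.
  exact: cg.
- move=> y; rewrite normrM -[X in _ <= X]mul1r ler_pM//.
  by rewrite ger0_norm// indicE lern1; case: (_ \in _).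
- move=> y; apply: contra_notP => nb; rewrite (supp_in0 sg) ?mulr0// => b.
  by apply: nb; rewrite -(subrK x y); apply: boxD => //; exact: norm_box.
Qed.

Lemma integrable_mollifier x : vol.-integrable setT (EFin \o (fun y => \1_A y * mollifier (y - x))).
Proof. exact: integrable_shift mollifier_continuous mollifier_supp. Qed.

Lemma integrable_dmollifier x v :
  vol.-integrable setT (EFin \o (fun y => \1_A y * dmollifier (y - x) v)).
Proof. exact: (@integrable_shift (dmollifier ^~ v) e x (@dmollifier_continuous v) (@dmollifier_supp v)). Qed.

Lemma dmollifier_linear x : linear (dmollifier x).
Proof. by move=> a u v; rewrite /dmollifier dot_linear /GRing.scale/=; ring. Qed.

Lemma dsmooth_linear x : linear (dsmooth x).
Proof.
move=> a u v; rewrite /dsmooth.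
under eq_Rintegral do rewrite dmollifier_linear mulrDr /GRing.scale/= mulrCA.
rewrite RintegralD//.
- rewrite RintegralZl//; first by rewrite /GRing.scale/=; ring.
  exact: integrable_dmollifier.
- rewrite (_ : EFin \o _ = (fun y => a%:E * (\1_A y * dmollifier (y - x) u)%:E)%E)//.
  by apply: integrableZl => //; exact: integrable_dmollifier.
- exact: integrable_dmollifier.
Qed.

Lemma dmollifier_bound x v : `|dmollifier x v| <= 4 * e ^+ 2 * (n.+1%:R * e) * `|v|.
Proof.
have [bx|nb] := pselect (box e x); last first.
  by rewrite (supp_in0 (dmollifier_supp (v := v)))// normr0 !mulr_ge0// ?sqr_ge0// ltW.
rewrite normrM normrN normrM (ger0_norm (_ : 0 <= 4))// -[leRHS]mulrA.
apply: ler_pM; rewrite ?mulr_ge0//.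
  rewrite ler_pM2l// ger0_norm ?le_max ?lexx ?orbT//.
  by rewrite ge_max sqr_ge0 lerBlDr lerDl sqnorm_ge0.
exact: dot_bound.
Qed.

Lemma integral_indic_shift (M c : R) (x : space) : 0 <= c ->
  \int[vol]_y (c * \1_(box M) (y - x)) = c * fine (vol (box M : set space)).
Proof.
move=> c0; have mB := @measurable_box R n M; have fB := @vol_box_fin R n M.
have m1 : measurable_fun setT (fun y : space => c * \1_(box M) y).
  by apply: measurable_funM => //; exact: measurable_indic.
have i1 : vol.-integrable setT (EFin \o (fun y : space => c * \1_(box M) y)).
  exact: integrable_cst_indic.
rewrite /Rintegral.
rewrite (@preserves_ge0_integral _ _ _ vol (fun y => y - x) (fun y => (c * \1_(box M) y)%:E)).
- under eq_integral do rewrite EFinM.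
  by rewrite ge0_integralZl//; [rewrite integral_indic// setIT fineM// ge0_fin_numE|exact/measurable_EFinP].
- exact: preserves_vol.
- by move=> y; rewrite lee_fin mulr_ge0.
- exact/measurable_EFinP.
Qed.

Lemma measurable_shift (g : space -> R) x : measurable_fun setT g ->
  measurable_fun setT (fun y => g (y - x)).
Proof. by move=> mg; exact: (measurableT_comp mg (preserves_vol (- x)).1). Qed.

Lemma integrable_box_shift (M c : R) x : 0 <= c ->
  vol.-integrable setT (EFin \o (fun y => c * \1_(box M) (y - x))).
Proof.
move=> c0; apply: (@integrable_supp _ _ (M + `|x|) c).
- apply: measurable_funM => //; apply: (@measurable_shift \1_(box M)).
  by apply: measurable_indic; exact: measurable_box.
- by move=> y; rewrite normrM !ger0_norm// ler_piMr// indicE lern1; case: (_ \in _).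
- move=> y; apply: contra_notP => nb; rewrite indicE memNset ?mulr0// => b.
  by apply: nb; rewrite -(subrK x y); apply: boxD => //; exact: norm_box.
Qed.

Lemma dsmooth_bound x : exists C, forall v, `|dsmooth x v| <= C * `|v|.
Proof.
pose D := 4 * e ^+ 2 * (n.+1%:R * e); have D0 : 0 <= D.
  by rewrite !mulr_ge0 ?sqr_ge0// ltW.
exists (mass^-1 * (D * fine (vol (box e : set space)))) => v.
have m0 := mass_gt0.
rewrite normrN normrM ger0_norm; last by rewrite invr_ge0 ltW.
rewrite -mulrA ler_pM2l ?invr_gt0//.
apply: le_trans (le_normr_Rintegral measurableT (integrable_dmollifier x v)) _.
rewrite mulrAC -(integral_indic_shift _ x); last by rewrite mulr_ge0.
apply: le_Rintegral => //.
- apply/integrable_norm => //; exact: integrable_dmollifier.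
- by apply: integrable_box_shift; rewrite mulr_ge0.
move=> y _; rewrite normrM [X in _ <= _ * X]indicE.
have [b|nb] := pselect (box e (y - x)); last first.
  by rewrite (supp_in0 (dmollifier_supp (v := v)))// normr0 mulr0 mulr_ge0// mulr_ge0.
rewrite mem_set// mulr1 -[X in _ <= X]mul1r ler_pM//; last exact: dmollifier_bound.
by rewrite ger0_norm// indicE lern1; case: (_ \in _).
Qed.

Definition smooth_taylor_const : R :=
  mass^-1 * (taylor_const * fine (vol (box (e + 1) : set space))).

Lemma taylor_const_ge0 : 0 <= taylor_const.
Proof. by rewrite /taylor_const addr_ge0 ?sqr_ge0// !mulr_ge0// ltW. Qed.

(** Integrate [mollifier_taylor] at [y - x] with increment [- h]; the dominating indicator has
    integral the volume of the box, whatever the centre. *)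
Lemma smooth_taylor x h : `|h| <= 1 ->
  `|smooth (x + h) - smooth x - dsmooth x h| <= smooth_taylor_const * `|h| ^+ 2.
Proof.
move=> h1; have m0 := mass_gt0; have t0 := taylor_const_ge0.
rewrite /smooth /dsmooth opprK -mulrBr -mulrDr.
rewrite -RintegralB//; [|exact: integrable_mollifier|exact: integrable_mollifier].
rewrite -RintegralD//; last 2 first.
- rewrite (_ : EFin \o _ = (fun y => (\1_A y * mollifier (y - (x + h)))%:E - (\1_A y * mollifier (y - x))%:E)%E)//.
  by apply: integrableB => //; exact: integrable_mollifier.
- exact: integrable_dmollifier.
have E y : \1_A y * mollifier (y - (x + h)) - \1_A y * mollifier (y - x) + \1_A y * dmollifier (y - x) h =
    \1_A y * (mollifier (y - x + - h) - mollifier (y - x) - dmollifier (y - x) (- h)).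
  by rewrite /dmollifier dotN opprD addrA; ring.
under eq_Rintegral do rewrite E.
have iI : vol.-integrable setT (EFin \o (fun y =>
    \1_A y * (mollifier (y - x + - h) - mollifier (y - x) - dmollifier (y - x) (- h)))).
  rewrite (_ : EFin \o _ = (fun y => ((\1_A y * mollifier (y - (x + h)))%:E - (\1_A y * mollifier (y - x))%:E) + (\1_A y * dmollifier (y - x) h)%:E)%E).
    apply: integrableD => //; last exact: integrable_dmollifier.
    by apply: integrableB => //; exact: integrable_mollifier.
  by apply/funext => y; rewrite /= -E EFinD EFinB.
have h0 : 0 <= taylor_const * `|h| ^+ 2 by rewrite mulr_ge0// sqr_ge0.
rewrite normrM gtr0_norm ?invr_gt0// /smooth_taylor_const -mulrA ler_pM2l ?invr_gt0//.
apply: le_trans (le_normr_Rintegral measurableT iI) _.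
rewrite mulrAC -(integral_indic_shift _ x)//.
apply: le_Rintegral => //; [exact: integrable_norm|exact: integrable_box_shift|].
move=> y _; rewrite normrM -[leRHS]mul1r; apply: ler_pM => //.
  by rewrite ger0_norm// indicE lern1; case: (_ \in _).
by rewrite -(normrN h); apply: mollifier_taylor; rewrite normrN.
Qed.

Lemma C1_smooth_derive : C1 smooth /\ forall x v, 'D_v smooth x = dsmooth x v.
Proof.
apply: (@C1_of_taylor _ _ _ _ smooth_taylor_const).
- exact: dsmooth_linear.
- move=> x; have [C CP] := dsmooth_bound x.
  by apply: (@lipschitz_linear_continuous _ _ _ C) => //; exact: dsmooth_linear.
- exact: smooth_taylor.
Qed.

Lemma C1_smooth : C1 smooth. Proof. exact: C1_smooth_derive.1. Qed.

Lemma smooth_derive_taylor x v (h : R) : 0 <= h -> `|h *: v| <= 1 ->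
  `|smooth (x + h *: v) - smooth x - h * 'D_v smooth x| <=
    smooth_taylor_const * `|h *: v| ^+ 2.
Proof.
move=> h0 h1; rewrite (C1_smooth_derive).2.
have -> : h * dsmooth x v = dsmooth x (h *: v).
  by rewrite linear_scale//; exact: dsmooth_linear.
exact: smooth_taylor.
Qed.

Lemma smooth_ge0 x : 0 <= smooth x.
Proof.
apply: mulr_ge0; first by rewrite invr_ge0 ltW// mass_gt0.
apply: Rintegral_ge0 => y _.
by rewrite mulr_ge0// mollifier_ge0.
Qed.

End smoothing.

Lemma mass_shift x : mass = \int[vol]_y mollifier (y - x).
Proof.
rewrite /mass /Rintegral.
rewrite [in RHS](@preserves_ge0_integral _ _ _ vol (fun y => y - x) (EFin \o mollifier))//.
- exact: preserves_vol.
- by move=> y; rewrite lee_fin mollifier_ge0.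
- by apply/measurable_EFinP; apply: continuous_measurable_space; exact: mollifier_continuous.
Qed.

(** Gives the upper bound 1 for mollified indicators, and reduces convergence at points of [A] to
    convergence to 0 for the complement. *)
Lemma smoothC (A : set space) x : measurable A ->
  smooth A x + smooth (~` A) x = 1.
Proof.
move=> mA; rewrite /smooth -mulrDr -RintegralD//.
- under eq_Rintegral.
    move=> y _; rewrite -mulrDl (_ : \1_A y + \1_(~` A) y = 1) ?mul1r; last first.
      rewrite !indicE; have [Ay|Ay] := pselect (A y).
        by rewrite mem_set// memNset ?addr0// => /(_ Ay).
      by rewrite memNset// mem_set// add0r.
    over.
  by rewrite /= -mass_shift mulVf// gt_eqF// mass_gt0.
- exact: integrable_mollifier.
- by apply: integrable_mollifier; exact: measurableC.
Qed.

Lemma smooth_le1 (A : set space) x : measurable A -> smooth A x <= 1.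
Proof. by move=> mA; rewrite -(smoothC x mA) lerDl smooth_ge0//; exact: measurableC. Qed.

Lemma smooth_le_density (A : set space) x : measurable A ->
  smooth A x <= mollifier_const / e ^+ n.+1 * fine (vol (eball x e `&` A)).
Proof.
move=> mA; have mB := measurable_eball x e.
have mBA : measurable (eball x e `&` A) by exact: measurableI.
have fB : (vol (eball x e `&` A) < +oo)%E.
  apply: (@le_lt_trans _ _ (vol (eball x e))).
    by apply: le_measure; rewrite ?inE//.
  by rewrite -ge0_fin_numE// vol_eball_fin// ltW.
have c0 : 0 <= mollifier_const / e ^+ n.+1.
  by rewrite divr_ge0 ?exprn_ge0 ?(ltW e0)// ltW// mollifier_const_gt0.
rewrite /smooth -RintegralZl//; last exact: integrable_mollifier.
apply: (@le_trans _ _ (\int[vol]_y (mollifier_const / e ^+ n.+1 * \1_(eball x e `&` A) y))).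
  apply: le_Rintegral => //.
  - rewrite (_ : EFin \o _ = (fun y => mass^-1%:E * (\1_A y * mollifier (y - x))%:E)%E)//.
    by apply: integrableZl => //; exact: integrable_mollifier.
  - exact: integrable_cst_indic.
  move=> y _; have [[By Ay]|nBA] := pselect ((eball x e `&` A) y).
    have BAy : (eball x e `&` A) y by [].
    rewrite !indicE (mem_set Ay) (mem_set BAy) mul1r mulr1 mulrC.
    exact: mollifier_mass_le.
  rewrite [X in _ <= _ * X]indicE memNset// mulr0.
  rewrite indicE; have [Ay|Ay] := pselect (A y); last by rewrite memNset// mul0r mulr0.
  rewrite /mollifier /sqpos mollifier_out ?expr0n/= ?mulr0// => h; apply: nBA; split=> //.
  by rewrite /eball/= enorm_lt.
rewrite RintegralZl//; last first.
  have := integrable_cst_indic (m := vol) 1 mBA fB.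
  by under eq_fun do rewrite mul1r.
by rewrite /Rintegral integral_indic// setIT.
Qed.

End kernel.

(** Where the complement of [B] has density one, the volume of [B] in small balls is negligible
    against [e ^+ n.+1], so the mollified indicator of [B] tends to 0. Apply this to [A] or to its
    complement. *)
Lemma smooth_cvg (A : set space) : measurable A ->
  {ae vol, forall x, smooth k.+1%:R^-1 A x @[k --> \oo] --> (\1_A x : R)}.
Proof.
move=> mA; have mcA := measurableC mA.
have vanish (B : set space) x : measurable B -> density_one (~` B) x ->
    smooth k.+1%:R^-1 B x @[k --> \oo] --> (0 : R).
  move=> mB; rewrite density_oneP; last exact: measurableC.
  move=> H; apply/cvgrPdist_le => d d0.
  have M0 := @mollifier_const_gt0.
  have [r /= r0 rH] := H _ (divr_gt0 d0 M0).
  near=> k; have k0 : 0 < k.+1%:R^-1 :> R by rewrite invr_gt0.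
  have kr : ball_ Num.norm 0 r (k.+1%:R^-1 : R).
    rewrite /ball_/= sub0r normrN gtr0_norm//.
    by near: k; exact: near_infty_natSinv_lt (PosNum r0).
  rewrite sub0r normrN ger0_norm ?smooth_ge0//.
  apply: le_trans (smooth_le_density k0 x mB) _.
  have h : (vol (eball x k.+1%:R^-1 `&` B) <=
      (d / mollifier_const * k.+1%:R^-1 ^+ n.+1)%:E)%E.
    by have := rH _ kr k0; rewrite setDE setCK.
  have {}h : fine (vol (eball x k.+1%:R^-1 `&` B)) <= d / mollifier_const * k.+1%:R^-1 ^+ n.+1.
    by rewrite -lee_fin fineK// ge0_fin_numE//; exact: le_lt_trans h (ltry _).
  set p := (k.+1%:R^-1 : R) ^+ n.+1 in h *.
  have p0 : 0 < p by rewrite exprn_gt0.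
  rewrite mulrAC ler_pdivrMr// mulrC -ler_pdivlMr//; apply: le_trans h _.
  by rewrite le_eqVlt; apply/orP; left; apply/eqP; field; rewrite gt_eqF.
have D1 := ae_density_one mA; have D2 := ae_density_one mcA.
move: D1 D2; apply: filterS2 => x D1 D2; rewrite indicE.
have [Ax|nAx] := pselect (A x).
  rewrite mem_set//.
  have -> : (fun k : nat => smooth k.+1%:R^-1 A x) = (fun k => 1 - smooth k.+1%:R^-1 (~` A) x).
    apply/funext => k; have k0 : 0 < k.+1%:R^-1 :> R by rewrite invr_gt0.
    by apply/eqP; rewrite eq_sym subr_eq smoothC.
  rewrite -[X in _ --> X]subr0; apply: cvgB; first exact: cvg_cst.
  by apply: vanish => //; rewrite setCK; exact/D1.
rewrite memNset//; apply: vanish => //; exact/D2.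
Unshelve. all: by end_near. Qed.

End mollifier.

(** * Submodularity of the perimeter *)

Section fields.
Context {R : realType} {n : nat}.
Local Notation space := ('rV[R]_n * R)%type.
Implicit Types x h v y w : space.
Implicit Types phi psi : space -> space.

Definition field_C1 phi :=
  (forall i, C1 (fun x => (phi x).1 ord0 i)) /\ C1 (fun x => (phi x).2).

(** The height [d] measures how far the field may be pushed towards the boundary of the half-space
    before leaving it. *)
Definition supported (d M : R) phi :=
  forall x, phi x <> 0 -> d <= x.2 /\ box M x.

Lemma space_eqP x y : (forall i, x.1 ord0 i = y.1 ord0 i) -> x.2 = y.2 -> x = y.
Proof. by case: x y => [x1 x2] [y1 y2] /= h ->; congr pair; apply/rowP. Qed.

Lemma supported0 d M phi x : supported d M phi -> ~ (d <= x.2 /\ box M x) -> phi x = 0.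
Proof. by move=> s nb; apply: contrapT => /s. Qed.

Lemma supp_coord d M phi i : supported d M phi ->
  supp_in M (fun x => (phi x).1 ord0 i).
Proof.
move=> s x h; have [] // := s x; apply: contra_not h => ->.
by rewrite mxE.
Qed.

Lemma supp_last d M phi : supported d M phi -> supp_in M (fun x => (phi x).2).
Proof. by move=> s x h; have [] // := s x; apply: contra_not h => ->. Qed.

Lemma derive_coord phi x v i : differentiable phi x ->
  differentiable (fun y => (phi y).1 ord0 i) x /\
  'D_v (fun y => (phi y).1 ord0 i) x = ('D_v phi x).1 ord0 i.
Proof.
move=> dphi; have dl := (@C1_coord R n i).1.1 (phi x).
have dc : differentiable (fun y => (phi y).1 ord0 i) x.
  exact: (differentiable_comp dphi dl).
split=> //; rewrite deriveE//.
rewrite (@diff_comp _ _ _ _ phi (fun y : space => y.1 ord0 i) x dphi dl).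
by rewrite /= -deriveE// (C1_coord i).2 deriveE.
Qed.

Lemma derive_last phi x v : differentiable phi x ->
  differentiable (fun y => (phi y).2) x /\
  'D_v (fun y => (phi y).2) x = ('D_v phi x).2.
Proof.
move=> dphi; have dl := (@C1_last R n).1.1 (phi x).
have dc : differentiable (fun y => (phi y).2) x.
  exact: (differentiable_comp dphi dl).
split=> //; rewrite deriveE//.
rewrite (@diff_comp _ _ _ _ phi (fun y : space => y.2) x dphi dl).
by rewrite /= -deriveE// C1_last.2 deriveE.
Qed.

Lemma row_sum (f : 'I_n -> R) : \row_i f i = \sum_(i < n) f i *: delta_mx ord0 i :> 'rV[R]_n.
Proof.
apply/rowP => j; rewrite !mxE summxE (bigD1 j)//= big1 => [|i ij].
  by rewrite !mxE !eqxx mulr1 addr0.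
by rewrite !mxE eqxx/= eq_sym (negbTE ij) mulr0.
Qed.

Lemma field_C1_differentiable phi x : field_C1 phi -> differentiable phi x.
Proof.
move=> [c1 c2].
have -> : phi = fun x => (((\sum_(i < n) (fun y => (phi y).1 ord0 i *: (delta_mx ord0 i : 'rV[R]_n))) : space -> 'rV[R]_n) x, (phi x).2).
  apply/funext => y; apply: space_eqP => //= i.
  by rewrite fct_sumE -row_sum mxE.
apply: differentiable_pair; last exact: c2.1.
apply: differentiable_sum => i; apply: differentiableZl; exact: (c1 i).1.
Qed.

Lemma field_C1_derive_continuous phi v : field_C1 phi -> continuous ('D_v phi).
Proof.
move=> cphi; have [c1 c2] := cphi.
apply: (@eq_continuous _ _ (fun x => (\sum_(i < n) 'D_v (fun y => (phi y).1 ord0 i) x *: (delta_mx ord0 i : 'rV[R]_n), 'D_v (fun y => (phi y).2) x))).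
  move=> x; have dphi := field_C1_differentiable x cphi.
  apply: space_eqP => /= [i|]; last by rewrite (derive_last v dphi).2.
  by rewrite -row_sum mxE (derive_coord v i dphi).2.
move=> x; have h2 := c2.2 v x.
have h1 : (fun x => \sum_(i < n) 'D_v (fun y => (phi y).1 ord0 i) x *:
    (delta_mx ord0 i : 'rV[R]_n)) y @[y --> x] -->
    \sum_(i < n) 'D_v (fun y => (phi y).1 ord0 i) x *: (delta_mx ord0 i : 'rV[R]_n).
  apply: cvg_big => [|i _]; first exact: add_continuous.
  by apply: cvgZ; [exact: (c1 i).2|exact: cvg_cst].
exact: cvg_pair h1 h2.
Qed.

(** The height attains a positive minimum on a compact support contained in the open half-space.
    Conversely, the support lies in the closed set of points of a box at height at least [d], which
    is compact and inside [Omega]. *)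
Lemma C1c_OmegaP phi : C1c_Omega phi <->
  exists d M, [/\ 0 < d, field_C1 phi & supported d M phi].
Proof.
split=> [[dphi cphi kphi ophi]|[d [M [d0 cphi sphi]]]].
- set K := closure _ in kphi ophi.
  have KM : exists M, K `<=` box M.
    have [M [_ MK]] := compact_bounded kphi; exists (M + 1) => x Kx.
    by apply: (@box_le _ _ `|x|); [apply: MK => //; rewrite ltrDl|exact: norm_box].
  have Kd : exists2 d, 0 < d & forall x, K x -> d <= x.2.
    have [K0|/set0P/negP/negPn/eqP K0] := pselect (K !=set0); last first.
      by exists 1 => // x; rewrite K0.
    have cK : {within K, continuous (fun x : space => x.2)}.
      by apply: continuous_subspaceT => x; exact: cvg_snd.
    have [c cK' cmin] := compact_EVT_min K0 kphi cK.
    exists c.2; first by apply: ophi; rewrite inE in cK'.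
    by move=> x Kx; apply: cmin; rewrite inE.
  have [M MK] := KM; have [d d0 dK] := Kd; exists d, M; split=> //.
    split=> [i|]; split=> [x|v].
    + exact: (derive_coord 0 i (dphi x)).1.
    + apply: (@eq_continuous _ _ (fun x => ('D_v phi x).1 ord0 i)) => [x|].
        by rewrite (derive_coord v i (dphi x)).2.
      move=> x; apply: (@cvg_comp _ _ _ ('D_v phi) (fun y : space => y.1 ord0 i)).
        exact: cphi.
      exact: (C1_continuous (C1_coord i).1).
    + exact: (derive_last 0 (dphi x)).1.
    + apply: (@eq_continuous _ _ (fun x => ('D_v phi x).2)) => [x|].
        by rewrite (derive_last v (dphi x)).2.
      move=> x; apply: (@cvg_comp _ _ _ ('D_v phi) (fun y : space => y.2)).
        exact: cphi.
      exact: cvg_snd.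
  move=> x /eqP px; have Kx : K x by apply: subset_closure.
  by split; [exact: dK|exact: MK].
- have cB : closed [set x : space | d <= x.2 /\ box M x].
    apply: closedI; last exact: closed_box.
    apply: (@closed_comp _ _ (fun x : space => x.2) [set t | d <= t]).
      by move=> x _; exact: cvg_snd.
    exact: closed_ge.
  have sB : closure [set x | phi x != 0] `<=` [set x : space | d <= x.2 /\ box M x].
    rewrite closureE => x; apply; split=> // y /= /eqP; exact: sphi.
  split.
  + by move=> x; exact: field_C1_differentiable.
  + by move=> v; exact: field_C1_derive_continuous.
  + apply: subclosed_compact (@compact_box R n M) _; first exact: closed_closure.
    by move=> x /sB[].
  + by move=> x /sB[dx _]; exact: lt_le_trans dx.
Qed.

Lemma divergence_continuous phi : field_C1 phi -> continuous (divergence phi).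
Proof.
move=> [c1 c2] x; apply: cvgD; last exact: c2.2.
apply: cvg_big => [|i _]; first exact: add_continuous.
exact: (c1 i).2.
Qed.

Lemma divergence_supp d M phi : supported d M phi -> supp_in M (divergence phi).
Proof.
move=> s x; apply: contra_notP => nb; rewrite /divergence.
rewrite big1 => [|i _]; last first.
  exact: (supp_in0 (derive_supp (supp_coord (i := i) s)) nb).
by rewrite (supp_in0 (derive_supp (supp_last s)) nb) addr0.
Qed.

Lemma divergence_Omega d M phi x : 0 < d -> supported d M phi -> ~ Omega x ->
  divergence phi x = 0.
Proof.
move=> d0 s nO.
have nz : \near x, phi x = 0.
  have oU : open [set y : space | y.2 < d].
    apply: (@open_comp _ _ (fun x : space => x.2) [set t | t < d]).
      by move=> y _; exact: cvg_snd.
    exact: open_lt.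
  have : nbhs x [set y : space | y.2 < d].
    apply: open_nbhs_nbhs; split=> //=; apply: le_lt_trans d0.
    by rewrite leNgt; apply/negP.
  apply: filterS => y /= yd; apply: (supported0 s) => -[dy _].
  by move: yd; rewrite ltNge dy.
rewrite /divergence big1 => [|i _].
  have : \near x, (phi x).2 = cst 0 x by apply: filterS nz => y ->.
  by move=> /near_eq_derive ->; rewrite derive_cst addr0.
have : \near x, (phi x).1 ord0 i = cst 0 x by apply: filterS nz => y ->; rewrite mxE.
by move=> /near_eq_derive ->; rewrite derive_cst.
Qed.

Lemma integral_divergence0 d M phi : field_C1 phi -> supported d M phi ->
  \int[vol]_x divergence phi x = 0.
Proof.
move=> [c1 c2] s; rewrite /divergence.
have ic i := integrable_cont_supp ((c1 i).2 (delta_mx ord0 i, 0))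
  (derive_supp (v := (delta_mx ord0 i, 0)) (supp_coord (i := i) s)).
have il := integrable_cont_supp (c2.2 (0, 1))
  (derive_supp (v := (0, 1)) (supp_last s)).
have is_ : vol.-integrable setT (EFin \o (fun x : space => \sum_(i < n)
   'D_(delta_mx ord0 i, 0) (fun y => (phi y).1 ord0 i) x)).
  rewrite (_ : EFin \o _ = (fun x => \sum_(i <- index_enum 'I_n)
     ('D_(delta_mx ord0 i, 0) (fun y => (phi y).1 ord0 i) x)%:E)%E).
    by apply: integrable_sum => // i _; exact: ic.
  by apply/funext => x /=; rewrite sumEFin.
rewrite RintegralD//.
rewrite (integral_derive0 (0, 1) c2 (supp_last s)) addr0.
rewrite /Rintegral; under eq_integral do rewrite -sumEFin.
rewrite integral_sum//.
rewrite big1// => i _.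
have := integral_derive0 (delta_mx ord0 i, 0) (c1 i) (supp_coord (i := i) s).
rewrite /Rintegral => E; rewrite -[LHS]fineK ?E//.
exact: integrable_fin_num (ic i).
Qed.

Lemma derive_field_sum (a : space -> R) x w : C1 a ->
  'D_w a x = \sum_(i < n) w.1 ord0 i * 'D_(delta_mx ord0 i, 0) a x + w.2 * 'D_(0, 1) a x.
Proof.
move=> ca; rewrite !deriveE_C1//; under eq_bigr do rewrite deriveE_C1//.
have wE : w = \sum_(i < n) w.1 ord0 i *: (delta_mx ord0 i, 0) + w.2 *: (0, 1).
  have fs (g : 'I_n -> space) : (\sum_(i < n) g i).1 = \sum_(i < n) (g i).1.
    exact: (big_morph fst).
  have ss (g : 'I_n -> space) : (\sum_(i < n) g i).2 = \sum_(i < n) (g i).2.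
    exact: (big_morph snd).
  apply: space_eqP => /= [j|]; rewrite ?fs ?ss/=.
    by rewrite scaler0 addr0 -row_sum mxE.
  by rewrite big1 ?add0r ?[_ *: 1]mulr1// => i _; rewrite scaler0.
rewrite [in LHS]wE linearD linearZ linear_sum/=; congr (_ + _).
by apply: eq_bigr => i _; rewrite linearZ.
Qed.

Lemma divergence_scale (a : space -> R) phi x : C1 a -> field_C1 phi ->
  divergence (fun y => a y *: phi y) x = a x * divergence phi x + 'D_(phi x) a x.
Proof.
move=> ca [c1 c2]; rewrite /divergence (derive_field_sum _ _ ca).
have E i v : 'D_v (fun y => (a y *: phi y).1 ord0 i) x =
    a x * 'D_v (fun y => (phi y).1 ord0 i) x + (phi x).1 ord0 i * 'D_v a x.
  by rewrite -deriveM_C1//; congr ('D_v _ x); apply/funext => y; rewrite mxE.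
under eq_bigr do rewrite E.
rewrite (deriveM_C1 (f := a) (g := fun y => (phi y).2))// big_split/= mulrDr mulr_sumr.
by rewrite addrACA.
Qed.

Lemma field_C1_scale (a : space -> R) phi : C1 a -> field_C1 phi ->
  field_C1 (fun y => a y *: phi y).
Proof.
move=> ca [c1 c2]; split=> [i|]; last exact: C1M.
by apply: eq_C1 (C1M ca (c1 i)) => x; rewrite mxE.
Qed.

Lemma divergenceD phi psi x : field_C1 phi -> field_C1 psi ->
  divergence (fun y => phi y + psi y) x = divergence phi x + divergence psi x.
Proof.
move=> [c1 c2] [e1 e2]; rewrite /divergence.
have E i v : 'D_v (fun y => (phi y + psi y).1 ord0 i) x =
    'D_v (fun y => (phi y).1 ord0 i) x + 'D_v (fun y => (psi y).1 ord0 i) x.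
  by rewrite -deriveD_C1//; congr ('D_v _ x); apply/funext => y; rewrite mxE.
under eq_bigr do rewrite E.
by rewrite (deriveD_C1 (f := fun y => (phi y).2) (g := fun y => (psi y).2))// big_split/= addrACA.
Qed.

Lemma field_C1D phi psi : field_C1 phi -> field_C1 psi ->
  field_C1 (fun y => phi y + psi y).
Proof.
move=> [c1 c2] [e1 e2]; split=> [i|]; last exact: C1D.
by apply: eq_C1 (C1D (c1 i) (e1 i)) => x; rewrite mxE.
Qed.

Lemma field_C1_cst w : field_C1 (fun _ => w).
Proof. by split=> [i|]; exact: C1_cst. Qed.

Lemma divergence_cst w x : divergence (fun _ => w) x = 0.
Proof.
rewrite /divergence big1 => [|i _]; first by rewrite add0r (derive_cst (w.2)).
by rewrite (derive_cst (w.1 ord0 i)).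
Qed.

Lemma field_C1_translate phi h : field_C1 phi -> field_C1 (fun y => phi (y + h)).
Proof.
move=> [c1 c2]; split=> [i|].
  exact: (C1_translate h (c1 i)).
exact: (C1_translate h c2).
Qed.

Lemma divergence_translate phi h x :
  divergence (fun y => phi (y + h)) x = divergence phi (x + h).
Proof.
rewrite /divergence; congr (_ + _).
  apply: eq_bigr => i _.
  exact: (derive_translate (fun y => (phi y).1 ord0 i)).
exact: (derive_translate (fun y => (phi y).2)).
Qed.

(** Keeps the pointwise bound on the length when two admissible fields are blended. *)
Lemma sqnorm_convex (t : R) x y : 0 <= t <= 1 -> sqnorm x <= 1 -> sqnorm y <= 1 ->
  sqnorm (t *: x + (1 - t) *: y) <= 1.
Proof.
move=> /andP[t0 t1] x1 y1.
apply: (@le_trans _ _ (t * sqnorm x + (1 - t) * sqnorm y)); last first.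
  have : t * sqnorm x <= t * 1 by rewrite ler_wpM2l.
  have : (1 - t) * sqnorm y <= (1 - t) * 1 by rewrite ler_wpM2l// subr_ge0.
  by lra.
have sq (a b : R) : (t * a + (1 - t) * b) ^+ 2 <= t * a ^+ 2 + (1 - t) * b ^+ 2.
  have : 0 <= t * (1 - t) * (a - b) ^+ 2 by rewrite mulr_ge0 ?sqr_ge0// mulr_ge0// subr_ge0.
  by nra.
rewrite /sqnorm !mulrDr addrACA !mulr_sumr -big_split/=; apply: lerD; last exact: sq.
by apply: ler_sum => i _; rewrite !mxE; exact: sq.
Qed.

End fields.

(** * Fluxes of mollified sets and submodularity *)

Section flux.
Context {R : realType} {n : nat}.
Local Notation space := ('rV[R]_n * R)%type.
Implicit Types x h v y w : space.
Implicit Types phi psi : space -> space.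
Implicit Types E F A : set space.

Definition flux E phi : R := \int[vol]_x (\1_E x * divergence phi x).

Lemma integrable_weight d M phi (u : space -> R) C : field_C1 phi ->
  supported d M phi -> measurable_fun setT u -> (forall x, `|u x| <= C) ->
  vol.-integrable setT (EFin \o (fun x => u x * divergence phi x)).
Proof.
move=> cphi sphi mu uC; have cd := divergence_continuous cphi.
have sd := divergence_supp sphi; have [D D0 DP] := bounded_supp cd sd.
apply: (@integrable_supp _ _ M (C * D)).
- by apply: measurable_funM => //; exact: continuous_measurable_space.
- by move=> x; rewrite normrM; apply: ler_pM.
- by move=> x; apply: contra_notP => nb; rewrite (supp_in0 sd)// mulr0.
Qed.

Lemma indic_norm_le1 E x : `|\1_E x : R| <= 1.
Proof. by rewrite ger0_norm// indicE lern1; case: (_ \in _). Qed.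

Lemma integrable_flux d M E phi : measurable E -> field_C1 phi -> supported d M phi ->
  vol.-integrable setT (EFin \o (fun x => \1_E x * divergence phi x)).
Proof.
move=> mE cphi sphi; apply: (@integrable_weight _ _ _ _ 1 cphi sphi) => //.
exact: indic_norm_le1.
Qed.

Lemma flux_Omega d M E phi : measurable E -> 0 < d -> field_C1 phi -> supported d M phi ->
  (\int[vol]_(x in Omega) (\1_E x * divergence phi x)%:E = (flux E phi)%:E)%E.
Proof.
move=> mE d0 cphi sphi; rewrite /flux /Rintegral fineK; last first.
  exact: integrable_fin_num (integrable_flux mE cphi sphi).
rewrite [LHS]integral_mkcond; apply: eq_integral => x _; rewrite patchE.
case: ifPn => // /negP xO; rewrite (divergence_Omega d0 sphi) ?mulr0// => h.
by apply: xO; rewrite inE.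
Qed.

Definition admissible (d M : R) phi :=
  [/\ 0 < d, field_C1 phi, supported d M phi & forall x, sqnorm (phi x) <= 1].

Lemma flux_le_perimeter d M E phi : measurable E -> admissible d M phi ->
  ((flux E phi)%:E <= perimeter E)%E.
Proof.
move=> mE [d0 cphi sphi nphi]; rewrite -(flux_Omega mE d0 cphi sphi).
apply: ereal_sup_ubound; exists phi => //; split.
  by apply/C1c_OmegaP; exists d, M.
by move=> x; rewrite enorm_le1.
Qed.

Lemma perimeter_le E (c : R) : measurable E ->
  (forall d M phi, admissible d M phi -> flux E phi <= c) -> (perimeter E <= c%:E)%E.
Proof.
move=> mE H; apply: ub_ereal_sup => _ [phi [/C1c_OmegaP[d [M [d0 cphi sphi]]] nphi] <-].
rewrite (flux_Omega mE d0 cphi sphi) lee_fin; apply: (H d M).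
by split=> // x; rewrite -enorm_le1.
Qed.

Lemma admissible0 : admissible 1 0 (fun _ => 0).
Proof.
split=> //; first exact: field_C1_cst.
by move=> x; rewrite /sqnorm big1 => [|i _]; rewrite ?mxE expr0n//= add0r.
Qed.

Lemma perimeter_ge0 E : measurable E -> (0 <= perimeter E)%E.
Proof.
move=> mE; apply: le_trans (flux_le_perimeter mE admissible0).
rewrite lee_fin /flux; under eq_Rintegral do rewrite divergence_cst mulr0.
by rewrite Rintegral_cst// mul0r.
Qed.

Lemma eq_perimeter E F : measurable E -> measurable F ->
  {ae vol, forall x, E x <-> F x} -> perimeter E = perimeter F.
Proof.
move=> mE mF EF; congr ereal_sup; apply: eq_imagel => phi /= [/C1c_OmegaP[d [M [d0 cphi sphi]]] _].
rewrite (flux_Omega mE d0 cphi sphi) (flux_Omega mF d0 cphi sphi); congr (_ %:E).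
congr fine; apply: ae_eq_integral => //.
- exact: measurable_int (integrable_flux mE cphi sphi).
- exact: measurable_int (integrable_flux mF cphi sphi).
apply: filterS EF => x EF _; congr ((_ * _)%:E); rewrite !indicE; congr ((nat_of_bool _)%:R).
by apply/idP/idP; rewrite !inE => /EF.
Qed.

Lemma supported_translate d M e phi w : supported d M phi -> box e w ->
  supported (d - e) (M + e) (fun x => phi (x - w)).
Proof.
move=> sphi bw x /sphi /= [dx bx]; have [_ w2] := bw; split.
  by move: dx w2; rewrite ler_norml; lra.
by rewrite -(subrK w x); exact: boxD.
Qed.

Lemma admissible_translate d M e phi w : admissible d M phi -> e < d -> box e w ->
  admissible (d - e) (M + e) (fun x => phi (x - w)).
Proof.
move=> [d0 cphi sphi nphi] ed bw; split.
- by rewrite subr_gt0.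
- exact: field_C1_translate.
- exact: supported_translate.
- by move=> x; exact: nphi.
Qed.

(* The mollification of [1_A] is an average of translates of [1_A]. *)
Lemma smooth_flux d M e A phi (p : R) : measurable A -> admissible d M phi ->
  0 < e -> e < d -> (perimeter A <= p%:E)%E ->
  \int[vol]_x (smooth e A x * divergence phi x) <= p.
Proof.
move=> mA aphi e0 ed Ap; have [d0 cphi sphi nphi] := aphi.
have cd := divergence_continuous cphi; have sd := divergence_supp sphi.
have [D D0 DP] := bounded_supp cd sd.
have [B B0 BP] := bounded_supp (@mollifier_continuous R n e) (mollifier_supp e0).
pose f (z : space * space) : \bar R :=
  (\1_A (z.1 + z.2) * mollifier e z.2 * divergence phi z.1)%:E.
have mf : measurable_fun setT f.
  apply/measurable_EFinP; apply: measurable_funM; first apply: measurable_funM.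
  - apply: (@measurableT_comp _ _ _ _ _ _ (\1_A : space -> R)).
      exact: measurable_indic.
    by apply: measurable_fun_spaceD.
  - apply: (@measurableT_comp _ _ _ _ _ _ (mollifier e : space -> R)) => //.
    by apply: continuous_measurable_space; exact: mollifier_continuous.
  - apply: (@measurableT_comp _ _ _ _ _ _ (divergence phi)) => //.
    exact: continuous_measurable_space.
have ib x : vol.-integrable setT (EFin \o (fun w => \1_A (x + w) * mollifier e w)).
  apply: (@integrable_supp _ _ e B).
  - apply: measurable_funM; last first.
      by apply: continuous_measurable_space; exact: mollifier_continuous.
    apply: (@measurableT_comp _ _ _ _ _ _ (\1_A : space -> R)); first exact: measurable_indic.
    by apply: measurable_fun_spaceD => //; exact: measurable_cst.
  - move=> w; rewrite normrM -[leRHS]mul1r ler_pM//; exact: indic_norm_le1.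
  - move=> w; apply: contra_notP => nb; by rewrite (supp_in0 (mollifier_supp e0))// mulr0.
have smoothE x : (smooth e A x * divergence phi x)%:E =
    ((mass (n := n) e)^-1%:E * \int[svol]_w f (x, w))%E.
  rewrite /f /= /smooth -mulrA EFinM; congr (_ * _)%E.
  under eq_integral do rewrite EFinM muleC.
  rewrite integralZl//; last exact: ib.
  rewrite muleC EFinM; congr (_ * _)%E.
  rewrite /Rintegral fineK; last first.
    exact: integrable_fin_num (integrable_mollifier e0 mA x).
  rewrite -(@integral_translate _ _ x (fun w => \1_A w * mollifier e (w - x))); first last.
  - by under eq_fun do rewrite addrK addrC; exact: ib.
  - by apply/measurable_EFinP; exact: measurable_int (integrable_mollifier e0 mA x).
  by apply: eq_integral => w _; rewrite addrK addrC.
have idw w : vol.-integrable setT (EFin \o (fun x => \1_A (x + w) * divergence phi x)).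
  apply: (@integrable_weight _ _ _ _ 1 cphi sphi) => [|x]; last exact: indic_norm_le1.
  apply: (@measurableT_comp _ _ _ _ _ _ (\1_A : space -> R)); first exact: measurable_indic.
  by apply: measurable_fun_spaceD => //; exact: measurable_cst.
have ifl w : vol.-integrable setT (EFin \o (fun x => \1_A x * divergence (fun y => phi (y - w)) x)).
  exact: (integrable_flux mA (field_C1_translate (- w) cphi)
    (supported_translate sphi (norm_box w))).
have fluxE w : (\int[svol]_x f (x, w) = (mollifier e w * flux A (fun x => phi (x - w)))%:E)%E.
  rewrite /f /=; under eq_integral do rewrite mulrAC mulrC EFinM.
  rewrite integralZl//; last exact: idw.
  rewrite [RHS]EFinM; congr (_ * _)%E.
  rewrite /flux /Rintegral fineK; last exact: integrable_fin_num (ifl w).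
  rewrite -(@integral_translate _ _ w (fun x => \1_A x * divergence (fun x => phi (x - w)) x)); first last.
  - by under eq_fun do rewrite divergence_translate addrK; exact: idw.
  - by apply/measurable_EFinP; exact: measurable_int (ifl w).
  by apply: eq_integral => x _; rewrite divergence_translate addrK.
have idv : vol.-integrable setT (EFin \o (fun x => `|divergence phi x|)).
  exact: integrable_norm (integrable_cont_supp cd sd).
have m0 := mass_gt0 (n := n) e0.
(* The absolute value of [f] is at most the kernel in [w] times the absolute divergence in [x], a
   product of integrable functions. *)
have intf : (svol \x svol)%E.-integrable setT f.
  apply/(integrable12ltyP _ _ mf).
  apply: (@le_lt_trans _ _ (\int[svol]_x ((mass (n := n) e)%:E * (`|divergence phi x|)%:E))%E); last first.
    by rewrite integralZl// lte_mul_pinfty ?lee_fin ?ltW// integrable_lty.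
  apply: ge0_le_integral => //.
  - by move=> x _; exact: integral_ge0.
  - apply: (measurable_fun_fubini_tonelli_F (abse \o f)) => [|z]; last exact: abse_ge0.
    exact: measurableT_comp.
  - by apply: measurable_int; exact: integrableZl idv.
  move=> x _; rewrite /f /=.
  have -> : ((mass (n := n) e)%:E * (`|divergence phi x|)%:E =
      \int[@svol R n]_w ((`|divergence phi x|)%:E * (mollifier e w)%:E))%E.
    rewrite integralZl//; last exact: mollifier_integrable.
    rewrite muleC; congr (_ * _)%E; rewrite /mass /Rintegral fineK//.
    exact: integrable_fin_num (mollifier_integrable e0).
  apply: ge0_le_integral => //.
  - apply/measurable_EFinP; apply: measurableT_comp => //.
    apply: measurable_funM => //; apply/measurable_EFinP; exact: measurable_int (ib x).
  - by apply: measurable_int; apply: integrableZl => //; exact: mollifier_integrable.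
  move=> w _; rewrite -EFinM lee_fin normrM mulrC ler_wpM2l// normrM.
  rewrite -[leRHS]mul1r (ger0_norm (mollifier_ge0 _ _)) ler_wpM2r ?mollifier_ge0//.
  exact: indic_norm_le1.
rewrite /Rintegral; under eq_integral do rewrite smoothE.
rewrite integralZl//; last exact: (integrable_fubini_F intf).
rewrite (Fubini intf).
have mG := measurable_fubini_G intf.
have iG : svol.-integrable setT (fun w => \int[svol]_x f (x, w))%E.
  apply/integrableP; split=> //.
  apply: le_lt_trans ((integrable21ltyP _ _ mf).1 intf).
  apply: ge0_le_integral => //.
  - exact: measurableT_comp.
  - apply: (measurable_fun_fubini_tonelli_G (abse \o f)) => [|z]; last exact: abse_ge0.
    exact: measurableT_comp.
  - move=> w _; apply: le_abse_integral => //.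
    exact: (measurableT_comp mf (measurable_pair2 w)).
have fG := integrable_fin_num measurableT iG.
have le : (\int[svol]_w \int[svol]_x f (x, w) <= p%:E * (mass (n := n) e)%:E)%E.
  have -> : (p%:E * (mass (n := n) e)%:E = \int[@svol R n]_w (p%:E * (mollifier e w)%:E))%E.
    rewrite integralZl//; last exact: mollifier_integrable.
    congr (_ * _)%E; rewrite /mass /Rintegral fineK//.
    exact: integrable_fin_num (mollifier_integrable e0).
  apply: le_integral => //.
    by apply: integrableZl => //; exact: mollifier_integrable.
  move=> w _; rewrite fluxE -EFinM lee_fin.
  (* Only translations by vectors in the support of the kernel count, and [e < d] keeps the
     translated field inside [Omega]. *)
  have [bw|nb] := pselect (box e w); last by rewrite (supp_in0 (mollifier_supp e0))// mul0r mulr0.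
  rewrite mulrC ler_wpM2r ?mollifier_ge0// -lee_fin; apply: le_trans Ap.
  exact: flux_le_perimeter (admissible_translate aphi ed bw).
rewrite -lee_fin fineK; last by rewrite fin_numM.
rewrite -(fineK fG) in le *; move: le; rewrite -!EFinM !lee_fin => le.
by rewrite mulrC ler_pdivrMr.
Qed.

Lemma weight_cvg d M phi (u_ : nat -> space -> R) (u : space -> R) :
  field_C1 phi -> supported d M phi ->
  (forall k, measurable_fun setT (u_ k)) -> measurable_fun setT u ->
  (forall k x, `|u_ k x| <= 1) ->
  {ae vol, forall x, u_ k x @[k --> \oo] --> u x} ->
  \int[vol]_x (u_ k x * divergence phi x) @[k --> \oo] -->
    \int[vol]_x (u x * divergence phi x).
Proof.
move=> cphi sphi mu_ mu u1 uu; have cd := divergence_continuous cphi.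
have md : measurable_fun setT (divergence phi) by exact: continuous_measurable_space.
have idv : vol.-integrable setT (EFin \o (fun x => `|divergence phi x|)).
  exact: integrable_norm (integrable_cont_supp cd (divergence_supp sphi)).
have [|||||i _ c] := @dominated_convergence _ _ _ vol setT measurableT
    (fun k x => (u_ k x * divergence phi x)%:E)
    (fun x => (u x * divergence phi x)%:E) (fun x => (`|divergence phi x|)%:E).
- by move=> k; apply/measurable_EFinP; exact: measurable_funM.
- by apply/measurable_EFinP; exact: measurable_funM.
- apply: filterS uu => x ux _; apply: cvg_EFin; first by near=> k.
  by apply: cvgM => //; exact: cvg_cst.
- exact: idv.
- apply: aeW => x k _; rewrite lee_fin normrM -[leRHS]mul1r ler_wpM2r//.
by apply: fine_cvg; rewrite fineK// integrable_fin_num.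
Unshelve. all: by end_near. Qed.

Lemma smooth_measurable e A : 0 < e -> measurable A -> measurable_fun setT (smooth e A).
Proof.
move=> e0 mA; apply: continuous_measurable_space.
by apply: C1_continuous; exact: C1_smooth.
Qed.

Definition blend (f g : space -> R) phi psi x : space := f x *: phi x + g x *: psi x.

Lemma field_C1_blend f g phi psi : C1 f -> C1 g -> field_C1 phi -> field_C1 psi ->
  field_C1 (blend f g phi psi).
Proof.
move=> cf cg cphi cpsi.
exact: (field_C1D (field_C1_scale cf cphi) (field_C1_scale cg cpsi)).
Qed.

Lemma divergence_blend f g phi psi x : C1 f -> C1 g -> field_C1 phi -> field_C1 psi ->
  divergence (blend f g phi psi) x =
  f x * divergence phi x + 'D_(phi x) f x + (g x * divergence psi x + 'D_(psi x) g x).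
Proof.
move=> cf cg cphi cpsi.
rewrite (divergenceD x (field_C1_scale cf cphi) (field_C1_scale cg cpsi)).
by rewrite (divergence_scale x cf cphi) (divergence_scale x cg cpsi).
Qed.

Lemma supported_blend d1 M1 d2 M2 f g phi psi :
  supported d1 M1 phi -> supported d2 M2 psi ->
  supported (Num.min d1 d2) (Num.max M1 M2) (blend f g phi psi).
Proof.
move=> s1 s2 x; rewrite /blend; have [->|/s1[h1 h2] _] := pselect (phi x = 0).
  have [->|/s2[h1 h2] _] := pselect (psi x = 0); first by rewrite !scaler0 addr0.
  split; first by rewrite ge_min h1 orbT.
  by apply: box_le h2; rewrite le_max lexx orbT.
split; first by rewrite ge_min h1.
by apply: box_le h2; rewrite le_max lexx.
Qed.

Lemma C1_compl (f : space -> R) : C1 f -> C1 (fun x => 1 - f x).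
Proof. by move=> cf; apply: C1B cf; exact: C1_cst. Qed.

Lemma derive_compl (f : space -> R) x v : C1 f -> 'D_v (fun y => 1 - f y) x = - 'D_v f x.
Proof.
move=> cf; rewrite (deriveD_C1 x v (C1_cst _ (1 : R)) (C1N cf)) (deriveN_C1 x v cf).
by rewrite (derive_cst (1 : R)) add0r.
Qed.

Lemma admissible_blend d1 M1 d2 M2 f phi psi : C1 f -> (forall x, 0 <= f x <= 1) ->
  admissible d1 M1 phi -> admissible d2 M2 psi ->
  admissible (Num.min d1 d2) (Num.max M1 M2) (blend f (fun x => 1 - f x) phi psi).
Proof.
move=> cf f01 [d10 c1 s1 n1] [d20 c2 s2 n2]; split.
- by rewrite lt_min d10.
- apply: field_C1_blend => //; exact: C1_compl.
- exact: supported_blend.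
- by move=> x; exact: sqnorm_convex.
Qed.

Lemma itv01M (a b : R) : 0 <= a <= 1 -> 0 <= b <= 1 -> 0 <= a * b <= 1.
Proof. by move=> /andP[? ?] /andP[? ?]; rewrite mulr_ge0//= mulr_ile1. Qed.

Lemma itv01_join (a b : R) : 0 <= a <= 1 -> 0 <= b <= 1 -> 0 <= a + b - a * b <= 1.
Proof. by move=> /andP[? ?] /andP[? ?]; apply/andP; split; nra. Qed.

Lemma smooth_submodular d1 M1 phi1 d2 M2 phi2 E F (e p q : R) :
  measurable E -> measurable F ->
  (perimeter E <= p%:E)%E -> (perimeter F <= q%:E)%E ->
  admissible d1 M1 phi1 -> admissible d2 M2 phi2 ->
  0 < e -> e < d1 -> e < d2 ->
  \int[vol]_x (smooth e E x * smooth e F x * divergence phi1 x) +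
  \int[vol]_x ((smooth e E x + smooth e F x - smooth e E x * smooth e F x) *
    divergence phi2 x) <= p + q.
Proof.
move=> mE mF Ep Fq ad1 ad2 e0 ed1 ed2.
have [d10 c1 s1 n1] := ad1; have [d20 c2 s2 n2] := ad2.
set a := smooth e E; set b := smooth e F.
have ca : C1 a by exact: C1_smooth.
have cb : C1 b by exact: C1_smooth.
have ma : measurable_fun setT a by exact: smooth_measurable.
have mb : measurable_fun setT b by exact: smooth_measurable.
have ed : e < Num.min d1 d2 by rewrite lt_min ed1.
have a01 x : 0 <= a x <= 1 by rewrite smooth_ge0// smooth_le1.
have b01 x : 0 <= b x <= 1 by rewrite smooth_ge0// smooth_le1.
have aX := admissible_blend cb b01 ad1 ad2.
have aY := admissible_blend ca a01 ad1 ad2.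
have hX := smooth_flux mE aX e0 ed Ep.
have hY := smooth_flux mF aY e0 ed Fq.
have cab : C1 (fun x => a x * b x) by exact: C1M.
(* The integration by parts: with u, v the mollified indicators, the divergence of uv(Y - X) has
   integral zero, and adding it to the two divergences cancels every derivative of u and v
   pointwise. *)
have cZ := field_C1_blend (C1N cab) cab c1 c2.
have sZ := supported_blend (f := fun x => - (a x * b x)) (g := fun x => a x * b x) s1 s2.
have hZ := integral_divergence0 cZ sZ.
have iw (u : space -> R) psi d M : field_C1 psi -> supported d M psi -> measurable_fun setT u ->
    (forall x, 0 <= u x <= 1) -> vol.-integrable setT (EFin \o (fun x => u x * divergence psi x)).
  move=> cpsi spsi mu u01; apply: (integrable_weight (C := 1) cpsi spsi mu) => x.
  by have /andP[? ?] := u01 x; rewrite ger0_norm.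
have [_ cX sX _] := aX; have [_ cY sY _] := aY.
have iX := iw a _ _ _ cX sX ma a01.
have iY := iw b _ _ _ cY sY mb b01.
have iZ := integrable_cont_supp (divergence_continuous cZ) (divergence_supp sZ).
rewrite -RintegralD//; last 2 first.
- apply: (iw _ _ _ _ c1 s1); first exact: measurable_funM.
  by move=> x; exact: itv01M.
- apply: (iw _ _ _ _ c2 s2).
    by apply: measurable_funB; [exact: measurable_funD|exact: measurable_funM].
  by move=> x; exact: itv01_join.
have -> : p + q = p + q + 0 by rewrite addr0.
rewrite -hZ; apply: le_trans (lerD (lerD hX hY) (lexx _)).
have iXY : vol.-integrable setT (EFin \o (fun x =>
    a x * divergence (blend b (fun x => 1 - b x) phi1 phi2) x +
    b x * divergence (blend a (fun x => 1 - a x) phi1 phi2) x)).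
  exact: (integrableD measurableT iX iY).
rewrite -(RintegralD measurableT iX iY) -(RintegralD measurableT iXY iZ).
rewrite le_eqVlt; apply/orP; left; apply/eqP; apply: eq_Rintegral => x _ /=.
rewrite (divergence_blend x cb (C1_compl cb) c1 c2) (divergence_blend x ca (C1_compl ca) c1 c2).
rewrite (divergence_blend x (C1N cab) cab c1 c2) !derive_compl// (deriveN_C1 _ _ cab).
rewrite (deriveM_C1 x (phi1 x) ca cb) (deriveM_C1 x (phi2 x) ca cb).
move: (divergence phi1 x) (divergence phi2 x) (a x) (b x) ('D_(phi1 x) a x)
  ('D_(phi2 x) a x) ('D_(phi1 x) b x) ('D_(phi2 x) b x) => *; ring.
Qed.

(** The bound for mollified sets does not depend on the radius. Almost everywhere convergence passes
    to uv and u + v - uv, whose limits are the indicators of the intersection and the union. *)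
Lemma flux_submodular d1 M1 phi1 d2 M2 phi2 E F (p q : R) :
  measurable E -> measurable F ->
  (perimeter E <= p%:E)%E -> (perimeter F <= q%:E)%E ->
  admissible d1 M1 phi1 -> admissible d2 M2 phi2 ->
  flux (E `&` F) phi1 + flux (E `|` F) phi2 <= p + q.
Proof.
move=> mE mF Ep Fq ad1 ad2.
have [d10 c1 s1 n1] := ad1; have [d20 c2 s2 n2] := ad2.
have k0 k : (0 : R) < k.+1%:R^-1 by rewrite invr_gt0.
pose a k := smooth (k.+1%:R^-1 : R) E; pose b k := smooth (k.+1%:R^-1 : R) F.
have ma k : measurable_fun setT (a k) by exact: smooth_measurable.
have mb k : measurable_fun setT (b k) by exact: smooth_measurable.
have a01 k x : 0 <= a k x <= 1 by rewrite smooth_ge0// smooth_le1.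
have b01 k x : 0 <= b k x <= 1 by rewrite smooth_ge0// smooth_le1.
have indI x : \1_(E `&` F) x = \1_E x * \1_F x :> R by rewrite indicI.
have indU x : \1_(E `|` F) x = \1_E x + \1_F x - \1_E x * \1_F x :> R.
  by rewrite !indicE in_setU; case: (x \in E); case: (x \in F); rewrite /=; ring.
have cvg1 : \int[vol]_x (a k x * b k x * divergence phi1 x) @[k --> \oo] -->
    flux (E `&` F) phi1.
  apply: (weight_cvg c1 s1).
  - by move=> k; exact: measurable_funM.
  - by apply: measurable_indic; exact: measurableI.
  - by move=> k x; have /andP[h0 h1] := itv01M (a01 k x) (b01 k x); rewrite ger0_norm.
  - apply: filterS2 (smooth_cvg mE) (smooth_cvg mF) => x ax bx.
    by rewrite indI; exact: cvgM ax bx.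
have cvg2 : \int[vol]_x ((a k x + b k x - a k x * b k x) * divergence phi2 x)
    @[k --> \oo] --> flux (E `|` F) phi2.
  apply: (weight_cvg c2 s2).
  - move=> k.
    by apply: measurable_funB; [exact: measurable_funD|exact: measurable_funM].
  - by apply: measurable_indic; exact: measurableU.
  - by move=> k x; have /andP[h0 h1] := itv01_join (a01 k x) (b01 k x); rewrite ger0_norm.
  - apply: filterS2 (smooth_cvg mE) (smooth_cvg mF) => x ax bx.
    by rewrite indU; exact: cvgB (cvgD ax bx) (cvgM ax bx).
have le : \forall k \near \oo, \int[vol]_x (a k x * b k x * divergence phi1 x) +
    \int[vol]_x ((a k x + b k x - a k x * b k x) * divergence phi2 x) <= p + q.
  near=> k; apply: (smooth_submodular mE mF Ep Fq ad1 ad2 (k0 k)).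
    by near: k; exact: (near_infty_natSinv_lt (PosNum d10)).
  by near: k; exact: (near_infty_natSinv_lt (PosNum d20)).
have c := cvgD cvg1 cvg2; rewrite -(cvg_lim _ (c _))//.
by apply: limr_le le; apply/cvg_ex; eexists; exact: c _.
Unshelve. all: by end_near. Qed.

(** The two test fields are independent, so the suprema can be taken one after the other, first for
    the union and then for the intersection. The zero field for the intersection shows that the
    union has finite perimeter. *)
Lemma perimeter_submodular E F : measurable E -> measurable F ->
  (perimeter E < +oo)%E -> (perimeter F < +oo)%E ->
  (perimeter (E `&` F) + perimeter (E `|` F) <= perimeter E + perimeter F)%E.
Proof.
move=> mE mF PE PF.
have fE : perimeter E \is a fin_num by rewrite ge0_fin_numE// perimeter_ge0.
have fF : perimeter F \is a fin_num by rewrite ge0_fin_numE// perimeter_ge0.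
rewrite -(fineK fE) -(fineK fF); set p := fine _; set q := fine _.
have Ep : (perimeter E <= p%:E)%E by rewrite fineK.
have Fq : (perimeter F <= q%:E)%E by rewrite fineK.
have mI := measurableI _ _ mE mF; have mU := measurableU _ _ mE mF.
have sub d1 M1 phi1 d2 M2 phi2 (h1 : admissible d1 M1 phi1) (h2 : admissible d2 M2 phi2) :=
  flux_submodular mE mF Ep Fq h1 h2.
have PU d1 M1 phi1 : admissible d1 M1 phi1 ->
    (perimeter (E `|` F) <= (p + q - flux (E `&` F) phi1)%:E)%E.
  by move=> a1; apply: perimeter_le => // d2 M2 phi2 a2; rewrite lerBrDl; exact: sub a1 a2.
have fU : perimeter (E `|` F) \is a fin_num.
  rewrite ge0_fin_numE ?perimeter_ge0//.
  exact: le_lt_trans (PU _ _ _ admissible0) (ltry _).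
have PI : (perimeter (E `&` F) <= (p + q - fine (perimeter (E `|` F)))%:E)%E.
  apply: perimeter_le => // d1 M1 phi1 a1; have := PU _ _ _ a1.
  by rewrite -{1}(fineK fU) lee_fin; lra.
by rewrite -(fineK fU) -leeBrDr// -EFinD -EFinB.
Qed.

End flux.

(** * Vertical slices and traces *)

Section line_jumps.
Context {R : realType}.
Implicit Types (U : set R) (t h r a b : R).
Local Notation m := (@lebesgue_line R).

Lemma line_density U : measurable U ->
  {ae m, forall t, U t -> forall e : R, 0 < e ->
    \forall r \near 0^'+, (m ([set s | (`|s - t| < r)%R] `\` U) <= (e * r)%:E)%E}.
Proof.
move=> mU; have mB t r : measurable [set s : R | `|s - t| < r].
  by apply: measurable_set_lt => //; apply: measurableT_comp => //; apply: measurable_funB.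
have [_ _ _ /(_ _ mU)] := @density_basis_line R.
apply: filterS => t H Ut e e0.
suff : \forall r \near 0^'+, (m ([set s | (`|s - t| < r)%R] `\` U) <= (e * r ^+ 1)%:E)%E by [].
apply: (@dyadic_near R (fun r => m ([set s | `|s - t| < r] `\` U)) 1 2%R) e0 => //.
  move=> r s _ _ rs; apply: le_measure; rewrite ?inE.
  - exact: measurableD.
  - exact: measurableD.
  - by move=> y [yr nA]; split=> //; exact: lt_le_trans rs.
move=> d d0; have := H Ut _ d0; apply: filterS => j.
by rewrite xsectionE.
Qed.

Definition jumps U h : set R := [set t | (U (t + h) /\ ~ U t) \/ (~ U (t + h) /\ U t)].

Lemma measurable_jumps U h : measurable U -> measurable (jumps U h).
Proof.
move=> mU; have mUh : measurable [set t | U (t + h)].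
  exact: (preimage_measurable (preserves_line h).1 mU).
rewrite (_ : jumps U h = ([set t | U (t + h)] `\` U) `|` (U `\` [set t | U (t + h)])).
  by apply: measurableU; exact: measurableD.
by apply/seteqP; split=> t [[? ?]|[? ?]]; by [left|right].
Qed.

(** The amount of [U] in a window of length [h] changes, as the window slides from [a] to [b], by at
    most the measure of the jumps. Lowering the part of [U] between [a + h] and [b + h] by [h] lands
    in [U] or in a jump; comparing the two ways of cutting the interval from [a] to [b + h] gives
    the rest, overlapping windows included. *)
Lemma jumps_between U a b h : measurable U -> a <= b -> 0 < h ->
  (m (U `&` `]b, (b + h)%R[%classic) <=
   m (U `&` `]a, (a + h)%R]%classic) + m (`]a, b[%classic `&` jumps U h))%E.
Proof.
move=> mU ab h0.
pose W := U `&` `]a, b[%classic; pose V' := U `&` `](a + h)%R, (b + h)%R[%classic.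
pose V := (fun t => t + h) @^-1` V'; pose X := `]a, b[%classic `&` jumps U h.
have mW : measurable W by apply: measurableI => //; exact: measurable_itv.
have mV' : measurable V' by apply: measurableI => //; exact: measurable_itv.
have mV : measurable V by exact: (preimage_measurable (preserves_line h).1 mV').
have mX : measurable X.
  by apply: measurableI; [exact: measurable_itv|exact: measurable_jumps].
have mU0 : measurable (U `&` `]a, (a + h)%R]%classic).
  by apply: measurableI => //; exact: measurable_itv.
have mU1 : measurable (U `&` `]b, (b + h)%R[%classic).
  by apply: measurableI => //; exact: measurable_itv.
have VV : (m V' <= m W + m X)%E.
  rewrite -(preserves_line h).2//; apply: le_trans (measureU2 _ mW mX).
  apply: le_measure; rewrite ?inE//; first exact: measurableU.
  move=> t [Ut] /=; rewrite in_itv/= ltrD2r ltrD2r => tab.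
  have [ut|nut] := pselect (U t); first by left.
  by right; split; rewrite /= ?in_itv//; left.
have UU : (m (U `&` `]b, (b + h)%R[%classic) + m W <= m (U `&` `]a, (a + h)%R]%classic) + m V')%E.
  rewrite -measureU//; last first.
    by rewrite -subset0 => t [[_ /=]]; rewrite in_itv/= => i1 [_ /=]; rewrite in_itv/=; lra.
  apply: le_trans (measureU2 _ mU0 mV'); apply: le_measure; rewrite ?inE//; try exact: measurableU.
  move=> t [] [Ut] /=; rewrite in_itv/= => /andP[t1 t2]; have [ta|ta] := leP t (a + h).
  - by left; split => //=; rewrite in_itv/= ta andbT; lra.
  - by right; split => //=; rewrite in_itv/= ta t2.
  - by left; split => //=; rewrite in_itv/= ta t1.
  - by right; split => //=; rewrite in_itv/= ta; lra.
have fW : m W \is a fin_num.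
  rewrite ge0_fin_numE//; apply: (@le_lt_trans _ _ (m `]a, b[%classic)).
    by apply: le_measure; rewrite ?inE//; exact: subIsetr.
  by rewrite /lebesgue_line lebesgue_measure_itv/=; case: ifP; rewrite ?ltry.
rewrite -(leeD2rE _ _ fW); apply: le_trans UU _.
by rewrite -addeA leeD2l// addeC; rewrite addeC in VV; rewrite addeC.
Qed.

Lemma positive_point U r (P : R -> Prop) : measurable U -> 0 < r ->
  m (`]0, r[%classic `&` U) <> 0%E -> {ae m, forall t, U t -> P t} ->
  exists t, [/\ 0 < t, t < r, U t & P t].
Proof.
move=> mU r0 nz H; apply: contrapT => nP; apply: nz.
have mI : measurable (`]0, r[%classic `&` U) by apply: measurableI => //; exact: measurable_itv.
suff N : m.-negligible (`]0, r[%classic `&` U).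
  by apply/eqP; move: N; rewrite negligibleP// => ->.
apply: negligibleS H => t [/=]; rewrite in_itv/= => /andP[t0 tr] Ut HP.
by apply: nP; exists t; split=> //; exact: HP.
Qed.

Lemma dist_lt a t h : a < t < a + h -> `|t - a| < h.
Proof. by move=> /andP[at1 at2]; rewrite ger0_norm ?subr_ge0 ?ltW// ltrBlDl. Qed.

(** Take a density point b of [U] and a density point a of its complement below it. The window of
    length [h] at b is at least three quarters full, the one at a at most a quarter full, and the
    difference consists of jumps. *)
Lemma jumps_base U r : measurable U -> 0 < r ->
  (forall r, 0 < r -> m (`]0, r[%classic `&` U) <> 0%E) ->
  (forall r, 0 < r -> m (`]0, r[%classic `&` ~` U) <> 0%E) ->
  exists2 p, 0 < p < r & \forall h \near 0^'+, ((h / 2)%:E <= m (`]p, r[%classic `&` jumps U h))%E.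
Proof.
move=> mU r0 HU HC.
have [b [b0 br Ub Hb]] := positive_point mU r0 (HU _ r0) (line_density mU).
have [a [a0 ab Ua Ha]] := positive_point (measurableC mU) b0 (HC _ b0) (line_density (measurableC mU)).
exists a; first by rewrite a0 (lt_trans ab).
have e4 : (0 : R) < 1 / 4 by [].
have e8 : (0 : R) < 1 / 8 by [].
near=> h.
have h0 : 0 < h by near: h; exact: nbhs_right_gt.
have h1 : (m ([set s | (`|s - b| < h)%R] `\` U) <= (1 / 4 * h)%:E)%E.
  by near: h; exact: Hb.
(* The window at [a] is closed on the right, so it is enclosed in an open ball of radius [2 * h];
   the tolerance 1/8 compensates for the doubling. *)
have h2 : (m ([set s | (`|s - a| < 2 * h)%R] `\` ~` U) <= (1 / 4 * h)%:E)%E.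
  have -> : 1 / 4 * h = 1 / 8 * (2 * h) by lra.
  near: h; have [d /= d0 Hd] := Ha _ e8.
  exists (d / 2) => /=; first by rewrite divr_gt0.
  move=> x /=; rewrite sub0r normrN => xd x0; apply: Hd; last by rewrite mulr_gt0.
  by rewrite /= sub0r normrN gtr0_norm ?mulr_gt0//; rewrite gtr0_norm// in xd; lra.
have mi (x y : R) : measurable `]x, y[%classic by exact: measurable_itv.
have J := jumps_between mU (ltW ab) h0.
have J1 : (m (U `&` `]a, (a + h)%R]%classic) <= (1 / 4 * h)%:E)%E.
  apply: le_trans h2; apply: le_measure; rewrite ?inE.
  - by apply: measurableI => //; exact: measurable_itv.
  - apply: measurableD; last exact: measurableC.
    by apply: measurable_set_lt => //; apply: measurableT_comp => //; apply: measurable_funB.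
  - move=> t [Ut /=]; rewrite in_itv/= => ti; split; last by move=> /(_ Ut).
    by apply: dist_lt; move: ti => /andP[-> ti]; apply: le_lt_trans ti _; rewrite ltrD2l ltr_pMl// ltr1n.
have J2 : ((3 / 4 * h)%:E <= m (U `&` `]b, (b + h)%R[%classic))%E.
  have mB : measurable [set s | (`|s - b| < h)%R].
    by apply: measurable_set_lt => //; apply: measurableT_comp => //; apply: measurable_funB.
  have : (m `]b, (b + h)%R[%classic <= m (U `&` `]b, (b + h)%R[%classic) + (1 / 4 * h)%:E)%E.
    apply: le_trans (leeD2l _ h1); apply: le_trans (measureU2 _ _ _).
    - apply: le_measure; rewrite ?inE//.
        by apply: measurableU; [exact: measurableI|exact: measurableD].
      move=> t /= ti; have [Ut|nU] := pselect (U t); [by left|right; split=> //=].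
      by move: ti; rewrite in_itv/=; exact: dist_lt.
    - exact: measurableI.
    - exact: measurableD.
  rewrite [X in (X <= _)%E]lebesgue_measure_itv/= lte_fin ltrDl h0 -EFinD addrAC subrr add0r.
  by rewrite -leeBlDr// -EFinB; apply: le_trans; rewrite lee_fin -{2}[h]mul1r -mulrBl; apply: ler_wpM2r; [exact: ltW|lra].
have := le_trans J2 (le_trans J (leeD2r _ J1)).
rewrite -leeBlDl// -EFinB; set X := m _ => H.
apply: le_trans (_ : (_ <= X)%E) _; last first.
  apply: le_measure; rewrite ?inE.
  - by apply: measurableI; [exact: measurable_itv|exact: measurable_jumps].
  - by apply: measurableI; [exact: measurable_itv|exact: measurable_jumps].
  - move=> t [/=]; rewrite in_itv/= => /andP[t1 t2] Jt; split=> //=.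
    by rewrite in_itv/= t1 (lt_trans t2).
by apply: le_trans H; rewrite lee_fin -mulrBl mulrC; apply: ler_wpM2r; [exact: ltW|lra].
Unshelve. all: by end_near. Qed.

(** Density points of both kinds accumulate at 0, so [jumps_base] can be repeated on ever lower,
    disjoint intervals, each contributing [h / 2]. The jump measure thus exceeds every multiple of
    [h]. *)
Lemma jumps_many U N r : measurable U -> 0 < r ->
  (forall r, 0 < r -> m (`]0, r[%classic `&` U) <> 0%E) ->
  (forall r, 0 < r -> m (`]0, r[%classic `&` ~` U) <> 0%E) ->
  exists2 p, 0 < p <= r &
    \forall h \near 0^'+, ((N%:R * (h / 2))%:E <= m (`]p, r[%classic `&` jumps U h))%E.
Proof.
move=> mU r0 HU HC; elim: N => [|N [p /andP[p0 pr] IH]].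
  exists r; first by rewrite r0 lexx.
  by near=> h; rewrite mul0r.
have [q /andP[q0 qp] Hq] := jumps_base mU p0 HU HC.
exists q; first by rewrite q0 ltW// (lt_le_trans qp).
near=> h.
have mi (x y : R) : measurable (`]x, y[%classic `&` jumps U h).
  by apply: measurableI; [exact: measurable_itv|exact: measurable_jumps].
apply: (@le_trans _ _ (m (`]q, p[%classic `&` jumps U h) + m (`]p, r[%classic `&` jumps U h))%E).
  rewrite -natr1 mulrDl mul1r EFinD addeC; apply: leeD; near: h; [exact: Hq|exact: IH].
rewrite -measureU//; last first.
  by rewrite -subset0 => t [[/=]]; rewrite in_itv/= => i1 _ [/=]; rewrite in_itv/=; lra.
apply: le_measure; rewrite ?inE//; first exact: measurableU.
move=> t [] [] /=; rewrite in_itv/= => /andP[t1 t2] Jt; split=> //=; rewrite in_itv/=.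
  by rewrite t1 (lt_le_trans t2).
by rewrite t2 (lt_trans qp).
Unshelve. all: by end_near. Qed.

End line_jumps.

(** * Vertical difference quotients of sets of finite perimeter *)

Section vertical.
Context {R : realType} {n : nat}.
Local Notation space := ('rV[R]_n * R)%type.
Implicit Types x y w : space.
Implicit Types E A B : set space.
Implicit Types s : space -> R.

Definition up (h : R) : space := (0, h).

Lemma box_up (h : R) : 0 <= h -> box h (up h).
Proof. by move=> h0; split=> [i|]; rewrite /= ?mxE ?normr0// ger0_norm. Qed.

Lemma upD (h k : R) : up (h + k) = up h + up k.
Proof. by congr pair; rewrite addr0. Qed.

(** A weight that will slide upwards and hence stay inside [Omega]. The last clause is a vertical
    Taylor bound uniform in the point. *)
Definition drift_ok (s : space -> R) d M C :=
  [/\ 0 < d, C1 s, (forall x, `|s x| <= 1), (forall x, s x <> 0 -> d <= x.2 /\ box M x) &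
   forall x k, 0 <= k <= 1 -> `|s (x - up k) - s x - k * 'D_(up (-1)) s x| <= C * k ^+ 2].

Definition drift E s (t : R) := \int[vol]_x (\1_E x * s (x - up t)).

Lemma drift_integrable E s d M C t : measurable E -> drift_ok s d M C ->
  vol.-integrable setT (EFin \o (fun x => \1_E x * s (x - up t))).
Proof.
move=> mE [d0 cs s1 ss _]; apply: (@integrable_supp _ _ (M + `|up t|) 1).
- apply: measurable_funM; first exact: measurable_indic.
  apply: measurable_shift; apply: continuous_measurable_space; exact: C1_continuous.
- by move=> x; rewrite normrM mulr_ile1// indic_norm_le1.
- move=> x h; have [|_ b] := ss (x - up t).
    by apply: contra_not h => ->; rewrite mulr0.
  by rewrite -(subrK (up t) x); apply: boxD b _; exact: norm_box.
Qed.

Lemma drift_translate E s d M C : measurable E -> drift_ok s d M C ->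
  (forall t, vol.-integrable setT (EFin \o (fun x => \1_E (x + up t) * s x))) /\
  (forall t, drift E s t = \int[vol]_x (\1_E (x + up t) * s x)).
Proof.
move=> mE dr; have [_ cs s1 ss _] := dr.
have iD t : vol.-integrable setT (EFin \o (fun x => \1_E (x + up t) * s x)).
  apply: (@integrable_supp _ _ M 1).
  - apply: measurable_funM; last by apply: continuous_measurable_space; exact: C1_continuous.
    apply: (@measurableT_comp _ _ _ _ _ _ (\1_E : space -> R)); first exact: measurable_indic.
    exact: (preserves_vol (up t)).1.
  - by move=> x; rewrite normrM mulr_ile1// indic_norm_le1.
  - by move=> x h'; have [|//] := ss x; apply: contra_not h' => ->; rewrite mulr0.
split=> // t; rewrite /drift /Rintegral.
rewrite -(@integral_translate _ _ (up t) (fun x => \1_E x * s (x - up t))).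
- by congr fine; apply: eq_integral => x _; rewrite addrK.
- by apply/measurable_EFinP; exact: measurable_int (drift_integrable t mE dr).
- by under eq_fun do rewrite addrK; exact: iD.
Qed.

(** The derivative of the drift in [t] is the flux of [E] through the shifted weight times the
    downward unit vector, an admissible field. A step of length [k] therefore costs at most [k * p]
    up to a quadratic error. *)
Lemma drift_step E s d M C p t k h : measurable E -> drift_ok s d M C -> 0 <= C ->
  (perimeter E <= p%:E)%E -> 0 <= t -> 0 <= k <= 1 -> t + k <= h ->
  drift E s (t + k) - drift E s t <=
    k * p + C * fine (vol (box (M + h) : set space)) * k ^+ 2.
Proof.
move=> mE dr C0 Ep t0 k01 tkh; have [d0 cs s1 ss sT] := dr.
have /andP[k0 k1] := k01; have h0 : 0 <= h by lra.
pose v : space := up (-1).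
pose phi x := s (x - up t) *: v.
have cst : C1 (fun x => s (x - up t)) by exact: C1_translate.
have cphi : field_C1 phi := field_C1_scale cst (field_C1_cst v).
have sphi : supported d (M + h) phi.
  move=> x h'; have [|dx b] := ss (x - up t).
    by apply: contra_not h' => e; rewrite /phi e scale0r.
  split; first by move: dx; rewrite /=; lra.
  rewrite -(subrK (up t) x); apply: boxD b _; apply: (@box_le _ _ t); first lra.
  exact: box_up.
have dphi x : divergence phi x = 'D_v s (x - up t).
  rewrite (divergence_scale x cst (field_C1_cst v)) divergence_cst mulr0 add0r.
  exact: derive_translate.
have aphi : admissible d (M + h) phi.
  split=> // x; rewrite /sqnorm big1 => [|i _]; last by rewrite /phi /= !mxE mulr0 expr0n.
  rewrite add0r /phi /= [_ *: _]mulrN1 sqrrN -[leRHS](expr1n _ 2).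
  by rewrite -(real_normK (num_real (s _))) lerXn2r ?nnegrE.
have fl : flux E phi <= p by rewrite -lee_fin; apply: le_trans Ep; exact: flux_le_perimeter aphi.
have mB := @measurable_box R n (M + h).
have iB : vol.-integrable setT (EFin \o (fun x : space => C * k ^+ 2 * \1_(box (M + h)) x)).
  exact: integrable_cst_indic mB (vol_box_fin _).
have iF := integrable_flux mE cphi sphi.
have ikF : vol.-integrable setT (EFin \o (fun x => k * (\1_E x * divergence phi x))).
  by have := integrableZl measurableT k iF; apply: eq_integrable.
have -> : k * p + C * fine (vol (box (M + h) : set space)) * k ^+ 2 =
    k * p + \int[@vol R n]_x (C * k ^+ 2 * \1_(box (M + h)) x).
  congr (_ + _); have C2 : 0 <= C * k ^+ 2 by rewrite mulr_ge0 ?sqr_ge0.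
  have := integral_indic_shift (M + h) (0 : space) C2.
  by under eq_Rintegral do rewrite subr0; move=> ->; rewrite mulrAC.
apply: le_trans (lerD (ler_wpM2l k0 fl) (lexx _)).
rewrite /flux -(RintegralZl k measurableT iF) -(RintegralD measurableT ikF iB).
rewrite /drift -(RintegralB measurableT (drift_integrable _ mE dr) (drift_integrable _ mE dr)).
apply: le_Rintegral => //.
- exact: integrableB (drift_integrable _ mE dr) (drift_integrable _ mE dr).
- exact: integrableD ikF iB.
move=> x _; set y := x - up t.
have yk : x - up (t + k) = y - up k by rewrite upD opprD addrA.
have out (r : R) : 0 <= r <= h -> ~ box (M + h) x -> s (x - up r) = 0.
  move=> /andP[r0 rh] nb; apply: contrapT => /ss[_ b]; apply: nb.
  rewrite -(subrK (up r) x); apply: boxD b _; apply: (@box_le _ _ r) => //.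
  exact: box_up.
have Ck : 0 <= C * k ^+ 2 by rewrite mulr_ge0 ?sqr_ge0.
have [bx|nb] := pselect (box (M + h) x); last first.
  rewrite (supp_in0 (divergence_supp sphi))// /y !out// ?t0 ?addr_ge0//; last lra.
  by rewrite !mulr0 subrr add0r mulr_ge0.
rewrite [\1_(box _) x]indicE mem_set// mulr1 dphi -/y yk -mulrBr.
have := sT y k k01; rewrite ler_norml => /andP[_ H].
rewrite indicE; case: (x \in E); rewrite ?mul0r ?mulr0 ?add0r// !mul1r.
by move: H; rewrite /v; lra.
Qed.

(** Cut the displacement [h] into [N.+1] equal steps. The quadratic errors add up to a multiple of
    [h ^+ 2 / N.+1%:R], which tends to 0. *)
Lemma drift_le E s d M C p h : measurable E -> drift_ok s d M C -> 0 <= C ->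
  (perimeter E <= p%:E)%E -> 0 < h ->
  drift E s h - drift E s 0 <= h * p.
Proof.
move=> mE dr C0 Ep h0; set C' := C * fine (vol (box (M + h) : set space)).
have C'0 : 0 <= C' by rewrite mulr_ge0// fine_ge0.
have step (N : nat) : h <= N.+1%:R -> drift E s h - drift E s 0 <= h * p + C' * h ^+ 2 / N.+1%:R.
  move=> hN; have N0 : (0 : R) < N.+1%:R by [].
  pose k := h / N.+1%:R; have k0 : 0 <= k by rewrite divr_ge0 ?ltW.
  have k1 : k <= 1 by rewrite ler_pdivrMr// mul1r.
  have : forall j : nat, (j <= N.+1)%N ->
      drift E s (j%:R * k) - drift E s 0 <= j%:R * (k * p + C' * k ^+ 2).
    elim=> [|j IH] jN; first by rewrite !mul0r subrr.
    have kN : N.+1%:R * k = h by rewrite /k mulrC divfK// gt_eqF.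
    have := @drift_step E s d M C p (j%:R * k) k h mE dr C0 Ep.
    move=> /(_ (mulr_ge0 (ler0n _ _) k0)); rewrite k0 k1 => /(_ isT).
    rewrite -{1}kN -[X in _ + X <= _]mul1r -mulrDl natr1 ler_wpM2r ?ler_nat// => /(_ isT).
    rewrite -/C' -natr1 !mulrDl !mul1r; have := IH (ltnW jN); rewrite !mulrDr; lra.
  move=> /(_ _ (leqnn _)); rewrite /k mulrC divfK ?gt_eqF//.
  suff -> : N.+1%:R * (h / N.+1%:R * p + C' * (h / N.+1%:R) ^+ 2) = h * p + C' * h ^+ 2 / N.+1%:R by [].
  by field; rewrite gt_eqF//.
apply/ler_addgt0Pr => e e0.
have [N hN] : exists N : nat, h <= N.+1%:R /\ C' * h ^+ 2 / N.+1%:R <= e.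
  have Ce : 0 <= C' * h ^+ 2 / e by apply: divr_ge0; [apply: mulr_ge0 => //; exact: sqr_ge0|exact: ltW].
  pose N := Num.truncn (h + C' * h ^+ 2 / e); exists N.
  have /ltW hN : h + C' * h ^+ 2 / e < N.+1%:R by exact: truncnS_gt.
  split; first by lra.
  have : C' * h ^+ 2 <= N.+1%:R * e by rewrite -ler_pdivrMr//; lra.
  by rewrite ler_pdivrMr// [e * _]mulrC.
by apply: le_trans (step N hN.1) _; rewrite lerD2l hN.2.
Qed.

Lemma smooth_supp e A x : 0 < e -> smooth e A x <> 0 -> exists2 y, A y & box e (y - x).
Proof.
move=> e0; apply: contra_notP => nA; rewrite /smooth.
under eq_Rintegral.
  move=> y _; rewrite (_ : _ * _ = 0); first by over.
  rewrite indicE; have [Ay|nAy] := pselect (A y); last by rewrite memNset// mul0r.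
  by rewrite (supp_in0 (mollifier_supp e0)) ?mulr0// => b; apply: nA; exists y.
by rewrite Rintegral_cst// mul0r mulr0.
Qed.

Lemma up_derive_smooth e A x (k : R) : 0 < e -> measurable A -> 0 <= k <= 1 ->
  `|smooth e A (x - up k) - smooth e A x - k * 'D_(up (-1)) (smooth e A) x| <=
    smooth_taylor_const (n := n) e * k ^+ 2.
Proof.
move=> e0 mA /andP[k0 k1].
have n1 : `|k *: (up (-1) : space)| = k.
  rewrite normrZ ger0_norm// (_ : `|up (-1)| = 1) ?mulr1//.
  by rewrite /up prod_normE /= normr0 normrN1; apply/max_idPr.
have -> : x - up k = x + k *: (up (-1) : space).
  by congr (_ + _); congr pair; rewrite ?scaler0 ?oppr0// [_ *: _]mulrN1.
have := smooth_derive_taylor e0 mA x (v := up (-1)) k0.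
by rewrite n1; apply.
Qed.

Lemma smooth_taylor_const_ge0 (e : R) : 0 < e -> 0 <= smooth_taylor_const (n := n) e.
Proof.
move=> e0; apply: mulr_ge0; first by rewrite invr_ge0 ltW// mass_gt0.
by apply: mulr_ge0; [exact: taylor_const_ge0|exact: fine_ge0].
Qed.

Lemma norm_diff_taylor (a a' b b' p q t c : R) :
  `|a' - a - t * p| <= c -> `|b' - b - t * q| <= c ->
  `|a' - b' - (a - b) - t * (p - q)| <= 2 * c.
Proof.
move=> h1 h2; have -> : a' - b' - (a - b) - t * (p - q) =
  (a' - a - t * p) - (b' - b - t * q) by ring.
by apply: le_trans (ler_normB _ _) _; lra.
Qed.

Lemma smooth_diff_taylor e A B x (t : R) : 0 < e -> measurable A -> measurable B ->
  0 <= t <= 1 ->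
  `|smooth e A (x - up t) - smooth e B (x - up t) - (smooth e A x - smooth e B x)
    - t * 'D_(up (-1)) (fun x => smooth e A x - smooth e B x) x| <=
  2 * smooth_taylor_const (n := n) e * t ^+ 2.
Proof.
move=> e0 mA mB t01.
have cA : C1 (smooth e A) by exact: C1_smooth.
have cB : C1 (smooth e B) by exact: C1_smooth.
rewrite (deriveD_C1 _ _ cA (C1N cB)) (deriveN_C1 _ _ cB) -mulrA.
by apply: norm_diff_taylor; exact: up_derive_smooth.
Qed.

Lemma indic_in {T : Type} {A : set T} {x : T} : A x -> \1_A x = 1 :> R.
Proof. by move=> Ax; rewrite indicE mem_set. Qed.

Lemma indic_out {T : Type} {A : set T} {x : T} : ~ A x -> \1_A x = 0 :> R.
Proof. by move=> nA; rewrite indicE memNset. Qed.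

(** Slide the mollified difference of the indicators of [A] and [B]. The increment of the drift
    tests that weight against the vertical difference of the indicator of [E], which is 1 on [A] and
    -1 on [B]; as the radius shrinks it tends to the volume of the union. *)
Lemma jump_volume_local E A B (d M p h : R) : measurable E -> measurable A -> measurable B ->
  0 < d -> 0 < h -> (perimeter E <= p%:E)%E ->
  (forall x, A x \/ B x -> d <= x.2 /\ box M x) ->
  (forall x, A x -> ~ E x /\ E (x + up h)) -> (forall x, B x -> E x /\ ~ E (x + up h)) ->
  (vol A + vol B <= (h * p)%:E)%E.
Proof.
move=> mE mA mB d0 h0 Ep AB HA HB.
pose eps k : R := k.+1%:R^-1; have e0 k : 0 < eps k by rewrite invr_gt0.
have e1 k : eps k <= 1 by rewrite invf_le1// ler1n.
pose s k x := smooth (eps k) A x - smooth (eps k) B x.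
pose w x : R := \1_E (x + up h) - \1_E x.
have s1 k x : `|s k x| <= 1.
  have := smooth_ge0 (n := n) (e0 k) A x; have := smooth_le1 (e0 k) x mA.
  have := smooth_ge0 (n := n) (e0 k) B x; have := smooth_le1 (e0 k) x mB.
  by rewrite /s ler_norml; lra.
have ss k x : s k x <> 0 -> d - eps k <= x.2 /\ box (M + eps k) x.
  move=> sx; have [y ABy by_] : exists2 y, A y \/ B y & box (eps k) (y - x).
    have [A0|/(smooth_supp (e0 k))[y Ay b]] := pselect (smooth (eps k) A x = 0); last by exists y => //; left.
    have [B0|/(smooth_supp (e0 k))[y By b]] := pselect (smooth (eps k) B x = 0); last by exists y => //; right.
    by exfalso; apply: sx; rewrite /s A0 B0 subrr.
  have [dy My] := AB _ ABy; split.
    by have [_] := by_; rewrite /= ler_norml; lra.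
  have -> : x = y + - (y - x) by rewrite opprB addrC subrK.
  by apply: boxD My _; exact: boxN.
have cs k : C1 (s k) by apply: C1B; exact: C1_smooth.
have dr k : eps k < d ->
    drift_ok (s k) (d - eps k) (M + eps k) (2 * smooth_taylor_const (n := n) (eps k)).
  move=> kd; split=> //; [by rewrite subr_gt0|exact: ss|].
  by move=> x t; exact: smooth_diff_taylor.
have mw : measurable_fun setT w.
  apply: measurable_funB; last exact: measurable_indic.
  apply: (@measurableT_comp _ _ _ _ _ _ (\1_E : space -> R)); first exact: measurable_indic.
  exact: (preserves_vol (up h)).1.
have ms k : measurable_fun setT (s k) by apply: continuous_measurable_space; exact: C1_continuous.
have w1 x : `|w x| <= 1.
  by rewrite /w !indicE; case: (_ \in _); case: (_ \in _); rewrite ?subrr ?subr0 ?sub0r ?normrN ?normr0 ?normr1.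
have le k : eps k < d -> \int[vol]_x (w x * s k x) <= h * p.
  move=> kd; have D0 : 0 <= 2 * smooth_taylor_const (n := n) (eps k).
    by apply: mulr_ge0 => //; exact: smooth_taylor_const_ge0.
  apply: le_trans (drift_le mE (dr k kd) D0 Ep h0).
  have [iD dE] := drift_translate mE (dr k kd).
  rewrite !dE -(RintegralB measurableT (iD h) (iD 0)).
  rewrite le_eqVlt; apply/orP; left; apply/eqP; apply: eq_Rintegral => x _.
  by rewrite /w mulrBl addr0.
have ind x : w x * (\1_A x - \1_B x) = \1_(A `|` B) x.
  rewrite /w; have [Ax|nA] := pselect (A x).
    have [nE Eh] := HA _ Ax; have nB : ~ B x by move=> /HB[].
    rewrite (indic_in Eh) (indic_out nE) (indic_in Ax) (indic_out nB) (indic_in (A := A `|` B)); last by left.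
    by rewrite !subr0 mulr1.
  have [Bx|nB] := pselect (B x); last first.
    by rewrite (indic_out nA) (indic_out nB) (indic_out (A := A `|` B)) ?subrr ?mulr0// => -[].
  have [Ex nEh] := HB _ Bx.
  rewrite (indic_out nEh) (indic_in Ex) (indic_out nA) (indic_in Bx) (indic_in (A := A `|` B)); last by right.
  by rewrite !sub0r mulrNN mulr1.
have c : \int[vol]_x (w x * s k x) @[k --> \oo] --> \int[vol]_x (\1_(A `|` B) x).
  have [|||||i _ c] := @dominated_convergence _ _ _ vol setT measurableT
      (fun k x => (w x * s k x)%:E) (fun x => (\1_(A `|` B) x)%:E)
      (fun x : space => (1 * \1_(box (M + 1)) x)%:E).
  - by move=> k; apply/measurable_EFinP; apply: measurable_funM.
  - by apply/measurable_EFinP; apply: measurable_indic; exact: measurableU.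
  - apply: filterS2 (smooth_cvg mA) (smooth_cvg mB) => x ax bx _.
    apply: cvg_EFin; first by near=> k.
    by rewrite -ind; apply: cvgM; [exact: cvg_cst|exact: cvgB].
  - exact: integrable_cst_indic (@measurable_box R n _) (vol_box_fin _).
  - apply: aeW => x k _; rewrite lee_fin mul1r normrM.
    have [sx|/ss[_ b]] := pselect (s k x = 0); first by rewrite sx normr0 mulr0.
    rewrite indicE mem_set; first by rewrite mulr_ile1.
    by apply: box_le b; rewrite lerD2l.
  by apply: fine_cvg; rewrite fineK// integrable_fin_num.
have mAB : measurable (A `|` B) by exact: measurableU.
have fAB : (vol (A `|` B) < +oo)%E.
  apply: le_lt_trans (vol_box_fin M); apply: le_measure; rewrite ?inE//.
    exact: measurable_box.
  by move=> x /AB[].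
rewrite -measureU//; last first.
  by rewrite -subset0 => x [/HA[nE _] /HB[]].
have : \int[vol]_x (\1_(A `|` B) x : R) <= h * p.
  rewrite -(cvg_lim _ c)//; apply: limr_le; first by apply/cvg_ex; eexists; exact: c.
  near=> k; apply: le; near: k; exact: (near_infty_natSinv_lt (PosNum d0)).
rewrite /Rintegral integral_indic// setIT -lee_fin fineK// ge0_fin_numE//.
Unshelve. all: by end_near. Qed.

Definition vjumps E (h : R) : set space := Omega `&`
  [set x | (E (x + up h) /\ ~ E x) \/ (~ E (x + up h) /\ E x)].

Lemma measurable_up E (h : R) : measurable E -> measurable [set x | E (x + up h)].
Proof. by move=> mE; exact: (preimage_measurable (preserves_vol (up h)).1 mE). Qed.

Lemma measurable_vjumps E (h : R) : measurable E -> measurable (vjumps E h).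
Proof.
move=> mE; apply: measurableI; first exact: measurable_Omega.
have mEh := measurable_up h mE.
rewrite (_ : [set x | _] = ([set x | E (x + up h)] `\` E) `|` (E `\` [set x | E (x + up h)])).
  by apply: measurableU; exact: measurableD.
by apply/seteqP; split=> x [[? ?]|[? ?]]; by [left|right].
Qed.

(** The total variation bound on vertical difference quotients. The local version needs a positive
    height and a box, so [Omega] is exhausted by the sets [K k]. *)
Lemma vjumps_volume E (p h : R) : measurable E -> 0 < h -> (perimeter E <= p%:E)%E ->
  (vol (vjumps E h) <= (h * p)%:E)%E.
Proof.
move=> mE h0 Ep; have mJ := measurable_vjumps h mE.
pose K (k : nat) : set space := [set x | k.+1%:R^-1 <= x.2] `&` box k%:R.
have mK k : measurable (K k).
  by apply: measurableI; [exact: measurable_set_le|exact: measurable_box].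
pose F k := vjumps E h `&` K k.
have mF k : measurable (F k) by exact: measurableI.
have FE : \bigcup_k F k = vjumps E h.
  rewrite -setI_bigcupr; apply/setIidPl => x [x0 _].
  pose k := Num.truncn (`|x| + x.2^-1).
  have /ltW hk : `|x| + x.2^-1 < k.+1%:R by exact: truncnS_gt.
  have x20 : 0 < x.2^-1 by rewrite invr_gt0.
  exists k.+1 => //; split=> /=.
    rewrite -[x.2]invrK lef_pV2 ?posrE// (le_trans _ (_ : k.+1%:R <= _)) ?ler_nat//.
    by apply: le_trans hk; rewrite lerDr.
  by apply: box_le (norm_box x); apply: le_trans hk; rewrite lerDl ltW.
have nF : nondecreasing_seq F.
  move=> i j ij; apply/subsetPset => x [Jx [Kx bx]]; split=> //; split=> /=.
    by apply: le_trans Kx; rewrite lef_pV2 ?posrE// ler_nat ltnS.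
  by apply: box_le bx; rewrite ler_nat.
have leF k : (vol (F k) <= (h * p)%:E)%E.
  have mA : measurable (F k `\` E) by exact: measurableD.
  have mB : measurable (F k `&` E) by exact: measurableI.
  rewrite (_ : F k = (F k `\` E) `|` (F k `&` E)); last first.
    by rewrite setUC setUIDK.
  apply: le_trans (measureU2 _ mA mB) _.
  apply: (jump_volume_local mE mA mB (d := k.+1%:R^-1) (M := k%:R)) => //.
  - by move=> x [[[_ [? ?]] _]|[[_ [? ?]] _]].
  - by move=> x [[[_ J] _] nE]; split=> //; case: J => -[].
  - by move=> x [[[_ J] _] Ex]; split=> //; case: J => -[].
have c := nondecreasing_cvg_mu (mu := vol) mF (bigcup_measurable (fun k _ => mF k)) nF.
rewrite -FE -(cvg_lim _ c)//; apply: lime_le; first by apply/cvg_ex; eexists; exact: c.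
by apply: nearW => k; exact: leF.
Qed.

End vertical.

(** * Slices over boundary points and the trace *)

Section slices.
Context {R : realType} {n : nat}.
Local Notation space := ('rV[R]_n * R)%type.
Local Notation row := 'rV[R]_n.
Implicit Types x y w : space.
Implicit Types z : row.
Implicit Types E F A B : set space.

Local Notation m := (@lebesgue_line R).

Definition vfill E : set row :=
  [set z | exists2 r, 0 < r & m (`]0, r[%classic `&` ~` xsection E z) = 0%E].

Definition vvoid E : set row :=
  [set z | exists2 r, 0 < r & m (`]0, r[%classic `&` xsection E z) = 0%E].

Lemma vjumps_section E (h : R) z :
  xsection (vjumps E h) z = `]0, +oo[%classic `&` jumps (xsection E z) h.
Proof.
have e t : ((z, t) : space) + up h = (z, t + h) by congr pair; rewrite addr0.
rewrite !xsectionE; apply/seteqP; split=> t /=; rewrite in_itv/= andbT => -[t0 J];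
  by split=> //; move: J; rewrite /jumps/= -(e t).
Qed.

Lemma steep_slice E z (N : nat) : measurable E -> ~ (vfill E z \/ vvoid E z) ->
  \forall h \near 0^'+, ((N%:R * (h / 2))%:E <= m (xsection (vjumps E h) z))%E.
Proof.
move=> mE bad; have mS : measurable (xsection E z) by exact: measurable_xsection.
have [||r /andP[r0 r1]] := jumps_many N mS (@ltr01 R).
- by move=> r r0 h; apply: bad; right; exists r.
- by move=> r r0 h; apply: bad; left; exists r.
apply: filterS => h; move=> /le_trans; apply; apply: le_measure; rewrite ?inE.
- by apply: measurableI; [exact: measurable_itv|exact: measurable_jumps].
- exact: (measurable_xsection z (measurable_vjumps h mE)).
- rewrite vjumps_section => t [/=]; rewrite in_itv/= => /andP[t0 _] J; split=> //.
  by rewrite /= in_itv/= andbT (lt_trans r0).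
Qed.

(** By Markov's inequality and [vjumps_volume], base points whose slice has jumps of measure at
    least [N.+1] times the step have measure at most [p / N.+1], for every step. A bad base point
    belongs to these sets for all small steps and for every [N], so the bad set is null. *)
Lemma fill_or_void E : measurable E -> (perimeter E < +oo)%E ->
  {ae lebesgue_row n, forall z, vfill E z \/ vvoid E z}.
Proof.
move=> mE PE; have fP : perimeter E \is a fin_num by rewrite ge0_fin_numE// perimeter_ge0.
pose p := fine (perimeter E); have Ep : (perimeter E <= p%:E)%E by rewrite /p fineK.
have p0 : 0 <= p by rewrite fine_ge0// perimeter_ge0.
pose J (k : nat) := vjumps E k.+1%:R^-1.
have mJ k : measurable (J k) by exact: measurable_vjumps.
have h0 k : (0 : R) < k.+1%:R^-1 by rewrite invr_gt0.
pose g (N k : nat) : set row := [set z | ((N.+1%:R * (k.+1%:R^-1 : R))%:E <= m (xsection (J k) z))%E].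
have mg N k : measurable (g N k).
  have := @measurable_fun_xsection _ _ _ _ _ (@lebesgue_line R) _ (mJ k).
  by move=> /emeasurable_fun_c_infty => /(_ measurableT (N.+1%:R * (k.+1%:R^-1 : R))%:E); rewrite setTI.
have vg N k : (lebesgue_row n (g N k) <= (p / N.+1%:R)%:E)%E.
  have c0 : (0 : R) < N.+1%:R * k.+1%:R^-1 by rewrite mulr_gt0.
  have : ((N.+1%:R * (k.+1%:R^-1 : R))%:E * lebesgue_row n (g N k) <= (k.+1%:R^-1 * p)%:E)%E.
    apply: le_trans (vjumps_volume mE (h0 k) Ep).
    rewrite -integral_cst//.
    have -> : vol (vjumps E k.+1%:R^-1) = (\int[lebesgue_row n]_z m (xsection (J k) z))%E by [].
    apply: (@le_trans _ _ (\int[lebesgue_row n]_(z in g N k) m (xsection (J k) z))%E).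
      apply: ge0_le_integral => //.
      - by move=> x _; rewrite lee_fin ltW.
      - by apply: measurable_funTS; exact: measurable_fun_xsection.
    apply: ge0_subset_integral => //.
    exact: measurable_fun_xsection.
  rewrite -lee_pdivlMl// => /le_trans; apply; rewrite -EFinM lee_fin invfM invrK.
  rewrite le_eqVlt; apply/orP; left; apply/eqP; field.
  by rewrite gt_eqF// gt_eqF.
pose G (N k : nat) := \bigcap_(j in [set j | (k <= j)%N]) g N j.
have mG N k : measurable (G N k) by apply: bigcap_measurable => [|j _]; [exists k => /=|].
have mU N : measurable (\bigcup_k G N k) by exact: bigcup_measurable.
have vU N : (lebesgue_row n (\bigcup_k G N k) <= (p / N.+1%:R)%:E)%E.
  have nG : nondecreasing_seq (G N).
    by move=> i j ij; apply/subsetPset => z Gz k /= jk; apply: Gz; exact: leq_trans jk.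
  have c := nondecreasing_cvg_mu (mu := lebesgue_row n) (mG N) (mU N) nG.
  rewrite -(cvg_lim _ c)//; apply: lime_le; first by apply/cvg_ex; eexists; exact: c.
  apply: nearW => k; apply: le_trans (vg N k); apply: le_measure; rewrite ?inE//.
  by move=> z; apply => /=.
have mI : measurable (\bigcap_N \bigcup_k G N k) by exact: bigcap_measurable.
exists (\bigcap_N \bigcup_k G N k); split=> //.
  apply/eqP; rewrite eq_le measure_ge0 andbT; apply/lee_addgt0Pr => e e0; rewrite add0e.
  pose N := Num.truncn (p / e).
  have /ltW hN : p / e < N.+1%:R by exact: truncnS_gt.
  apply: (@le_trans _ _ (lebesgue_row n (\bigcup_k G N k))).
    by apply: le_measure; rewrite ?inE// => z; apply.
  apply: le_trans (vU N) _; rewrite lee_fin ler_pdivrMr//.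
  by rewrite [e * _]mulrC -ler_pdivrMr.
move=> z /= bad N _.
(* The factor 2 offsets the [h / 2] contributed by each interval. *)
have [d /= d0 H] := steep_slice (2 * N.+1)%N mE bad.
have [k _ Hk] := near_infty_natSinv_lt (PosNum d0).
exists k => // j /= kj; rewrite /g /=.
have := H _ _ (h0 j); rewrite /= sub0r normrN gtr0_norm// => /(_ (Hk _ kj)).
apply: le_trans; rewrite lee_fin natrM le_eqVlt; apply/orP; left; apply/eqP; field.
by rewrite gt_eqF.
Qed.

Lemma vvoidE E : vvoid E = vfill (~` E).
Proof.
apply/seteqP; split=> z [r r0 H]; exists r => //; move: H;
  by rewrite (_ : ~` xsection (~` E) z = xsection E z)// !xsectionE setCK.
Qed.

Definition void_layer E (k : nat) : set space :=
  [set x | 0 < x.2 /\ x.2 < k.+1%:R^-1] `&` ~` E.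

(** An inequality with 0 is a sublevel set of the section measure, whence measurability. The levels
    increase with [k] and exhaust [vfill E]. *)
Definition fill_level E (k : nat) : set row :=
  [set z | (m (xsection (void_layer E k) z) <= 0)%E].

Lemma measurable_void_layer E k : measurable E -> measurable (void_layer E k).
Proof.
move=> mE; apply: measurableI; last exact: measurableC.
by apply: measurableI; exact: measurable_set_lt.
Qed.

Lemma measurable_fill_level E k : measurable E -> measurable (fill_level E k).
Proof. by move=> mE; apply: measurable_section_le; exact: measurable_void_layer. Qed.

Lemma void_layer_section E k z :
  xsection (void_layer E k) z = `]0, k.+1%:R^-1[%classic `&` ~` xsection E z.
Proof.
rewrite !xsectionE; apply/seteqP; split=> t /=; rewrite in_itv/=.
  by move=> [[-> ->] nE].
by move=> [/andP[? ?] nE].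
Qed.

Lemma vfill_levels E : measurable E -> vfill E = \bigcup_k fill_level E k.
Proof.
move=> mE; apply/seteqP; split=> z.
  move=> [r r0 H]; have [k _ Hk] := near_infty_natSinv_lt (PosNum r0).
  exists k => //; rewrite /fill_level/= -H void_layer_section; apply: le_measure; rewrite ?inE.
  - by apply: measurableI; [exact: measurable_itv|apply: measurableC; exact: measurable_xsection].
  - by apply: measurableI; [exact: measurable_itv|apply: measurableC; exact: measurable_xsection].
  - move=> t [/=]; rewrite !in_itv/= => /andP[t0 tk] nE; split=> //=.
    by rewrite t0 (lt_trans tk)//; exact: Hk k (leqnn k).
move=> [k _]; rewrite /fill_level/= void_layer_section => H; exists k.+1%:R^-1 => //.
by apply/eqP; rewrite eq_le H measure_ge0.
Qed.

Lemma measurable_vfill E : measurable E -> measurable (vfill E).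
Proof.
move=> mE; rewrite vfill_levels//; apply: bigcup_measurable => k _.
exact: measurable_fill_level.
Qed.

Lemma half_ball_cube z (r : R) : half_ball z r `<=` [set x | rcube z r x.1 /\ 0 < x.2 < r].
Proof.
move=> x [x0 /eball_cube[b1 /=]]; rewrite subr0 => b2; split=> //.
by rewrite [X in X && _]x0; apply: le_lt_trans b2; exact: ler_norm.
Qed.

Lemma measurable_half_ball z (r : R) : measurable (half_ball z r).
Proof. by apply: measurableI; [exact: measurable_Omega|exact: measurable_eball]. Qed.

(** A cube of side r/(n + 1) resting on the boundary at [z] fits into the half ball. *)
Lemma vol_half_ball_ge z (r : R) : 0 < r ->
  (((n.+1%:R^-1 * r) ^+ n.+1)%:E <= vol (half_ball z r))%E.
Proof.
move=> r0; pose s := r / n.+1%:R; have s0 : 0 < s by rewrite divr_gt0.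
have := vol_cube ((z, s / 2) : space) (ltW (divr_gt0 s0 (ltr0Sn _ 1))).
rewrite mulrCA divff// mulr1 => vE; rewrite [_^-1 * r]mulrC -/s -vE.
apply: le_measure; rewrite ?inE; [exact: measurable_cube|exact: measurable_half_ball|].
move=> x [c1 /=]; rewrite ltr_norml => c2; split; first by rewrite /Omega/=; lra.
apply: cube_eball => //; split=> /= [i|]; last by rewrite subr0 -/s gtr0_norm; lra.
by apply: lt_le_trans (c1 i) _; rewrite -/s; lra.
Qed.

Lemma vol_half_ball_fin z (r : R) : 0 <= r -> vol (half_ball z r) \is a fin_num.
Proof.
move=> r0; have := vol_eball_fin ((z, 0) : space) r0.
rewrite !ge0_fin_numE// => /(le_lt_trans _); apply; apply: le_measure; rewrite ?inE.
- exact: measurable_half_ball.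
- exact: measurable_eball.
- exact: subIsetr.
Qed.

Lemma fill_level_null E k : measurable E ->
  vol (void_layer E k `&` (fill_level E k `*` setT)) = 0%E.
Proof.
move=> mE; have mQ := measurable_fill_level k mE.
set N := _ `&` _; have mN : measurable N.
  by apply: measurableI; [exact: measurable_void_layer|exact: measurableX].
apply/negligibleP => //; apply: negligible_xsection => // y.
have [Qy|nQ] := pselect (fill_level E k y); last first.
  rewrite (_ : xsection N y = set0); first exact: negligible_set0.
  by rewrite xsectionE -subset0 => t [_ []].
apply/negligibleP; first exact: measurable_xsection.
apply/eqP; rewrite eq_le measure_ge0 andbT; apply: le_trans Qy.
apply: le_measure; rewrite ?inE.
- exact: measurable_xsection.
- by apply: measurable_xsection; exact: measurable_void_layer.
- by rewrite !xsectionE => t [].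
Qed.

(** At a density point of the level, the half ball minus [E] is contained, up to a null set, in a
    cylinder of height [r] over the small part of the cube that misses the level. The height
    supplies the last factor of [r ^+ n.+1]. *)
Lemma fill_level_density E k : measurable E ->
  {ae lebesgue_row n, forall z, fill_level E k z -> forall e : R, 0 < e ->
    \forall r \near 0^'+, (vol (half_ball z r `\` E) <= (e * r ^+ n.+1)%:E)%E}.
Proof.
move=> mE; have mQ := measurable_fill_level k mE.
have := row_density mQ; apply: filterS => z H Qz e e0.
have k0 : (0 : R) < k.+1%:R^-1 by rewrite invr_gt0.
near=> r.
have r0 : 0 < r by near: r; exact: nbhs_right_gt.
have rk : r < k.+1%:R^-1 by near: r; exact: nbhs_right_lt.
have h : (lebesgue_row n (rcube z r `\` fill_level E k) <= (e * r ^+ n)%:E)%E.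
  by near: r; exact: H.
pose N := void_layer E k `&` (fill_level E k `*` setT).
have mN : measurable N.
  by apply: measurableI; [exact: measurable_void_layer|exact: measurableX].
have N0 : vol N = 0%E by exact: fill_level_null.
have mP : measurable ((rcube z r `\` fill_level E k) `*` `]0, r[%classic).
  apply: measurableX; last exact: measurable_itv.
  by apply: measurableD => //; exact: measurable_rcube.
apply: (@le_trans _ _ (vol (((rcube z r `\` fill_level E k) `*` `]0, r[%classic) `|` N))).
  apply: le_measure; rewrite ?inE.
  - by apply: measurableD => //; exact: measurable_half_ball.
  - exact: measurableU.
  - move=> x [/half_ball_cube[c1 /andP[x0 xr]] nE].
    have [Qx|nQ] := pselect (fill_level E k x.1); [right|left].
      by split=> //; split=> //; split=> //; exact: lt_trans rk.
    by split=> //=; rewrite in_itv/= x0.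
apply: le_trans (measureU2 _ mP mN) _; rewrite [X in (_ + X)%E]N0 adde0.
rewrite [X in (X <= _)%E]product_measure1E//; last first.
  by apply: measurableD => //; exact: measurable_rcube.
rewrite [X in (_ * X)%E]lebesgue_measure_itv/= lte_fin r0 oppr0 adde0.
rewrite exprSr mulrA EFinM; apply: lee_wpmul2r => //.
by rewrite lee_fin ltW.
Unshelve. all: by end_near. Qed.

Lemma fill_density E : measurable E ->
  {ae lebesgue_row n, forall z, vfill E z -> forall e : R, 0 < e ->
    \forall r \near 0^'+, (vol (half_ball z r `\` E) <= (e * r ^+ n.+1)%:E)%E}.
Proof.
move=> mE; have H k := fill_level_density k mE.
have := negligible_bigcup H; apply: negligibleS => z /= nz.
apply: contrapT => nU; apply: nz; rewrite vfill_levels// => -[k _ Qz].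
by apply: contrapT => nH; apply: nU; exists k => //= /(_ Qz).
Qed.

Lemma ereal_ratio (v w : \bar R) (a b : R) : 0 < a -> v \is a fin_num ->
  (a%:E <= v)%E -> (0 <= w)%E -> (w <= b%:E)%E ->
  exists2 q : R, (v^-1 * w)%E = q%:E & 0 <= q <= b / a.
Proof.
case: v => [v||]//; case: w => [w||]// a0 _; rewrite !lee_fin => av w0 wb.
have v0 : 0 < v by exact: lt_le_trans av.
exists (v^-1 * w); first by rewrite inver gt_eqF.
rewrite mulr_ge0 ?invr_ge0 ?(ltW v0)//= mulrC; apply: ler_pM => //.
  by rewrite invr_ge0 ltW.
by rewrite lef_pV2 ?posrE.
Qed.

Lemma half_ball_ratio z (v : R -> \bar R) :
  (forall r, (0 <= v r)%E) ->
  (forall e : R, 0 < e -> \forall r \near 0^'+, (v r <= (e * r ^+ n.+1)%:E)%E) ->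
  ((vol (half_ball z r))^-1 * v r)%E @[r --> 0^'+] --> 0%E.
Proof.
move=> v0 H; pose a r : R := (n.+1%:R^-1 * r) ^+ n.+1.
have a0 r : 0 < r -> 0 < a r by move=> r0; rewrite exprn_gt0// mulr_gt0.
have R' r b : 0 < r -> (v r <= b%:E)%E ->
    exists2 q : R, ((vol (half_ball z r))^-1 * v r)%E = q%:E & 0 <= q <= b / a r.
  move=> r0 vb; apply: ereal_ratio => //; [exact: a0| |exact: vol_half_ball_ge].
  by apply: vol_half_ball_fin; exact: ltW.
apply/fine_cvgP; split.
  near=> r; have r0 : 0 < r by near: r; exact: nbhs_right_gt.
  have vb : (v r <= (1 * r ^+ n.+1)%:E)%E by near: r; exact: H.
  by have [q ->] := R' r _ r0 vb.
apply/cvgrPdist_le => e e0.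
have k0 : 0 < e * n.+1%:R^-1 ^+ n.+1 by rewrite mulr_gt0// exprn_gt0.
near=> r.
have r0 : 0 < r by near: r; exact: nbhs_right_gt.
have vb : (v r <= (e * n.+1%:R^-1 ^+ n.+1 * r ^+ n.+1)%:E)%E by near: r; exact: H.
have [q /= -> /andP[q0 qe]] := R' r _ r0 vb.
rewrite /= sub0r normrN ger0_norm//; apply: le_trans qe _.
by rewrite /a -mulrA -exprMn mulfK// gt_eqF// exprn_gt0// mulr_gt0.
Unshelve. all: by end_near. Qed.

(** Almost every slice that is not full is void, that is, full for the complement. The mean
    deviation in half balls is then the density of the complement or of [E], and [fill_density]
    makes it vanish. *)
Lemma is_trace_vfill E : measurable E -> (perimeter E < +oo)%E ->
  is_trace \1_E \1_(vfill E).
Proof.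
move=> mE PE; split; first by apply: measurable_indic; exact: measurable_vfill.
have mEc := measurableC mE.
have := fill_density mE; have := fill_density mEc; have := fill_or_void mE PE.
apply: filterS3 => z FV HV HF.
have int1 (F : set space) r : measurable F -> (\int[vol]_(x in half_ball z r) (\1_F x)%:E)%E =
    vol (half_ball z r `\` ~` F).
  move=> mF; rewrite integral_indic//; first by rewrite setDE setCK setIC.
  exact: measurable_half_ball.
have [Fz|nF] := pselect (vfill E z).
  rewrite (indic_in Fz) (_ : (fun r => _) = fun r => ((vol (half_ball z r))^-1 *
    vol (half_ball z r `\` E))%E); first exact: half_ball_ratio (HF Fz).
  apply/funext => r; congr (_ * _)%E; rewrite -{2}(setCK E) -int1//.
  apply: eq_integral => x _; congr (_%:E); rewrite !indicE in_setC.
  by case: (x \in E); rewrite ?subrr ?normr0// sub0r normrN normr1.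
have Vz : vfill (~` E) z by rewrite -vvoidE; case: FV.
rewrite (indic_out nF) (_ : (fun r => _) = fun r => ((vol (half_ball z r))^-1 *
  vol (half_ball z r `\` ~` E))%E); first exact: half_ball_ratio (HV Vz).
apply/funext => r; congr (_ * _)%E; rewrite -int1//.
by apply: eq_integral => x _; rewrite subr0 ger0_norm.
Qed.

(** The number |T z - T' z| is bounded by the sum of the two mean deviations over every half ball,
    and both tend to 0. *)
Lemma trace_unique E (T T' : row -> R) : measurable E -> is_trace \1_E T -> is_trace \1_E T' ->
  {ae lebesgue_row n, forall z, T z = T' z}.
Proof.
move=> mE [mT HT] [mT' HT']; apply: filterS2 HT HT' => z H H'.
have mh r := measurable_half_ball z r.
have mi (S : R) r : measurable_fun (half_ball z r) (fun x : space => (`|\1_E x - S|)%:E).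
  apply: measurable_funTS; apply/measurable_EFinP; apply: measurableT_comp => //.
  by apply: measurable_funB => //; exact: measurable_indic.
have HD : ((vol (half_ball z r))^-1 * \int[vol]_(x in half_ball z r) `|\1_E x - T z|%:E +
  (vol (half_ball z r))^-1 * \int[vol]_(x in half_ball z r) `|\1_E x - T' z|%:E)%E @[r --> 0^'+] --> 0%E.
  by rewrite -[0%E in X in _ --> X]adde0; exact: cvgeD.
apply/eqP; rewrite -subr_eq0 -normr_le0 -lee_fin.
rewrite -[X in (_ <= X)%E](cvg_lim _ HD)//.
apply: lime_ge; first by apply/cvg_ex; eexists; exact: HD.
near=> r; have r0 : 0 < r by near: r; exact: nbhs_right_gt.
have vf := vol_half_ball_fin z (ltW r0).
have vp : (0 < vol (half_ball z r))%E.
  apply: lt_le_trans (vol_half_ball_ge z r0).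
  by rewrite lte_fin exprn_gt0// mulr_gt0.
rewrite /= -(fineK vf) inver gt_eqF ?fine_gt0 ?vp ?ltey_eq ?vf//.
rewrite -ge0_muleDr; [|exact: integral_ge0|exact: integral_ge0].
rewrite lee_pdivlMl ?fine_gt0 ?vp ?ltey_eq ?vf// fineK// muleC -integral_cst//.
rewrite -ge0_integralD//.
apply: ge0_le_integral => //.
- by move=> x _; rewrite lee_fin.
- by apply: emeasurable_funD; exact: mi.
move=> x _; rewrite -EFinD lee_fin distrC.
by apply: le_trans (ler_distD (\1_E x) _ _) _; rewrite distrC addrC distrC.
Unshelve. all: by end_near. Qed.

(** [get] returns a trace because one exists; uniqueness then identifies it almost everywhere. *)
Lemma trace_vfill E : measurable E -> (perimeter E < +oo)%E ->
  measurable_fun setT (trace \1_E) /\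
  {ae lebesgue_row n, forall z, trace \1_E z = \1_(vfill E) z}.
Proof.
move=> mE PE; have tE := is_trace_vfill mE PE.
have tT : is_trace \1_E (trace \1_E).
  by rewrite /trace; apply: (@getPex _ (is_trace \1_E)); exists \1_(vfill E).
by split; [exact: tT.1|exact: trace_unique tT tE].
Qed.

End slices.

(** * The calibration *)

Section composition.
Context {R : realType}.
Implicit Types V : normedModType R.

(** The derivative of [g] is prescribed only at values of [f], since the square root and the inverse
    are not C1 on the whole line. *)
Lemma C1_comp_derive V (g dg : R -> R) (f : V -> R) :
  (forall x, is_derive (f x) 1 g (dg (f x))) -> continuous (fun x => dg (f x)) ->
  C1 f -> C1 (fun x => g (f x)) /\
    forall x v, 'D_v (fun y => g (f y)) x = dg (f x) * 'D_v f x.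
Proof.
move=> gd cdg cf.
have dg_ x : differentiable g (f x).
  by apply/derivable1_diffP; have := gd x; case.
have D x v : 'D_v (fun y => g (f y)) x = dg (f x) * 'D_v f x.
  have df := cf.1 x; rewrite deriveE; last exact: differentiable_comp.
  rewrite (@diff_comp _ _ _ _ f g x df (dg_ x))/= -(@derive_val _ _ _ _ _ _ _ (gd x)) !deriveE//.
  rewrite -[in LHS](mulr1 ('d f x v)) -[LHS]/('d g (f x) ('d f x v *: 1)).
  by rewrite linearZ/= mulrC.
split=> //; split=> [x|v]; first exact: (differentiable_comp (cf.1 x) (dg_ x)).
apply: (@eq_continuous _ _ (fun y => dg (f y) * 'D_v f y)) => y; first by rewrite D.
by apply: cvgM; [exact: cdg|exact: cf.2].
Qed.

Lemma C1_sqrt V (f : V -> R) : (forall x, 0 < f x) -> C1 f ->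
  C1 (fun x => Num.sqrt (f x)) /\
    forall x v, 'D_v (fun y => Num.sqrt (f y)) x = 'D_v f x / (2 * Num.sqrt (f x)).
Proof.
move=> f0 cf.
have [c D] : C1 (fun x => Num.sqrt (f x)) /\ forall x v,
    'D_v (fun y => Num.sqrt (f y)) x = (2 * Num.sqrt (f x))^-1 * 'D_v f x.
  apply: (@C1_comp_derive _ Num.sqrt (fun u => (2 * Num.sqrt u)^-1)) => //.
    by move=> x; exact: is_derive1_sqrt.
  move=> x; apply: cvgV; first by rewrite mulf_neq0// gt_eqF// sqrtr_gt0.
  apply: cvgM; first exact: cvg_cst.
  apply: (@cvg_comp _ _ _ f Num.sqrt); first exact: C1_continuous.
  exact: sqrt_continuous.
by split=> // x v; rewrite D mulrC.
Qed.

Lemma C1_inv V (f : V -> R) : (forall x, 0 < f x) -> C1 f ->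
  C1 (fun x => (f x)^-1) /\
    forall x v, 'D_v (fun y => (f y)^-1) x = - 'D_v f x / f x ^+ 2.
Proof.
move=> f0 cf.
have [c D] : C1 (fun x => (f x)^-1) /\ forall x v,
    'D_v (fun y => (f y)^-1) x = - (f x) ^- 2 * 'D_v f x.
  apply: (@C1_comp_derive _ (fun u => u^-1) (fun u => - u ^- 2)) => //.
    move=> x; have h := is_derive_id (f x) 1.
    have n0 : f x != 0 by rewrite gt_eqF.
    have := is_deriveV (f := id) n0 h.
    by rewrite [_ *: _]mulr1.
  move=> x; apply: cvgN; apply: cvgV; first by rewrite expf_neq0// gt_eqF.
  by apply: cvgM; exact: C1_continuous.
by split=> // x v; rewrite D mulrC mulrN mulNr.
Qed.

End composition.

Section calibration_field.
Context {R : realType} {n : nat}.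
Local Notation space := ('rV[R]_n * R)%type.
Implicit Types x y w v : space.
Variable b : R.
Hypotheses (b0 : 0 < b) (b1 : b < 1).

Definition hsq x : R := \sum_(i < n) x.1 ord0 i ^+ 2.

Lemma hsq_ge0 x : 0 <= hsq x.
Proof. by apply: sumr_ge0 => i _; exact: sqr_ge0. Qed.

Lemma C1_hsq : C1 hsq /\
  forall x v, 'D_v hsq x = 2 * \sum_(i < n) x.1 ord0 i * v.1 ord0 i.
Proof.
have c2 : C1 (fun x : space => x.2 * x.2) by apply: C1M; exact: C1_last.1.
have E x : sqnorm x - x.2 * x.2 = hsq x by rewrite /sqnorm expr2 addrK.
have cs := C1_sqnorm (R := R) (n := n).
split=> [|x v]; first exact: eq_C1 E (C1B cs.1 c2).
have <- : (fun x => sqnorm x - x.2 * x.2) = hsq by apply/funext.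
rewrite (deriveD_C1 _ _ cs.1 (C1N c2)) (deriveN_C1 _ _ c2).
rewrite (deriveM_C1 _ _ C1_last.1 C1_last.1) C1_last.2 cs.2 /dot.
by ring.
Qed.

Definition hroot (m : R) x : R := Num.sqrt (m + hsq x).

Lemma hroot_gt0 m x : 0 < m -> 0 < hroot m x.
Proof. by move=> m0; rewrite sqrtr_gt0 ltr_wpDr// hsq_ge0. Qed.

Lemma hroot_sqr m x : 0 < m -> hroot m x ^+ 2 = m + hsq x.
Proof. by move=> m0; rewrite sqr_sqrtr// addr_ge0 ?hsq_ge0// ltW. Qed.

Lemma C1_root m : 0 < m -> C1 (hroot m) /\
  forall x v, 'D_v (hroot m) x = (\sum_(i < n) x.1 ord0 i * v.1 ord0 i) / hroot m x.
Proof.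
move=> m0; have p x : 0 < m + hsq x by rewrite ltr_wpDr// hsq_ge0.
have cm : C1 (fun x => m + hsq x) by apply: C1D; [exact: C1_cst|exact: C1_hsq.1].
have [c D] := C1_sqrt p cm; split=> // x v; rewrite D.
rewrite (deriveD_C1 _ _ (C1_cst _ m) C1_hsq.1) derive_cst add0r C1_hsq.2.
by rewrite invfM mulrACA divff// mul1r.
Qed.

Lemma C1_invroot m : 0 < m -> C1 (fun x => (hroot m x)^-1) /\
  forall x v, 'D_v (fun y => (hroot m y)^-1) x =
    - (\sum_(i < n) x.1 ord0 i * v.1 ord0 i) / hroot m x ^+ 3.
Proof.
move=> m0; have [c D] := C1_root m0.
have [c' D'] := C1_inv (fun x => hroot_gt0 x m0) c.
split=> // x v; rewrite D' D mulNr mulNr; congr (- _).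
by have := hroot_gt0 x m0; move: (hroot m x) => r r0; field; rewrite gt_eqF.
Qed.

Definition slope : R := Num.sqrt (1 - b ^+ 2).

Lemma slope_sqr : slope ^+ 2 = 1 - b ^+ 2.
Proof. by rewrite sqr_sqrtr// subr_ge0 expr_le1// ltW. Qed.

Lemma slope_ge0 : 0 <= slope. Proof. exact: sqrtr_ge0. Qed.

Definition level x : R := b * x.2 + slope * hroot 1 x.

(** The gradient of [level] divided by its length [hroot (b ^+ 2) x / hroot 1 x], after cancelling
    [hroot 1 x]; the length follows from b^2 + s^2 = 1. *)
Definition nfield x : space :=
  (\row_i (slope * x.1 ord0 i * (hroot (b ^+ 2) x)^-1),
   b * hroot 1 x * (hroot (b ^+ 2) x)^-1).

Let b20 : 0 < b ^+ 2. Proof. exact: exprn_gt0. Qed.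

Lemma nfield_C1 : field_C1 nfield.
Proof.
have cr := (C1_invroot b20).1; split=> [i|].
  apply: (@eq_C1 _ _ (fun x => slope * x.1 ord0 i * (hroot (b ^+ 2) x)^-1)).
    by move=> x; rewrite mxE.
  by apply: C1M => //; apply: C1M; [exact: C1_cst|exact: (C1_coord i).1].
apply: C1M => //; apply: C1M; first exact: C1_cst.
exact: (C1_root ltr01).1.
Qed.

Lemma nfield_unit x : sqnorm (nfield x) = 1.
Proof.
have r0 := hroot_gt0 x b20; have rs := hroot_sqr x b20.
rewrite /sqnorm /=; under eq_bigr do rewrite mxE !exprMn.
rewrite -mulr_suml -mulr_sumr -/(hsq x) slope_sqr !exprMn (hroot_sqr x ltr01).
rewrite -mulrDl exprVn rs.
suff -> : (1 - b ^+ 2) * hsq x + b ^+ 2 * (1 + hsq x) = b ^+ 2 + hsq x.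
  by rewrite divff// gt_eqF// -rs exprn_gt0.
by ring.
Qed.

Lemma nfield_last x : b <= (nfield x).2.
Proof.
have r0 := hroot_gt0 x b20.
rewrite /= -mulrA ler_peMr ?(ltW b0)//.
rewrite ler_pdivlMr// mul1r ler_wsqrtr// lerD2r.
by rewrite expr_le1// ltW.
Qed.

Lemma derive_level x v :
  'D_v level x = hroot (b ^+ 2) x / hroot 1 x * dot (nfield x) v.
Proof.
have [c D] := C1_root (ltr01 : (0 : R) < 1).
have cb : C1 (fun x : space => b * x.2) by apply: C1M; [exact: C1_cst|exact: C1_last.1].
have cr : C1 (fun x => slope * hroot 1 x) by apply: C1M => //; exact: C1_cst.
rewrite /level (deriveD_C1 _ _ cb cr).
rewrite (deriveM_C1 _ _ (C1_cst _ b) C1_last.1) (deriveM_C1 _ _ (C1_cst _ slope) c).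
rewrite !derive_cst !mulr0 !addr0 C1_last.2 D /dot /=.
under [in RHS]eq_bigr do rewrite mxE mulrAC -[slope * _ * _]mulrA mulrAC.
have r0 := hroot_gt0 x b20; have r1 := hroot_gt0 x (ltr01 : (0 : R) < 1).
rewrite -mulr_sumr; move: (\sum_(i < n) _) => S.
by field; rewrite !gt_eqF.
Qed.

Lemma C1_level : C1 level.
Proof.
apply: C1D; first by apply: C1M; [exact: C1_cst|exact: C1_last.1].
by apply: C1M; [exact: C1_cst|exact: (C1_root ltr01).1].
Qed.

Lemma derive_vertical_root m x : 0 < m -> 'D_(0, 1) (hroot m) x = 0 /\
  'D_(0, 1) (fun y => (hroot m y)^-1) x = 0.
Proof.
move=> m0; rewrite (C1_root m0).2 (C1_invroot m0).2 big1 => [|i _].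
  by rewrite oppr0 !mul0r.
by rewrite mxE mulr0.
Qed.

(** With r the root of b^2 + |z|^2, the i-th horizontal term is s(r^2 - z_i^2)/r^3, which is
    nonnegative separately for each i. The vertical component does not depend on the height. *)
Lemma divergence_nfield x : 0 <= divergence nfield x.
Proof.
have [c D] := C1_invroot b20; have c1 := (C1_root (ltr01 : (0 : R) < 1)).1.
have r0 := hroot_gt0 x b20.
rewrite /divergence; apply: addr_ge0.
  apply: sumr_ge0 => i _.
  have -> : (fun y => (nfield y).1 ord0 i) = fun y => slope * y.1 ord0 i * (hroot (b ^+ 2) y)^-1.
    by apply/funext => y; rewrite mxE.
  have cc : C1 (fun y : space => slope * y.1 ord0 i).
    by apply: C1M; [exact: C1_cst|exact: (C1_coord i).1].
  rewrite (deriveM_C1 _ _ cc c) (deriveM_C1 _ _ (C1_cst _ slope) (C1_coord i).1).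
  rewrite derive_cst mulr0 addr0 (C1_coord i).2 D /= mxE !eqxx/=.
  rewrite (bigD1 i)//= big1 => [|j ji]; last by rewrite mxE eqxx (negbTE ji) mulr0.
  rewrite mxE !eqxx addr0 !mulr1.
  have xi : x.1 ord0 i ^+ 2 <= hroot (b ^+ 2) x ^+ 2.
    rewrite hroot_sqr// /hsq (bigD1 i)//= addrCA lerDl addr_ge0 ?(ltW b20)//.
    by apply: sumr_ge0 => j _; exact: sqr_ge0.
  have s0 := slope_ge0; move: (hroot _ x) r0 xi => r r0 xi.
  suff -> : slope * x.1 ord0 i * (- x.1 ord0 i / r ^+ 3) + r^-1 * slope =
      slope * (r ^+ 2 - x.1 ord0 i ^+ 2) / r ^+ 3.
    by apply: divr_ge0; [rewrite mulr_ge0 ?subr_ge0|rewrite exprn_ge0// ltW].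
  by field; rewrite gt_eqF.
have -> : (fun y => (nfield y).2) = fun y => b * hroot 1 y * (hroot (b ^+ 2) y)^-1 by [].
have cc : C1 (fun y => b * hroot 1 y) by apply: C1M => //; exact: C1_cst.
rewrite (deriveM_C1 _ _ cc c) (deriveM_C1 _ _ (C1_cst _ b) c1).
rewrite (derive_vertical_root _ ltr01).1 (derive_vertical_root _ b20).2 derive_cst.
by rewrite !mulr0 addr0 mulr0.
Qed.

Lemma dot_le1 v w : sqnorm v <= 1 -> sqnorm w <= 1 -> dot v w <= 1.
Proof.
move=> v1 w1; have := sqnorm_ge0 (v - w); rewrite sqnormD dotN.
have -> : sqnorm (- w) = sqnorm w.
  by rewrite /sqnorm /= sqrrN; congr (_ + _); apply: eq_bigr => i _; rewrite mxE sqrrN.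
by lra.
Qed.

End calibration_field.

(** * Cutoff functions *)

Section ramp.
Context {R : realType}.
Implicit Types t : R.

(** A C1 step from 0 to 1 on the unit interval: 2t^2 on the first half and 1 - 2(1 - t)^2 on the
    second. Its derivative [dramp] is a tent of height 2. *)
Definition ramp t : R := 2 * sqpos t - 4 * sqpos (t - 1 / 2) + 2 * sqpos (t - 1).

Definition dramp t : R :=
  4 * Num.max t 0 - 8 * Num.max (t - 1 / 2) 0 + 4 * Num.max (t - 1) 0.

Lemma ramp_dramp_cases t :
  [/\ 0 <= ramp t <= 1, 0 <= dramp t <= 2,
      t <= 0 -> ramp t = 0 /\ dramp t = 0 & 1 <= t -> ramp t = 1 /\ dramp t = 0].
Proof.
rewrite /ramp /dramp /sqpos /Num.max.
case: ltP => h1; case: ltP => h2; case: ltP => h3; split;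
  try (by lra); try (by apply/andP; split; nra); try (by move=> h; split; nra).
Qed.

Lemma C1_ramp : C1 ramp /\ forall t, 'D_1 ramp t = dramp t.
Proof.
have [cs D] := @C1_sqpos R.
have csh (a : R) : C1 (fun t => sqpos (t - a)) by exact: C1_translate.
have cm (a : R) (f : R -> R) : C1 f -> C1 (fun t => a * f t) by move=> cf; apply: C1M => //; exact: C1_cst.
have Dm (a : R) (f : R -> R) t : C1 f -> 'D_1 (fun t => a * f t) t = a * 'D_1 f t.
  by move=> cf; rewrite (deriveM_C1 _ _ (C1_cst _ a) cf) derive_cst mulr0 addr0.
have Ds (a t : R) : 'D_1 (fun t => sqpos (t - a)) t = 2 * Num.max (t - a) 0.
  by rewrite (derive_translate sqpos) D mulr1.
have c1 := cm 2 _ cs; have c2 := C1N (cm 4 _ (csh (1 / 2))); have c3 := cm 2 _ (csh 1).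
split; first exact: C1D (C1D c1 c2) c3.
move=> t; rewrite /ramp (deriveD_C1 _ _ (C1D c1 c2) c3) (deriveD_C1 _ _ c1 c2).
rewrite (deriveN_C1 _ _ (cm 4 _ (csh (1/2)))) !Dm// !Ds D mulr1 /dramp.
by ring.
Qed.

Lemma C1_ramp_comp (V : normedModType R) (f : V -> R) : C1 f ->
  C1 (fun x => ramp (f x)) /\
  forall x v, 'D_v (fun y => ramp (f y)) x = dramp (f x) * 'D_v f x.
Proof.
move=> cf; have [cr D] := C1_ramp; split; first exact: C1_comp.
by move=> x v; rewrite derive_comp_C1// D.
Qed.

Lemma ramp01 t : 0 <= ramp t <= 1. Proof. by case: (ramp_dramp_cases t). Qed.

End ramp.

Section cutoffs.
Context {R : realType} {n : nat}.
Local Notation space := ('rV[R]_n * R)%type.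
Implicit Types x y w v : space.

Definition ascent d x : R := ramp ((x.2 - d) / d).

(** Equal to 1 for |x| <= r and to 0 once |x|^2 >= 2r^2, in particular off [box (2 * r)]. The
    squared norm avoids a singularity at the origin. *)
Definition plateau (r : R) x : R := ramp (2 - sqnorm x / r ^+ 2).

Lemma C1_ascent d : C1 (ascent d) /\
  forall x v, 'D_v (ascent d) x = dramp ((x.2 - d) / d) * (v.2 / d).
Proof.
have c0 : C1 (fun x : space => x.2 - d) by apply: C1B; [exact: C1_last.1|exact: C1_cst].
have cf : C1 (fun x : space => (x.2 - d) / d) by apply: C1M => //; exact: C1_cst.
have [c D] := C1_ramp_comp cf; split=> // x v; rewrite D; congr (_ * _).
rewrite (deriveM_C1 _ _ c0 (C1_cst _ d^-1)) derive_cst mulr0 add0r.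
by rewrite (deriveD_C1 _ _ C1_last.1 (C1_cst _ (- d))) derive_cst addr0 C1_last.2 mulrC.
Qed.

Lemma C1_plateau (r : R) : C1 (plateau r) /\
  forall x v, 'D_v (plateau r) x = - dramp (2 - sqnorm x / r ^+ 2) * (2 * dot x v / r ^+ 2).
Proof.
have cs := C1_sqnorm (R := R) (n := n).
have c1 : C1 (fun x : space => sqnorm x / r ^+ 2) by apply: C1M; [exact: cs.1|exact: C1_cst].
have cf : C1 (fun x : space => 2 - sqnorm x / r ^+ 2) by apply: C1B => //; exact: C1_cst.
have [c D] := C1_ramp_comp cf; split=> // x v; rewrite D mulNr -mulrN; congr (_ * _).
rewrite (deriveD_C1 _ _ (C1_cst _ (2 : R)) (C1N c1)) (deriveN_C1 _ _ c1) derive_cst add0r.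
rewrite (deriveM_C1 _ _ cs.1 (C1_cst _ (r ^+ 2)^-1)) derive_cst mulr0 add0r cs.2.
by rewrite mulrC.
Qed.

Lemma plateau_in (r : R) x : 0 < r -> sqnorm x <= r ^+ 2 ->
  plateau r x = 1 /\ forall v, 'D_v (plateau r) x = 0.
Proof.
move=> r0 xr; have h : 1 <= 2 - sqnorm x / r ^+ 2.
  by have : sqnorm x / r ^+ 2 <= 1; [rewrite ler_pdivrMr ?exprn_gt0// mul1r|lra].
have [_ _ _ /(_ h)[E D]] := ramp_dramp_cases (2 - sqnorm x / r ^+ 2).
by split=> // v; rewrite (C1_plateau r).2 D oppr0 mul0r.
Qed.

Lemma plateau_out (r : R) x : 0 < r -> ~ box (2 * r) x ->
  plateau r x = 0 /\ forall v, 'D_v (plateau r) x = 0.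
Proof.
move=> r0 nb; have xr : 2 * r ^+ 2 <= sqnorm x.
  rewrite leNgt; apply/negP => h; apply: nb; apply: sqnorm_lt_box; first by rewrite mulr_gt0.
  by apply: lt_le_trans h _; rewrite exprMn ler_wpM2r ?sqr_ge0//; lra.
have h : 2 - sqnorm x / r ^+ 2 <= 0.
  by rewrite subr_le0 ler_pdivlMr ?exprn_gt0.
have [_ _ /(_ h)[E D] _] := ramp_dramp_cases (2 - sqnorm x / r ^+ 2).
by split=> // v; rewrite (C1_plateau r).2 D oppr0 mul0r.
Qed.

(** Where the derivative is nonzero |x|^2 < 2r^2, and expanding |x - r v|^2 >= 0 gives x.v <= 3r/2.
    With slope at most 2 of the ramp this yields 2 * 2 * (3r/2) / r^2 = 6/r. *)
Lemma derive_plateau_ge (r : R) x v : 0 < r -> sqnorm v <= 1 ->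
  - (6 / r) * \1_(box (2 * r)) x <= 'D_v (plateau r) x.
Proof.
move=> r0 v1; have [bx|nb] := pselect (box (2 * r) x); last first.
  by rewrite (indic_out nb) mulr0 (plateau_out r0 nb).2.
rewrite (indic_in bx) mulr1 (C1_plateau r).2.
have [h|h] := leP (2 - sqnorm x / r ^+ 2) 0.
  have [_ _ /(_ h)[_ ->] _] := ramp_dramp_cases (2 - sqnorm x / r ^+ 2).
  by rewrite oppr0 mul0r oppr_le0 divr_ge0// ltW.
have xr : sqnorm x < 2 * r ^+ 2 by move: h; rewrite subr_gt0 ltr_pdivrMr ?exprn_gt0.
have [_ /andP[d0 d2] _ _] := ramp_dramp_cases (2 - sqnorm x / r ^+ 2).
set D := dramp _ in d0 d2 *.
have dt : dot x v <= 3 / 2 * r.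
  have := sqnorm_ge0 (x + (- r) *: v); rewrite sqnormD.
  have -> : sqnorm ((- r) *: v) = r ^+ 2 * sqnorm v.
    rewrite /sqnorm /= [_ *: v.2]/(_ * _) exprMn sqrrN mulrDr; congr (_ + _).
    by rewrite mulr_sumr; apply: eq_bigr => i _; rewrite mxE exprMn sqrrN.
  rewrite (linear_scale _ _ (dot_linear x)) => H.
  have H1 : r ^+ 2 * sqnorm v <= r ^+ 2 * 1 by rewrite ler_wpM2l ?sqr_ge0.
  have : r * dot x v <= r * (3 / 2 * r) by nra.
  by rewrite ler_pM2l.
have r2 : 0 < r ^+ 2 by rewrite exprn_gt0.
rewrite mulNr lerN2 mulrA ler_pdivrMr//.
have -> : 6 / r * r ^+ 2 = 2 * (2 * (3 / 2 * r)) by field; rewrite gt_eqF.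
have r3 : 0 <= 2 * (3 / 2 * r) by lra.
apply: (@le_trans _ _ (D * (2 * (3 / 2 * r)))); last by rewrite ler_wpM2r.
by rewrite ler_wpM2l// ler_pM2l.
Qed.

Lemma ascent_low d x : 0 < d -> x.2 <= d -> ascent d x = 0.
Proof.
move=> d0 xd; have h : (x.2 - d) / d <= 0 by rewrite pmulr_lle0 ?invr_gt0// subr_le0.
by have [_ _ /(_ h)[]] := ramp_dramp_cases ((x.2 - d) / d).
Qed.

Lemma ascent_high d x : 0 < d -> 2 * d <= x.2 -> ascent d x = 1.
Proof.
move=> d0 xd; have h : 1 <= (x.2 - d) / d by rewrite ler_pdivlMr//; lra.
by have [_ _ _ /(_ h)[]] := ramp_dramp_cases ((x.2 - d) / d).
Qed.

End cutoffs.

(** * The calibration inequality *)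

Section calibration.
Context {R : realType} {n : nat}.
Local Notation space := ('rV[R]_n * R)%type.
Implicit Types x y w v : space.
Implicit Types phi : space -> space.
Implicit Types E F A : set space.
Variable b : R.
Hypotheses (b0 : 0 < b) (b1 : b < 1).

Lemma dot_self x : dot x x = sqnorm x.
Proof. by rewrite /dot /sqnorm -expr2; congr (_ + _); apply: eq_bigr => i _; rewrite expr2. Qed.

Definition cutoff d r x : R := ascent d x * plateau r x.

Definition cutfield d r x : space := cutoff d r x *: nfield b x.

(** A C1 approximation from below of the indicator of [level b x < c]: it is 1 up to [c - sg] and 0
    from [c] on. *)
Definition layer sg c x : R := 1 - ramp ((level b x - (c - sg)) / sg).

Definition ascent_rate d x : R := dramp ((x.2 - d) / d) / d.

Lemma cutoff01 d r x : 0 <= cutoff d r x <= 1.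
Proof. by apply: itv01M; exact: ramp01. Qed.

Lemma layer01 sg c x : 0 <= layer sg c x <= 1.
Proof. by have /andP[? ?] := ramp01 ((level b x - (c - sg)) / sg); rewrite /layer; lra. Qed.

Lemma ascent_rate_ge0 d x : 0 < d -> 0 <= ascent_rate d x.
Proof.
move=> d0; have [_ /andP[h _] _ _] := ramp_dramp_cases ((x.2 - d) / d).
by rewrite divr_ge0// ltW.
Qed.

Lemma C1_cutoff d r : C1 (cutoff d r).
Proof. by apply: C1M; [exact: (C1_ascent d).1|exact: (C1_plateau r).1]. Qed.

Lemma C1_layer sg c : C1 (layer sg c) /\ forall x v,
  'D_v (layer sg c) x = - (dramp ((level b x - (c - sg)) / sg) * ('D_v (level b) x / sg)).
Proof.
have cl := @C1_level R n b.
have c0 : C1 (fun x => level b x - (c - sg)) by apply: C1B => //; exact: C1_cst.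
have cf : C1 (fun x => (level b x - (c - sg)) / sg) by apply: C1M => //; exact: C1_cst.
have [cr D] := C1_ramp_comp cf.
split=> [|x v]; first exact: C1_compl.
rewrite (derive_compl _ _ cr) D; congr (- (_ * _)).
rewrite (deriveM_C1 _ _ c0 (C1_cst _ sg^-1)) derive_cst mulr0 add0r.
by rewrite (deriveD_C1 _ _ cl (C1_cst _ (- (c - sg)))) derive_cst addr0 mulrC.
Qed.

Lemma cutfield_admissible d r : 0 < d -> 0 < r -> admissible d (2 * r) (cutfield d r).
Proof.
move=> d0 r0; split=> //.
- exact: (field_C1_scale (C1_cutoff d r) (nfield_C1 b0)).
- move=> x h; split.
    rewrite leNgt; apply/negP => xd; apply: h.
    by rewrite /cutfield /cutoff ascent_low ?ltW// mul0r scale0r.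
  apply: contra_notP h => nb.
  by rewrite /cutfield /cutoff (plateau_out r0 nb).1 mulr0 scale0r.
- move=> x; have /andP[k0 k1] := cutoff01 d r x.
  have := @sqnorm_convex R n (cutoff d r x) (nfield b x) 0 (cutoff01 d r x).
  rewrite scaler0 addr0; apply; first by rewrite nfield_unit.
  by rewrite /sqnorm big1 => [|i _]; rewrite ?mxE expr0n//= add0r.
Qed.

(** Of the three terms of the product rule, the divergence of [nfield b] is nonnegative, the
    vertical cutoff gains at least [b] times its rate because the vertical component is at least
    [b], and the plateau loses at most [6 / r]. *)
Lemma cutfield_divergence d r x : 0 < d -> 0 < r ->
  b * (ascent_rate d x * plateau r x) - 6 / r * \1_(box (2 * r)) x <= divergence (cutfield d r) x.
Proof.
move=> d0 r0; rewrite /cutfield (divergence_scale x (C1_cutoff d r) (nfield_C1 b0)).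
have dN := divergence_nfield b0 x; have /andP[k0 k1] := cutoff01 d r x.
rewrite /cutoff (deriveM_C1 _ _ (C1_ascent d).1 (C1_plateau r).1) (C1_ascent d).2 -/(cutoff d r x).
have nN := nfield_unit b0 b1 x; have Nb := nfield_last b0 b1 x.
have D := @derive_plateau_ge R n r x (nfield b x) r0; rewrite nN lexx in D; have {}D := D isT.
have /andP[l0 l1] := ramp01 ((x.2 - d) / d); rewrite -/(ascent d x) in l0 l1.
have /andP[c0 c1] := ramp01 (2 - sqnorm x / r ^+ 2); rewrite -/(plateau r x) in c0 c1.
have w0 := ascent_rate_ge0 x d0; rewrite [_ * (_ / d)]mulrCA -/(ascent_rate d x).
have p1 : 0 <= cutoff d r x * divergence (nfield b) x by rewrite mulr_ge0.
have i01 : 0 <= (\1_(box (2 * r)) x : R) by [].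
have p2 : - (6 / r * \1_(box (2 * r)) x) <= ascent d x * 'D_(nfield b x) (plateau r) x.
  have r6 : 0 <= 6 / r * \1_(box (2 * r)) x by rewrite mulr_ge0// divr_ge0// ltW.
  move: D; rewrite mulNr; move: ('D__ _ _) => Dc Dcge.
  by nra.
have p3 : b * (ascent_rate d x * plateau r x) <= plateau r x * ((nfield b x).2 * ascent_rate d x).
  have -> : plateau r x * ((nfield b x).2 * ascent_rate d x) =
    (nfield b x).2 * (ascent_rate d x * plateau r x) by ring.
  by rewrite ler_wpM2r// mulr_ge0.
by lra.
Qed.

(** Here [L] is the layer, [K * (q / sg)] the length of its gradient, [ch] the cutoff, [dp] the
    normal component of the test field, [lr] the boundary rate and [S] the loss at the plateau. *)
Lemma calibration_arith (L P K q sg ch dp lr S dX : R) : 0 <= L <= 1 -> 0 <= S ->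
  b * lr - S <= dX -> 0 <= K * (q / sg) * (ch - dp) ->
  L * P + b * ((1 - L) * lr) - S <=
  L * P - K * (q * dp / sg) + ((1 - L) * dX - - (K * (q * ch / sg))).
Proof.
move=> /andP[l0 l1] S0 h1 h2.
have h3 : (1 - L) * (b * lr - S) <= (1 - L) * dX by rewrite ler_wpM2l// subr_ge0.
have h4 : 0 <= L * S by rewrite mulr_ge0.
have -> : L * P - K * (q * dp / sg) + ((1 - L) * dX - - (K * (q * ch / sg))) =
  L * P + (1 - L) * dX + K * (q / sg) * (ch - dp) by ring.
by move: h2 h3 h4; rewrite !mulrBr !mulrBl !mul1r; lra.
Qed.

Definition testfield sg c d r phi := blend (layer sg c) (fun x => 1 - layer sg c x) phi (cutfield d r).

Lemma testfield_admissible sg c d r d0 M phi : 0 < d -> 0 < r -> admissible d0 M phi ->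
  admissible (Num.min d0 d) (Num.max M (2 * r)) (testfield sg c d r phi).
Proof.
move=> dp r0 aphi.
exact: (admissible_blend (C1_layer sg c).1 (layer01 sg c) aphi (cutfield_admissible dp r0)).
Qed.

Lemma sqnorm_box M x : box M x -> sqnorm x <= n.+1%:R * M ^+ 2.
Proof.
have sq (a : R) : `|a| <= M -> a ^+ 2 <= M ^+ 2.
  by move=> aM; rewrite -real_normK ?num_real// lerXn2r ?nnegrE//; exact: le_trans aM.
move=> [m1 m2]; rewrite /sqnorm -natr1 mulrDl mul1r; apply: lerD; last exact: sq.
by apply: sum_const_le => i; exact: sq.
Qed.

(** The field is [phi] below the level and the calibration above it. The gradient of the layer
    contributes a positive multiple of the cutoff minus the normal component of [phi]; this is
    nonnegative because the two size conditions make the cutoff 1 wherever [phi] is nonzero, and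
    [phi] has length at most 1. *)
Lemma testfield_divergence sg c d r d0 M phi x : 0 < sg -> 0 < d -> 0 < r -> admissible d0 M phi ->
  2 * d <= d0 -> n.+1%:R * M ^+ 2 <= r ^+ 2 ->
  layer sg c x * divergence phi x + b * ((1 - layer sg c x) * (ascent_rate d x * plateau r x))
    - 6 / r * \1_(box (2 * r)) x <= divergence (testfield sg c d r phi) x.
Proof.
move=> sg0 dp r0 [d00 cphi sphi nphi] dd Mr.
have [cl Dl] := C1_layer sg c.
have [_ cX _ _] := cutfield_admissible dp r0.
rewrite /testfield (divergence_blend x cl (C1_compl cl) cphi cX) (derive_compl _ _ cl) !Dl.
rewrite !(derive_level b0).
have HX := cutfield_divergence x dp r0.
have L01 := layer01 sg c x.
have dNX : dot (nfield b x) (cutfield d r x) = cutoff d r x.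
  by rewrite /cutfield (linear_scale _ _ (dot_linear _)) dot_self nfield_unit// mulr1.
rewrite dNX.
have dNphi : dot (nfield b x) (phi x) <= cutoff d r x.
  have [p0|pn] := pselect (phi x = 0).
    have -> : phi x = (0 : R) *: phi x by rewrite p0 scaler0.
    rewrite (linear_scale _ _ (dot_linear _)) mul0r.
    by have /andP[] := cutoff01 d r x.
  have [dx Mx] := sphi x pn.
  rewrite /cutoff ascent_high//; last exact: le_trans dx.
  have xr : sqnorm x <= r ^+ 2 by apply: le_trans Mr; exact: sqnorm_box.
  rewrite mul1r (plateau_in r0 xr).1; apply: dot_le1 (nphi x).
  by rewrite nfield_unit.
set K := dramp _; set q := hroot _ x / hroot 1 x.
have K0 : 0 <= K by have [_ /andP[]] := ramp_dramp_cases ((level b x - (c - sg)) / sg).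
have q0 : 0 <= q / sg.
  by rewrite divr_ge0 ?(ltW sg0)// divr_ge0// sqrtr_ge0.
have H1 : 0 <= K * (q / sg) * (cutoff d r x - dot (nfield b x) (phi x)).
  by rewrite mulr_ge0 ?subr_ge0// mulr_ge0.
have i01 : 0 <= 6 / r * (\1_(box (2 * r)) x : R) by rewrite mulr_ge0// divr_ge0// ltW.
exact: calibration_arith.
Qed.

(** The rate of ascent is a probability density in the height, concentrated between [d] and [2 * d],
    so for small [d] this integral detects the trace of [F] outside the sublevel. *)
Definition boundary_term F sg c d r : R :=
  \int[vol]_x (\1_F x * ((1 - layer sg c x) * (ascent_rate d x * plateau r x))).

Lemma measurable_C1 (f : space -> R) : C1 f -> measurable_fun setT f.
Proof. by move=> cf; apply: continuous_measurable_space; exact: C1_continuous. Qed.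

Lemma continuous_dramp : continuous (@dramp R).
Proof.
have cm (a : R) : continuous (fun t : R => Num.max (t - a) 0).
  move=> t; apply: (@cvg_comp _ _ _ (fun t => t - a) (fun t => Num.max t 0)).
    by apply: cvgB; [exact: cvg_id|exact: cvg_cst].
  by apply: (@continuous_max _ _ _ _ (t - a)) => //; exact: cst_continuous.
move=> t; apply: cvgD; last by apply: cvgM; [exact: cvg_cst|exact: cm].
apply: cvgB; apply: cvgM; [exact: cvg_cst| |exact: cvg_cst|exact: cm].
by apply: (@continuous_max _ _ _ _ t) => //; exact: cst_continuous.
Qed.

Lemma continuous_ascent_rate d : continuous (ascent_rate d).
Proof.
move=> x; apply: cvgM; last exact: cvg_cst.
apply: (@cvg_comp _ _ _ (fun x : space => (x.2 - d) / d) (@dramp R)); last exact: continuous_dramp.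
apply: cvgM; last exact: cvg_cst.
by apply: cvgB; [exact: cvg_snd|exact: cvg_cst].
Qed.

Lemma boundary_integrable F sg c d r : measurable F -> 0 < d -> 0 < r ->
  vol.-integrable setT (EFin \o (fun x =>
    \1_F x * ((1 - layer sg c x) * (ascent_rate d x * plateau r x)))).
Proof.
move=> mF d0 r0; apply: (@integrable_supp _ _ (2 * r) (2 / d)).
- apply: measurable_funM; first exact: measurable_indic.
  apply: measurable_funM; first exact: measurable_C1 (C1_compl (C1_layer sg c).1).
  apply: measurable_funM; last exact: measurable_C1 (C1_plateau r).1.
  by apply: continuous_measurable_space; exact: continuous_ascent_rate.
- move=> x; have /andP[l0 l1] := layer01 sg c x.
  have /andP[p0 p1] := ramp01 (2 - sqnorm x / r ^+ 2); rewrite -/(plateau r x) in p0 p1.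
  have a0 := ascent_rate_ge0 x d0.
  have a1 : ascent_rate d x <= 2 / d.
    have [_ /andP[_ h] _ _] := ramp_dramp_cases ((x.2 - d) / d).
    by rewrite /ascent_rate ler_pM2r// invr_gt0.
  rewrite normrM -[leRHS]mul1r; apply: ler_pM => //; first exact: indic_norm_le1.
  have q0 : 0 <= ascent_rate d x * plateau r x by rewrite mulr_ge0.
  have l2 : 0 <= 1 - layer sg c x by rewrite subr_ge0.
  rewrite (ger0_norm (mulr_ge0 l2 q0)).
  apply: (@le_trans _ _ (ascent_rate d x * plateau r x)).
    by rewrite ler_piMl// lerBlDr lerDl.
  exact: le_trans (ler_piMr a0 p1) a1.
- move=> x; apply: contra_notP => nb; rewrite (plateau_out r0 nb).1.
  by rewrite !mulr0.
Qed.

Lemma calibration_integral F (p sg c d r d0 M : R) phi : measurable F ->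
  (perimeter F <= p%:E)%E -> 0 < sg -> 0 < d -> 0 < r -> admissible d0 M phi ->
  2 * d <= d0 -> n.+1%:R * M ^+ 2 <= r ^+ 2 ->
  \int[vol]_x (\1_F x * layer sg c x * divergence phi x) + b * boundary_term F sg c d r
    - 6 / r * fine (vol (F `&` box (2 * r))) <= p.
Proof.
move=> mF Fp sg0 d0p r0 aphi dd Mr; have [d00 cphi sphi nphi] := aphi.
have apsi := testfield_admissible sg c d0p r0 aphi.
have [_ cpsi spsi _] := apsi.
have fl : flux F (testfield sg c d r phi) <= p.
  by rewrite -lee_fin; apply: le_trans Fp; exact: flux_le_perimeter apsi.
have i1 : vol.-integrable setT (EFin \o (fun x => \1_F x * layer sg c x * divergence phi x)).
  apply: (integrable_weight (C := 1) cphi sphi).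
    by apply: measurable_funM; [exact: measurable_indic|exact: measurable_C1 (C1_layer sg c).1].
  move=> x; rewrite normrM mulr_ile1 ?indic_norm_le1//.
  by have /andP[? ?] := layer01 sg c x; rewrite ger0_norm.
have i2 := boundary_integrable sg c mF d0p r0.
have mB := @measurable_box R n (2 * r).
have mFB : measurable (F `&` box (2 * r)) by exact: measurableI.
have fFB : (vol (F `&` box (2 * r)) < +oo)%E.
  apply: le_lt_trans (@vol_box_fin R n (2 * r)); apply: le_measure; rewrite ?inE//.
have i3 := integrable_cst_indic (6 / r) mFB fFB.
have i2b : vol.-integrable setT (EFin \o (fun x => b * (\1_F x *
    ((1 - layer sg c x) * (ascent_rate d x * plateau r x))))).
  exact: (integrableZl measurableT b i2).
have -> : 6 / r * fine (vol (F `&` box (2 * r))) =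
    \int[vol]_x (6 / r * \1_(F `&` box (2 * r)) x).
  have i1B : vol.-integrable setT (EFin \o (\1_(F `&` box (2 * r)) : space -> R)).
    by have := integrable_cst_indic 1 mFB fFB; under eq_fun do rewrite mul1r.
  rewrite (RintegralZl (6 / r) measurableT i1B); congr (_ * _).
  by rewrite /Rintegral integral_indic// setIT.
rewrite /boundary_term -(RintegralZl b measurableT i2) -(RintegralD measurableT i1 i2b).
have i12 := integrableD measurableT i1 i2b.
rewrite -(RintegralB measurableT i12 i3).
apply: le_trans fl; rewrite /flux; apply: le_Rintegral => //.
- exact: (integrableB measurableT i12 i3).
- exact: (integrable_flux mF cpsi spsi).
move=> x _; have := testfield_divergence c x sg0 d0p r0 aphi dd Mr.
have eI : \1_(F `&` box (2 * r)) x = \1_F x * \1_(box (2 * r)) x :> R by rewrite indicI.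
rewrite eI; have [Fx|nF] := pselect (F x); last first.
  by rewrite (indic_out nF) !mul0r !mulr0 addr0 subr0.
by rewrite (indic_in Fx) !mul1r.
Qed.

End calibration.

(** * Cutting along a level set *)

Section level_cut.
Context {R : realType} {n : nat}.
Local Notation space := ('rV[R]_n * R)%type.
Local Notation row := 'rV[R]_n.
Implicit Types x y w v : space.
Implicit Types phi : space -> space.
Implicit Types E F A : set space.
Variable b : R.
Hypotheses (b0 : 0 < b) (b1 : b < 1).

Definition sublevel c : set space := [set x | level b x < c].

Definition base_out c : set row := [set z | c <= level b (z, 0)].

Lemma measurable_sublevel c : measurable (sublevel c).
Proof. by apply: measurable_set_lt => //; exact: measurable_C1 (@C1_level R n b). Qed.

Lemma measurable_base_out c : measurable (base_out c).
Proof.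
have ml : measurable_fun setT (fun z : row => level b (z, 0)).
  apply: (@measurableT_comp _ _ _ _ _ _ (level b)).
    exact: measurable_C1 (@C1_level R n b).
  exact: pair2_measurable.
exact: measurable_set_le.
Qed.

Lemma level_out z (t c : R) : 0 <= t -> base_out c z -> c <= level b (z, t).
Proof.
move=> t0 h; apply: le_trans h _.
by rewrite /level /= mulr0 add0r /hroot /hsq /= lerDr mulr_ge0// ltW.
Qed.

Lemma layer_out sg c x : 0 < sg -> c <= level b x -> layer b sg c x = 0.
Proof.
move=> sg0 h; have h1 : 1 <= (level b x - (c - sg)) / sg by rewrite ler_pdivlMr//; lra.
have [_ _ _ /(_ h1)[E _]] := ramp_dramp_cases ((level b x - (c - sg)) / sg).
by rewrite /layer E subrr.
Qed.

Lemma layer_in sg c x : 0 < sg -> level b x <= c - sg -> layer b sg c x = 1.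
Proof.
move=> sg0 h; have h1 : (level b x - (c - sg)) / sg <= 0.
  by rewrite pmulr_lle0 ?invr_gt0// subr_le0.
have [_ _ /(_ h1)[E _] _] := ramp_dramp_cases ((level b x - (c - sg)) / sg).
by rewrite /layer E subr0.
Qed.

Lemma layer_cvg c x : layer b k.+1%:R^-1 c x @[k --> \oo] --> (\1_(sublevel c) x : R).
Proof.
have [h|h] := ltP (level b x) c.
  have p : 0 < c - level b x by rewrite subr_gt0.
  rewrite (indic_in (h : sublevel c x)); apply: (cvg_near_cst (1 : R)).
  have := near_infty_natSinv_lt (PosNum p); apply: filterS => k /= kp.
  apply: layer_in; first by rewrite invr_gt0.
  by rewrite lerBrDl -lerBrDr ltW.
rewrite (indic_out (_ : ~ sublevel c x)); last by rewrite /sublevel/= ltNge h.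
apply: (cvg_near_cst (0 : R)); apply: nearW => k.
by rewrite layer_out ?invr_gt0.
Qed.

(** Transport along the identity between the line and its measurable copy, on which the fundamental
    theorem of calculus is formulated. *)
Lemma lebesgue_line_integral (D : set R) (f : R -> \bar R) : measurable D ->
  measurable_fun D f -> (forall t, (0 <= f t)%E) ->
  (\int[@lebesgue_line R]_(t in D) f t = \int[lebesgue_measure]_(t in D) f t)%E.
Proof.
move=> mD mf f0.
pose phi (t : measurableTypeR R) : R := t.
have mphi : measurable_fun setT phi by move=> _ Y mY; rewrite setTI.
have := ge0_integral_pushforward mphi lebesgue_measure mD mf (fun t _ => f0 t).
move=> <-; apply: eq_measure_integral => A mA _ //.
Qed.

Lemma C1_id : C1 (fun t : R => t).
Proof.
split=> [t|v t]; first by apply/derivable1_diffP; exact: derivable_id.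
apply: (@eq_continuous _ _ (fun _ => v)) => [u|]; first by rewrite derive_id.
exact: cst_continuous.
Qed.

Lemma ascent_derivative d : C1 (fun t : R => ramp ((t - d) / d)) /\
  forall t : R, 'D_1 (fun t : R => ramp ((t - d) / d)) t = dramp ((t - d) / d) / d.
Proof.
have c0 : C1 (fun t : R => t - d) by apply: C1B; [exact: C1_id|exact: C1_cst].
have cf : C1 (fun t : R => (t - d) / d) by apply: C1M => //; exact: C1_cst.
have [cr D] := C1_ramp_comp cf; split=> // t; rewrite D; congr (_ * _).
rewrite (deriveM_C1 _ _ c0 (C1_cst _ d^-1)) derive_cst mulr0 add0r.
by rewrite (deriveD_C1 _ _ C1_id (C1_cst _ (- d))) derive_cst addr0 derive_id mulr1.
Qed.

Lemma continuous_rate d : continuous (fun t : R => dramp ((t - d) / d) / d).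
Proof.
move=> t; apply: cvgM; last exact: cvg_cst.
apply: (@cvg_comp _ _ _ (fun t : R => (t - d) / d) (@dramp R)); last exact: continuous_dramp.
apply: cvgM; last exact: cvg_cst.
by apply: cvgB; [exact: cvg_id|exact: cvg_cst].
Qed.

Lemma measurable_rate d : measurable_fun setT (fun t : R => dramp ((t - d) / d) / d).
Proof. exact: continuous_measurable_fun (@continuous_rate d). Qed.

Lemma integral_ascent d : 0 < d ->
  (\int[@lebesgue_line R]_(t in `[d, (2 * d)%R]) (dramp ((t - d) / d) / d)%:E = 1)%E.
Proof.
move=> d0; have dd : d < 2 * d by lra.
rewrite lebesgue_line_integral//; last 2 first.
- by apply: measurable_funTS; apply/measurable_EFinP; exact: measurable_rate.
- by move=> t; rewrite lee_fin; exact: (ascent_rate_ge0 ((0, t) : space) d0).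
have [cr D] := ascent_derivative d; have cc := C1_continuous cr.
rewrite (@continuous_FTC2 R (fun t => dramp ((t - d) / d) / d) (fun t => ramp ((t - d) / d)) d (2 * d) dd).
- have e1 : ramp ((2 * d - d) / d) = 1 :> R.
    have h : 1 <= (2 * d - d) / d by rewrite ler_pdivlMr//; lra.
    by have [_ _ _ /(_ h)[]] := ramp_dramp_cases ((2 * d - d) / d).
  have e0 : ramp ((d - d) / d) = 0 :> R.
    have h : (d - d) / d <= 0 by rewrite subrr mul0r.
    by have [_ _ /(_ h)[]] := ramp_dramp_cases ((d - d) / d).
  by rewrite e1 e0 sube0.
- by apply: continuous_subspaceT; exact: continuous_rate.
- split.
  + by move=> t _; exact: C1_derivable.
  + by apply: cvg_at_right_filter; exact: cc.
  + by apply: cvg_at_left_filter; exact: cc.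
- by move=> t _; rewrite derive1E D.
Qed.

Lemma boundary_integrand_ge0 F sg c d r x : 0 < d ->
  0 <= \1_F x * ((1 - layer b sg c x) * (ascent_rate d x * plateau r x)).
Proof.
move=> d0; have /andP[_ l1] := layer01 b sg c x.
have /andP[p0 _] := ramp01 (2 - sqnorm x / r ^+ 2); rewrite -/(plateau r x) in p0.
have a0 := ascent_rate_ge0 x d0.
by apply: mulr_ge0 => //; apply: mulr_ge0; [rewrite subr_ge0|exact: mulr_ge0].
Qed.

(** Over a point of the fill level the slice of [F] is full up to a height above [2 * d], so the
    whole unit mass of the rate is counted. Over [base_out] the layer vanishes, as the level
    increases with height, and within the cube the plateau is 1. *)
Lemma boundary_term_ge F sg c d r k (M : R) : measurable F -> 0 < sg -> 0 < d -> 0 < r ->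
  2 * d < k.+1%:R^-1 -> 1 <= M -> n.+1%:R * M ^+ 2 <= r ^+ 2 ->
  (lebesgue_row n (fill_level F k `&` base_out c `&` rcube 0 M) <=
   (boundary_term b F sg c d r)%:E)%E.
Proof.
move=> mF sg0 d0 r0 dk M1 Mr; set S := _ `&` rcube 0 M.
have mS : measurable S.
  apply: measurableI; last exact: measurable_rcube.
  by apply: measurableI; [exact: measurable_fill_level|exact: measurable_base_out].
pose I : set R := `[d, (2 * d)%R]%classic.
have mI : measurable I by exact: measurable_itv.
pose rho (t : R) : R := dramp ((t - d) / d) / d.
have rho0 t : 0 <= rho t by exact: (ascent_rate_ge0 ((0, t) : space) d0).
have mrho : measurable_fun setT rho by exact: measurable_rate.
pose h x : R := \1_S x.1 * (\1_I x.2 * rho x.2).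
have h0 x : 0 <= h x by rewrite mulr_ge0// mulr_ge0.
have mh : measurable_fun setT h.
  apply: measurable_funM.
    by apply: (@measurableT_comp _ _ _ _ _ _ (\1_S : row -> R)).
  apply: measurable_funM.
    by apply: (@measurableT_comp _ _ _ _ _ _ (\1_I : R -> R)).
  exact: (@measurableT_comp _ _ _ _ _ _ rho).
have -> : lebesgue_row n S = (\int[vol]_x (h x)%:E)%E.
  rewrite [RHS](@fubini_tonelli1 _ _ _ _ _ (lebesgue_row n) lebesgue_line (EFin \o h))//.
    transitivity (\int[lebesgue_row n]_z (\1_S z)%:E)%E.
      by rewrite integral_indic// setIT.
    apply: eq_integral => z _; rewrite /fubini_F /h /=.
    under eq_integral do rewrite EFinM.
    rewrite ge0_integralZl_EFin//; last 2 first.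
    - by move=> t _; rewrite lee_fin mulr_ge0.
    - by apply/measurable_EFinP; apply: measurable_funM => //; exact: measurable_indic.
    rewrite -[LHS]mule1; congr (_ * _)%E; rewrite -(integral_ascent d0) [LHS]integral_mkcond.
    apply: eq_integral => t _; rewrite patchE indicE.
    by case: ifPn => _; rewrite ?mul1r ?mul0r.
  exact/measurable_EFinP.
have iB := boundary_integrable b sg c mF d0 r0.
rewrite /boundary_term /Rintegral fineK; last exact: integrable_fin_num iB.
apply: ae_ge0_le_integral => //.
- by move=> x _; rewrite lee_fin.
- exact/measurable_EFinP.
- by move=> x _; rewrite lee_fin boundary_integrand_ge0.
- exact: measurable_int iB.
exists (void_layer F k `&` (fill_level F k `*` setT)); split.
- apply: measurableI; first exact: measurable_void_layer.
  by apply: measurableX => //; exact: measurable_fill_level.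
- exact: fill_level_null.
move=> x /=; apply: contra_notP => nN _; rewrite lee_fin /h.
have B0 := boundary_integrand_ge0 F sg c r x d0.
have [Sx|nS] := pselect (S x.1); last by rewrite (indic_out nS) mul0r.
have [Ix|nI] := pselect (I x.2); last by rewrite (indic_out nI) mul0r mulr0.
have [[Fk oc] Mx] := Sx; have /andP[x1 x2] : d <= x.2 <= 2 * d by move: Ix; rewrite /I/= in_itv.
have x0 : 0 < x.2 by exact: lt_le_trans x1.
have Fx : F x.
  apply: contrapT => nF; apply: nN; split=> //; split=> //; split=> //=.
  exact: le_lt_trans dk.
have xr : sqnorm x <= r ^+ 2.
  apply: le_trans Mr; apply: sqnorm_box; split=> [i|].
    by apply/ltW; have := Mx i; rewrite mxE subr0.
  rewrite gtr0_norm//; apply: le_trans M1; apply: le_trans x2 _.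
  by apply: le_trans (ltW dk) _; rewrite invf_le1// ler1n.
rewrite (indic_in Sx) (indic_in Ix) (indic_in Fx) !mul1r (plateau_in r0 xr).1 mulr1.
rewrite layer_out//; last by case: (x) x0 oc => z t /= t0 oc; exact: level_out (ltW t0) oc.
by rewrite subr0 mul1r.
Qed.

(** The height [d] is fixed by [phi] and [k]. For each tolerance, [r] is then taken so large that
    the finite volume of [F] makes the plateau loss small, and the layer width goes to 0. The
    resulting bound no longer refers to the cutoffs. *)
Lemma level_cut_flux F (p c d0 M : R) phi k : measurable F -> (vol F < +oo)%E ->
  (perimeter F <= p%:E)%E -> admissible d0 M phi ->
  flux (F `&` sublevel c) phi +
    b * fine (lebesgue_row n (fill_level F k `&` base_out c `&` rcube 0 k.+1%:R)) <= p.
Proof.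
move=> mF fF Fp aphi; have [d00 cphi sphi nphi] := aphi.
set S := fine _.
pose d := Num.min (d0 / 2) (k.+1%:R^-1 / 4).
have dp : 0 < d by rewrite lt_min !divr_gt0.
have dd : 2 * d <= d0.
  by have : d <= d0 / 2; [rewrite ge_min lexx|lra].
have dk : 2 * d < k.+1%:R^-1.
  have k0 : (0 : R) < k.+1%:R^-1 by rewrite invr_gt0.
  have h (q u : R) : 0 < q -> u <= q / 4 -> 2 * u < q by move=> *; lra.
  by apply: h k0 _; rewrite ge_min lexx orbT.
have i1 j : measurable_fun setT (fun x => \1_F x * layer b j.+1%:R^-1 c x : R).
  by apply: measurable_funM; [exact: measurable_indic|exact: measurable_C1 (C1_layer _ _ _).1].
have c1 : \int[vol]_x (\1_F x * layer b j.+1%:R^-1 c x * divergence phi x) @[j --> \oo] -->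
    flux (F `&` sublevel c) phi.
  apply: (weight_cvg cphi sphi i1).
  - by apply: measurable_indic; apply: measurableI => //; exact: measurable_sublevel.
  - move=> j x; rewrite normrM mulr_ile1 ?indic_norm_le1//.
    by have /andP[? ?] := layer01 b j.+1%:R^-1 c x; rewrite ger0_norm.
  - apply: aeW => x; have -> : \1_(F `&` sublevel c) x = \1_F x * \1_(sublevel c) x :> R by rewrite indicI.
    by apply: cvgM; [exact: cvg_cst|exact: layer_cvg].
apply/ler_addgt0Pr => e e0.
have [r [r0 Mr kr re]] : exists r, [/\ 0 < r, n.+1%:R * M ^+ 2 <= r ^+ 2,
    n.+1%:R * k.+1%:R ^+ 2 <= r ^+ 2 & 6 / r * fine (vol F) <= e].
  have v0 : 0 <= fine (vol F) by rewrite fine_ge0.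
  (* One summand for each condition; the 1 ensures [r <= r ^+ 2], so that [r] itself may dominate
     the two quadratic bounds. *)
  pose r := 1 + n.+1%:R * M ^+ 2 + n.+1%:R * k.+1%:R ^+ 2 + 6 * fine (vol F) / e.
  have a0 : 0 <= n.+1%:R * M ^+ 2 by rewrite mulr_ge0// sqr_ge0.
  have k0 : (0 : R) <= n.+1%:R * k.+1%:R ^+ 2 by rewrite mulr_ge0// sqr_ge0.
  have ve0 : 0 <= 6 * fine (vol F) / e by rewrite divr_ge0 ?(ltW e0)// mulr_ge0.
  have r1 : 1 <= r by rewrite /r; lra.
  have rr : r <= r ^+ 2 by rewrite expr2 ler_peMr// (le_trans _ r1).
  have rp : 0 < r by exact: lt_le_trans r1.
  exists r; split => //; [by apply: le_trans rr; rewrite /r; lra..|].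
  rewrite mulrAC ler_pdivrMr// [e * _]mulrC -ler_pdivrMr//.
  by rewrite /r; lra.
have le j : \int[vol]_x (\1_F x * layer b j.+1%:R^-1 c x * divergence phi x) <= p + e - b * S.
  have j0 : (0 : R) < j.+1%:R^-1 by rewrite invr_gt0.
  have := calibration_integral b0 b1 c mF Fp j0 dp r0 aphi dd Mr.
  have k1 : (1 : R) <= k.+1%:R by rewrite ler1n.
  have := boundary_term_ge c mF j0 dp r0 dk k1 kr.
  move=> HB; have {}HB : S <= boundary_term b F j.+1%:R^-1 c d r.
    by rewrite -lee_fin /S fineK// ge0_fin_numE//; exact: le_lt_trans HB (ltry _).
  have mFB : measurable (F `&` box (2 * r)) by apply: measurableI => //; exact: measurable_box.
  have vle : fine (vol (F `&` box (2 * r))) <= fine (vol F).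
    apply: fine_le; rewrite ?ge0_fin_numE//.
      by apply: le_lt_trans fF; apply: le_measure; rewrite ?inE.
    by apply: le_measure; rewrite ?inE.
  have h6 : 6 / r * fine (vol (F `&` box (2 * r))) <= e.
    by apply: le_trans re; rewrite ler_wpM2l// divr_ge0// ltW.
  have bS : b * S <= b * boundary_term b F j.+1%:R^-1 c d r by rewrite ler_pM2l.
  by lra.
rewrite -lerBrDr -(cvg_lim _ c1)//; apply: limr_le; first by apply/cvg_ex; eexists; exact: c1.
exact: nearW.
Qed.

Lemma fill_level_nondecreasing F : measurable F -> nondecreasing_seq (fill_level F).
Proof.
move=> mF i j ij; apply/subsetPset => z; rewrite /fill_level/= => /(le_trans _); apply.
apply: le_measure; rewrite ?inE.
- by apply: measurable_xsection; exact: measurable_void_layer.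
- by apply: measurable_xsection; exact: measurable_void_layer.
rewrite !xsectionE => t [[t0 tj] nF]; split=> //; split=> //=.
by apply: lt_le_trans tj _; rewrite lef_pV2 ?posrE// ler_nat ltnS.
Qed.

(** Take the supremum over the test fields for a fixed fill level and cube, then let both grow to
    exhaust the trace outside the sublevel. *)
Lemma level_cut_perimeter F c : measurable F -> (vol F < +oo)%E -> (perimeter F < +oo)%E ->
  (perimeter (F `&` sublevel c) + b%:E * lebesgue_row n (vfill F `&` base_out c) <=
   perimeter F)%E.
Proof.
move=> mF fF PF; have mL := measurable_sublevel c.
have mFL : measurable (F `&` sublevel c) by exact: measurableI.
have fP : perimeter F \is a fin_num by rewrite ge0_fin_numE// perimeter_ge0.
pose p := fine (perimeter F); have Fp : (perimeter F <= p%:E)%E by rewrite /p fineK.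
pose S (k : nat) : set row := fill_level F k `&` base_out c `&` rcube 0 k.+1%:R.
have mS k : measurable (S k).
  apply: measurableI; last exact: measurable_rcube.
  by apply: measurableI; [exact: measurable_fill_level|exact: measurable_base_out].
have fS k : lebesgue_row n (S k) \is a fin_num.
  rewrite ge0_fin_numE//; apply: (@le_lt_trans _ _ (lebesgue_row n (rcube 0 k.+1%:R))).
    apply: le_measure; rewrite ?inE => //; first exact: measurable_rcube.
    by move=> z [].
  by rewrite lebesgue_row_cube// ltry.
have PL k : (perimeter (F `&` sublevel c) <= (p - b * fine (lebesgue_row n (S k)))%:E)%E.
  apply: perimeter_le => // d M phi aphi; rewrite lerBrDr.
  exact: level_cut_flux mF fF Fp aphi.
have fPL : perimeter (F `&` sublevel c) \is a fin_num.
  by rewrite ge0_fin_numE ?perimeter_ge0//; exact: le_lt_trans (PL 0) (ltry _).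
pose q := fine (perimeter (F `&` sublevel c)).
have Sq k : (lebesgue_row n (S k) <= ((p - q) / b)%:E)%E.
  rewrite -(fineK (fS k)) lee_fin ler_pdivlMr// mulrC.
  by have := PL k; rewrite -(fineK fPL) lee_fin -/q; lra.
have nS : nondecreasing_seq S.
  move=> i j ij; apply/subsetPset => z [[Fz oz] cz]; split; first split=> //.
    by have /subsetPset := fill_level_nondecreasing mF ij; apply.
  by move=> l; apply: lt_le_trans (cz l) _; rewrite ler_nat.
have US : \bigcup_k S k = vfill F `&` base_out c.
  rewrite vfill_levels//; apply/seteqP; split=> z.
    by move=> [k _ [[Fz oz] _]]; split=> //; exists k.
  move=> [[k _ Fz] oz]; pose N := maxn k (Num.truncn `|((z, 0) : space)|).
  exists N => //; split; first split=> //.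
    have /subsetPset := fill_level_nondecreasing mF (leq_maxl k (Num.truncn `|((z, 0) : space)|)).
    by apply.
  move=> i; rewrite mxE subr0.
  have [zi _] := norm_box ((z, 0) : space); apply: le_lt_trans (zi i) _.
  apply: lt_le_trans (truncnS_gt _) _.
  by rewrite ler_nat ltnS leq_maxr.
have mU : measurable (\bigcup_k S k) by exact: bigcup_measurable.
have cS := nondecreasing_cvg_mu (mu := lebesgue_row n) mS mU nS.
have leU : (lebesgue_row n (vfill F `&` base_out c) <= ((p - q) / b)%:E)%E.
  rewrite -US -(cvg_lim _ cS)//; apply: lime_le; first by apply/cvg_ex; eexists; exact: cS.
  by apply: nearW => k; exact: Sq.
rewrite -(fineK fPL) -(fineK fP) -/p -/q.
apply: (@le_trans _ _ (q%:E + b%:E * ((p - q) / b)%:E)%E).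
  by apply: leeD2l; apply: lee_wpmul2l => //; rewrite lee_fin ltW.
by rewrite -EFinM -EFinD lee_fin mulrC divfK ?gt_eqF// addrC subrK.
Qed.

(** Both terms of [level] are positive in [Omega], so each is below [c]. The bound on the horizontal
    part needs a positive slope, that is, b < 1. *)
Lemma sublevel_bounded c x : Omega x -> sublevel c x ->
  sqnorm x <= (c / slope b) ^+ 2 + (c / b) ^+ 2.
Proof.
move=> x0; rewrite /sublevel /level/= => h.
have s0 : 0 < slope b by rewrite sqrtr_gt0 subr_gt0 expr_lt1// ltW.
have r0 := hroot_gt0 x (ltr01 : (0 : R) < 1).
have bx : 0 < b * x.2 by exact: mulr_gt0.
have sr : 0 < slope b * hroot 1 x by exact: mulr_gt0.
apply: lerD.
  apply: (@le_trans _ _ (hroot 1 x ^+ 2)); first by rewrite hroot_sqr// lerDr.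
  rewrite lerXn2r ?nnegrE ?(ltW r0) ?divr_ge0 ?(ltW s0)//; first lra.
  by rewrite ler_pdivlMr// mulrC; lra.
have x0' : 0 < x.2 by [].
rewrite lerXn2r ?nnegrE ?(ltW x0') ?divr_ge0 ?(ltW b0)//; first lra.
by rewrite ler_pdivlMr// mulrC; lra.
Qed.

Lemma perimeter_Omega : (perimeter (Omega : set space) <= 0%:E)%E.
Proof.
apply: perimeter_le => [|d M phi [d0 cphi sphi _]]; first exact: measurable_Omega.
rewrite -(integral_divergence0 cphi sphi) /flux le_eqVlt; apply/orP; left; apply/eqP.
apply: eq_Rintegral => x _; have [Ox|nO] := pselect (Omega x).
  by rewrite (indic_in Ox) mul1r.
by rewrite (indic_out nO) mul0r (divergence_Omega d0 sphi).
Qed.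

(** Apply the calibration to [Omega] itself, whose perimeter is zero. Its volume is infinite, but
    for one fixed radius [r'] the plateau loss is a finite number, and this number bounds the
    perimeter. *)
Lemma sublevel_perimeter c : (perimeter (Omega `&` sublevel c) < +oo)%E.
Proof.
pose m := (c / slope b) ^+ 2 + (c / b) ^+ 2; pose r := 1 + m.
have m0 : 0 <= m by rewrite addr_ge0 ?sqr_ge0.
have r0 : 0 < r by rewrite /r; lra.
have mr : m <= r ^+ 2 by rewrite /r; nra.
pose q := n.+1%:R * (2 * r) ^+ 2; pose r' := 1 + q.
have q0 : 0 <= q by rewrite mulr_ge0// sqr_ge0.
have r'0 : 0 < r' by rewrite /r'; lra.
have qr' : q <= r' ^+ 2 by rewrite /r'; nra.
have mO : measurable (Omega : set space) by exact: measurable_Omega.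
have mL := measurable_sublevel c.
apply: (@le_lt_trans _ _ (6 / r' * fine (vol ((Omega : set space) `&` box (2 * r'))))%:E); last exact: ltry.
apply: perimeter_le => [|d M phi [d0 cphi sphi nphi]]; first exact: measurableI.
pose psi x := plateau r x *: phi x.
have cpsi : field_C1 psi by exact: field_C1_scale (C1_plateau r).1 cphi.
have spsi : supported d (2 * r) psi.
  move=> x h; split; first by apply: (sphi x _).1 => e; apply: h; rewrite /psi e scaler0.
  by apply: contra_notP h => nb; rewrite /psi (plateau_out r0 nb).1 scale0r.
have apsi : admissible d (2 * r) psi.
  split=> // x.
  have := @sqnorm_convex R n (plateau r x) (phi x) 0 (ramp01 _) (nphi x).
  rewrite scaler0 addr0; apply.
  by rewrite /sqnorm big1 => [|i _]; rewrite ?mxE expr0n//= add0r.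
have -> : flux (Omega `&` sublevel c) phi = flux (Omega `&` sublevel c) psi.
  apply: eq_Rintegral => x _; have [[Ox Lx]|nO] := pselect ((Omega `&` sublevel c) x); last first.
    by rewrite (indic_out nO) !mul0r.
  have xr : sqnorm x <= r ^+ 2 by apply: le_trans mr; exact: sublevel_bounded.
  rewrite (divergence_scale x (C1_plateau r).1 cphi) (plateau_in r0 xr).1.
  by rewrite (plateau_in r0 xr).2 addr0 mul1r.
have d2 : 0 < d / 2 by rewrite divr_gt0.
have dd : 2 * (d / 2) <= d by lra.
have i1 j : measurable_fun setT (fun x => \1_Omega x * layer b j.+1%:R^-1 c x : R).
  by apply: measurable_funM; [exact: measurable_indic|exact: measurable_C1 (C1_layer _ _ _).1].
have c1 : \int[vol]_x (\1_Omega x * layer b j.+1%:R^-1 c x * divergence psi x) @[j --> \oo] -->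
    flux (Omega `&` sublevel c) psi.
  apply: (weight_cvg cpsi spsi i1).
  - by apply: measurable_indic; exact: measurableI.
  - move=> j x; rewrite normrM mulr_ile1 ?indic_norm_le1//.
    by have /andP[? ?] := layer01 b j.+1%:R^-1 c x; rewrite ger0_norm.
  - apply: aeW => x; have -> : \1_(Omega `&` sublevel c) x = \1_Omega x * \1_(sublevel c) x :> R by rewrite indicI.
    by apply: cvgM; [exact: cvg_cst|exact: layer_cvg].
rewrite -(cvg_lim _ c1)//; apply: limr_le; first by apply/cvg_ex; eexists; exact: c1.
apply: nearW => j; have j0 : (0 : R) < j.+1%:R^-1 by rewrite invr_gt0.
have := calibration_integral b0 b1 c mO perimeter_Omega j0 d2 r'0 apsi dd qr'.
have bt : 0 <= b * boundary_term b (Omega : set space) j.+1%:R^-1 c (d / 2) r'.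
  rewrite mulr_ge0 ?(ltW b0)//; apply: Rintegral_ge0 => x _.
  exact: boundary_integrand_ge0.
by lra.
Qed.

End level_cut.

(** * The capillary functional *)

Section slice_algebra.
Context {R : realType} {n : nat}.
Local Notation space := ('rV[R]_n * R)%type.
Local Notation row := 'rV[R]_n.
Implicit Types z : row.
Implicit Types E F A : set space.
Local Notation m := (@lebesgue_line R).

Lemma vfill_sub E F z : measurable E -> measurable F ->
  (exists2 r : R, 0 < r & forall t, 0 < t < r -> E (z, t) -> F (z, t)) ->
  vfill E z -> vfill F z.
Proof.
move=> mE mF [r r0 EF] [q q0 H].
have q'0 : 0 < Num.min r q by rewrite lt_min r0.
exists (Num.min r q) => //; apply/eqP; rewrite eq_le measure_ge0 andbT -H.
have mS (A : set space) (a : R) : measurable A -> measurable (`]0, a[%classic `&` ~` xsection A z).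
  by move=> mA; apply: measurableI; [exact: measurable_itv|apply: measurableC; exact: measurable_xsection].
apply: le_measure; rewrite ?inE; [exact: mS|exact: mS|].
rewrite !xsectionE => t [/=]; rewrite in_itv/= lt_min => /and3P[t0 tr tq] nF.
by split; [rewrite /= in_itv/= t0|move=> Et; apply: nF; apply: EF => //; rewrite t0].
Qed.

Lemma vfillS E F : measurable E -> measurable F -> E `<=` F -> vfill E `<=` vfill F.
Proof.
move=> mE mF EF z; apply: vfill_sub => //.
by exists 1 => // t _; exact: EF.
Qed.

Lemma vfillI E F z : measurable E -> measurable F -> vfill E z -> vfill F z ->
  vfill (E `&` F) z.
Proof.
move=> mE mF [r r0 Hr] [q q0 Hq]; exists (Num.min r q); first by rewrite lt_min r0.
have mS (A : set space) (a : R) : measurable A -> measurable (`]0, a[%classic `&` ~` xsection A z).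
  by move=> mA; apply: measurableI; [exact: measurable_itv|apply: measurableC; exact: measurable_xsection].
apply/eqP; rewrite eq_le measure_ge0 andbT.
have <- : (m (`]0%R, r[%classic `&` ~` xsection E z) + m (`]0%R, q[%classic `&` ~` xsection F z) = 0)%E.
  by rewrite Hr Hq adde0.
apply: le_trans (measureU2 _ (mS E r mE) (mS F q mF)).
apply: le_measure; rewrite ?inE.
- by apply: mS; exact: measurableI.
- by apply: measurableU; exact: mS.
rewrite !xsectionE => t [/=]; rewrite in_itv/= lt_min => /and3P[t0 tr tq] nEF.
have [Et|nE] := pselect (E (z, t)); [right|left]; split=> //=; rewrite ?in_itv/= ?t0//.
by move=> Ft; apply: nEF.
Qed.

Lemma vfill_compl E z : measurable E -> vfill E z -> ~ vfill (~` E) z.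
Proof.
move=> mE h1 h2; have := vfillI mE (measurableC mE) h1 h2.
rewrite setICr => -[r r0]; rewrite xsection0.
rewrite setC0 setIT [X in X = _]lebesgue_measure_itv/= lte_fin r0 oppr0 adde0.
by move=> [] r00; rewrite r00 ltxx in r0.
Qed.

Lemma vfill_or_compl E : measurable E -> (perimeter E < +oo)%E ->
  {ae lebesgue_row n, forall z, vfill E z \/ vfill (~` E) z}.
Proof.
move=> mE PE; have := fill_or_void mE PE; apply: filterS => z.
by rewrite vvoidE.
Qed.

(** The union of two slices can be full near 0 without either being full, but only if one of them is
    neither full nor void; finite perimeter excludes this for almost every base point. *)
Lemma indic_vfill_modular E F : measurable E -> measurable F ->
  (perimeter E < +oo)%E -> (perimeter F < +oo)%E ->
  {ae lebesgue_row n, forall z, \1_(vfill (E `&` F)) z + \1_(vfill (E `|` F)) z =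
    \1_(vfill E) z + \1_(vfill F) z :> R}.
Proof.
move=> mE mF PE PF; have mI := measurableI _ _ mE mF; have mU := measurableU _ _ mE mF.
have sI1 := vfillS mI mE (@subIsetl _ E F); have sI2 := vfillS mI mF (@subIsetr _ E F).
have sU1 := vfillS mE mU (@subsetUl _ E F); have sU2 := vfillS mF mU (@subsetUr _ E F).
apply: filterS2 (vfill_or_compl mE PE) (vfill_or_compl mF PF) => z hE hF.
have [Ez|nEz] := pselect (vfill E z); have [Fz|nFz] := pselect (vfill F z).
- by rewrite (indic_in (vfillI mE mF Ez Fz)) (indic_in (sU1 _ Ez)) (indic_in Ez) (indic_in Fz).
- rewrite (indic_out (fun h => nFz (sI2 _ h))) (indic_in (sU1 _ Ez)) (indic_in Ez) (indic_out nFz).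
  by rewrite addrC.
- by rewrite (indic_out (fun h => nEz (sI1 _ h))) (indic_in (sU2 _ Fz)) (indic_in Fz) (indic_out nEz).
- have cE : vfill (~` E) z by case: hE.
  have cF : vfill (~` F) z by case: hF.
  have nU : ~ vfill (E `|` F) z.
    move=> /(vfill_compl mU); apply; rewrite setCU.
    by apply: vfillI => //; exact: measurableC.
  by rewrite (indic_out (fun h => nEz (sI1 _ h))) (indic_out nU) (indic_out nEz) (indic_out nFz).
Qed.

End slice_algebra.

Section capillarity.
Context {R : realType} {n : nat}.
Local Notation space := ('rV[R]_n * R)%type.
Local Notation row := 'rV[R]_n.
Implicit Types z : row.
Implicit Types E F A : set space.

(** [BVset] without the choice of representative, and therefore stable under intersection and
    union. *)
Definition finite_perimeter_set E :=
  [/\ measurable E, E `<=` Omega, (vol E < +oo)%E & (perimeter E < +oo)%E].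

Lemma ae_eq_integral_indic E F (D : set space) (g : R -> R) : measurable E -> measurable F ->
  measurable D -> measurable_fun setT g -> {ae vol, forall x, E x <-> F x} ->
  (\int[vol]_(x in D) (g (\1_E x))%:E = \int[vol]_(x in D) (g (\1_F x))%:E)%E.
Proof.
move=> mE mF mD mg EF; apply: ae_eq_integral => //.
- apply: measurable_funTS; apply/measurable_EFinP; apply: measurableT_comp => //.
- apply: measurable_funTS; apply/measurable_EFinP; apply: measurableT_comp => //.
apply: filterS EF => x EF _; congr (g _)%:E; rewrite !indicE; congr ((nat_of_bool _)%:R).
by apply/idP/idP; rewrite !inE => /EF.
Qed.

Lemma is_trace_ae E F (T : row -> R) : measurable E -> measurable F ->
  {ae vol, forall x, E x <-> F x} -> is_trace \1_E T -> is_trace \1_F T.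
Proof.
move=> mE mF EF [mT H]; split; first exact: mT.
have e' y : (fun r => (vol (half_ball y r))^-1 *
      \int[vol]_(x in half_ball y r) (`|\1_E x - T y|)%:E)%E =
    (fun r => (vol (half_ball y r))^-1 *
      \int[vol]_(x in half_ball y r) (`|\1_F x - T y|)%:E)%E.
  apply/funext => r; congr (_ * _)%E.
  apply: (@ae_eq_integral_indic E F (half_ball y r) (fun s => `|s - T y|) mE mF) EF.
    exact: measurable_half_ball.
  by apply: measurableT_comp => //; exact: measurable_funB.
apply: filterS H => y; rewrite (e' y); exact.
Qed.

Lemma eq_trace E F : measurable E -> measurable F -> {ae vol, forall x, E x <-> F x} ->
  trace \1_E = trace \1_F :> (row -> R).
Proof.
move=> mE mF EF.
have FE : {ae vol, forall x, F x <-> E x} by apply: filterS EF => x [? ?]; split.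
suff eT : is_trace \1_E = is_trace \1_F :> set (row -> R) by rewrite /trace eT.
apply/seteqP; split=> T; [exact: is_trace_ae mE mF EF|exact: is_trace_ae mF mE FE].
Qed.

Lemma eq_capillary (beta : row -> R) E F : measurable E -> measurable F ->
  {ae vol, forall x, E x <-> F x} -> capillary beta E = capillary beta F.
Proof. by move=> mE mF EF; rewrite /capillary (eq_perimeter mE mF EF) (eq_trace mE mF EF). Qed.

Lemma vol_fin_BV E : BVset E -> finite_perimeter_set E.
Proof.
move=> [mE EO _ [iE vE]]; split=> //.
have /integrableP[_] := iE.
under eq_integral do rewrite /= ger0_norm//.
by rewrite integral_indic//; [rewrite (setIidl EO)|exact: measurable_Omega].
Qed.

Lemma finite_perimeterI E F : finite_perimeter_set E -> finite_perimeter_set F ->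
  finite_perimeter_set (E `&` F) /\ finite_perimeter_set (E `|` F).
Proof.
move=> [mE EO vE PE] [mF FO vF PF].
have mI := measurableI _ _ mE mF; have mU := measurableU _ _ mE mF.
have PI0 := perimeter_ge0 mI; have PU0 := perimeter_ge0 mU.
have S : (perimeter (E `&` F) + perimeter (E `|` F) < +oo)%E.
  apply: le_lt_trans (perimeter_submodular mE mF PE PF) _.
  by rewrite lte_add_pinfty.
split; (split; [by []| | | ]).
- by move=> x [/EO].
- by apply: le_lt_trans vE; apply: le_measure; rewrite ?inE//; exact: subIsetl.
- by apply: le_lt_trans S; rewrite leeDl.
- by move=> x [/EO|/FO].
- by apply: le_lt_trans (measureU2 _ mE mF) _; rewrite lte_add_pinfty.
- by apply: le_lt_trans S; rewrite leeDr.
Qed.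

(** A trace inequality: cutting at level 0 with b = 1/2 removes the whole trace, since the level is
    nonnegative on the boundary. Half the measure of the trace is thus at most the perimeter. *)
Lemma vfill_finite E : finite_perimeter_set E -> (lebesgue_row n (vfill E) < +oo)%E.
Proof.
move=> [mE EO vE PE]; have h0 : (0 : R) < 1 / 2 by [].
have h1 : (1 / 2 : R) < 1 by lra.
have := level_cut_perimeter h0 h1 0 mE vE PE.
have -> : base_out (1 / 2) 0 = [set: row].
  apply/seteqP; split=> // z _; rewrite /base_out /level /= mulr0 add0r.
  by rewrite mulr_ge0// sqrtr_ge0.
rewrite setIT => H; have {}H : ((1 / 2)%:E * lebesgue_row n (vfill E) <= perimeter E)%E.
  apply: le_trans H; rewrite leeDr// perimeter_ge0//.
  by apply: measurableI => //; exact: measurable_sublevel.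
rewrite ltey; apply/eqP => e; move: H; rewrite e gt0_muley ?lte_fin// leye_eq => /eqP e'.
by rewrite e' in PE.
Qed.

Variable beta : row -> R.
Hypothesis mbeta : measurable_fun setT beta.
Hypothesis beta1 : {ae lebesgue_row n, forall y, `|beta y| <= 1}.

Definition adhesion E : R := \int[lebesgue_row n]_y (beta y * \1_(vfill E) y).

Lemma adhesion_integrable E : finite_perimeter_set E ->
  (lebesgue_row n).-integrable setT (EFin \o (fun y => beta y * \1_(vfill E) y)).
Proof.
move=> fE; have [mE _ _ _] := fE; have mV := measurable_vfill mE.
have mf : measurable_fun setT (fun y => beta y * \1_(vfill E) y).
  by apply: measurable_funM => //; exact: measurable_indic.
apply/integrableP; split; first exact/measurable_EFinP.
apply: le_lt_trans (vfill_finite fE).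
rewrite -[X in (_ <= lebesgue_row n X)%E]setIT -integral_indic//.
apply: ae_ge0_le_integral => //.
- by apply: measurableT_comp => //; exact/measurable_EFinP.
- by apply/measurable_EFinP; exact: measurable_indic.
apply: filterS beta1 => y b1 _; rewrite lee_fin normrM.
by rewrite [X in _ * X]ger0_norm// ler_piMl.
Qed.

Lemma capillaryE E : finite_perimeter_set E ->
  capillary beta E = (perimeter E - (adhesion E)%:E)%E.
Proof.
move=> fE; have [mE _ _ PE] := fE; have [mT HT] := trace_vfill mE PE.
rewrite /capillary /adhesion /Rintegral fineK; last first.
  exact: integrable_fin_num (adhesion_integrable fE).
congr (_ - _)%E; apply: ae_eq_integral => //.
- by apply/measurable_EFinP; exact: measurable_funM.
- by apply: measurable_int; exact: adhesion_integrable.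
by apply: filterS HT => y -> _.
Qed.

Lemma capillary_fin E : finite_perimeter_set E -> capillary beta E \is a fin_num.
Proof.
move=> fE; have [mE _ _ PE] := fE; rewrite (capillaryE fE) fin_numB.
by rewrite ge0_fin_numE ?PE//; exact: perimeter_ge0.
Qed.

Lemma capillary_arith (p1 p2 p3 p4 a1 a2 a3 a4 : R) : a3 + a4 = a1 + a2 ->
  p3 + p4 <= p1 + p2 -> p3 - a3 + (p4 - a4) <= p1 - a1 + (p2 - a2).
Proof. lra. Qed.

Lemma capillary_submodular E F : finite_perimeter_set E -> finite_perimeter_set F ->
  (capillary beta (E `&` F) + capillary beta (E `|` F) <= capillary beta E + capillary beta F)%E.
Proof.
move=> fE fF; have [fI fU] := finite_perimeterI fE fF.
have [mE _ _ PE] := fE; have [mF _ _ PF] := fF.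
have [mI _ _ PI] := fI; have [mU _ _ PU] := fU.
have S := perimeter_submodular mE mF PE PF.
rewrite (capillaryE fI) (capillaryE fU) (capillaryE fE) (capillaryE fF).
have A : adhesion (E `&` F) + adhesion (E `|` F) = adhesion E + adhesion F.
  rewrite /adhesion -(RintegralD measurableT (adhesion_integrable fI) (adhesion_integrable fU)).
  rewrite -(RintegralD measurableT (adhesion_integrable fE) (adhesion_integrable fF)).
  congr fine; apply: ae_eq_integral => //.
  - apply: measurable_int; exact: integrableD (adhesion_integrable fI) (adhesion_integrable fU).
  - apply: measurable_int; exact: integrableD (adhesion_integrable fE) (adhesion_integrable fF).
  apply: filterS (indic_vfill_modular mE mF PE PF) => y H _ /=.
  by rewrite -!mulrDr H.
have fin (G : set space) : measurable G -> (perimeter G < +oo)%E -> exists p : R, perimeter G = p%:E.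
  by move=> mG PG; exists (fine (perimeter G)); rewrite fineK// ge0_fin_numE ?PG//; exact: perimeter_ge0.
have [p1 e1] := fin _ mE PE; have [p2 e2] := fin _ mF PF.
have [p3 e3] := fin _ mI PI; have [p4 e4] := fin _ mU PU.
move: S; rewrite e1 e2 e3 e4 -!EFinB -!EFinD !lee_fin => S.
exact: capillary_arith.
Qed.

End capillarity.

(** * Density-one representatives *)

Section representatives.
Context {R : realType} {n : nat}.
Local Notation space := ('rV[R]_n * R)%type.
Implicit Types x y w : space.
Implicit Types E F A G : set space.

Lemma subset_density_one E F : measurable E -> measurable F -> E `<=` F ->
  density_one E `<=` density_one F.
Proof.
move=> mE mF EF x; rewrite !density_oneP// => H e e0; apply: filterS (H e e0) => r.
move=> /(le_trans _); apply; apply: le_measure; rewrite ?inE.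
- by apply: measurableD => //; exact: measurable_eball.
- by apply: measurableD => //; exact: measurable_eball.
- by move=> y [By nF]; split=> // /EF.
Qed.

Lemma eq_vol E F : measurable E -> measurable F ->
  {ae vol, forall x, E x <-> F x} -> vol E = vol F.
Proof.
move=> mE mF EF; have i (G : set space) : measurable G -> vol G = (\int[vol]_x (\1_G x)%:E)%E.
  by move=> mG; rewrite integral_indic// setIT.
rewrite (i _ mE) (i _ mF).
exact: (@ae_eq_integral_indic _ _ E F setT (fun s => s) mE mF measurableT _ EF).
Qed.

Lemma eq_density_one E F : measurable E -> measurable F ->
  {ae vol, forall x, E x <-> F x} -> density_one E = density_one F.
Proof.
move=> mE mF EF; apply/seteqP.
have vE r x : vol (eball x r `\` E) = vol (eball x r `\` F).
  have mB := measurable_eball x r.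
  apply: eq_vol; [exact: measurableD|exact: measurableD|].
  by apply: filterS EF => y [EFy FEy]; split=> -[By nE]; split=> // h; apply: nE; auto.
by split=> x; rewrite !density_oneP// => H e e0; apply: filterS (H e e0) => r; rewrite vE.
Qed.

Lemma density_one_idem E : measurable E -> density_one (density_one E) = density_one E.
Proof.
move=> mE; apply: eq_density_one => //; first exact: measurable_density_one.
exact: ae_density_one.
Qed.

Lemma density_one_not_null E x : measurable E -> density_one E x ->
  forall r : R, 0 < r -> vol (E `&` eball x r) <> 0%E.
Proof.
move=> mE; rewrite density_oneP// => H r r0 E0.
have k0 : 0 < ball_const (R := R) (n := n) / 2 by rewrite divr_gt0// ball_const_gt0.
have := H _ k0; move=> [/= q q0 Hq].
pose s := Num.min r q / 2; have m0 : 0 < Num.min r q by rewrite lt_min r0.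
have s0 : 0 < s by rewrite divr_gt0.
have sr : s < r.
  by have : Num.min r q <= r; [rewrite ge_min lexx|rewrite /s; lra].
have sq : s < q.
  by have : Num.min r q <= q; [rewrite ge_min lexx orbT|rewrite /s; lra].
have := Hq s; rewrite /= sub0r normrN gtr0_norm// => /(_ sq s0).
have mB := measurable_eball x s.
have -> : vol (eball x s `\` E) = vol (eball x s).
  rewrite measureD//; last by rewrite -ge0_fin_numE//; exact: vol_eball_fin (ltW s0).
  suff v0 : vol (eball x s `&` E) = 0%E by rewrite [X in (_ - X)%E]v0 sube0.
  apply/eqP; rewrite eq_le measure_ge0 andbT -E0; apply: le_measure; rewrite ?inE.
  - exact: measurableI.
  - by apply: measurableI => //; exact: measurable_eball.
  - by move=> y [By Ey]; split=> //; exact: lt_trans sr.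
move=> /(le_trans (vol_eball_ge x s0)); rewrite lee_fin ler_pM2r ?exprn_gt0//.
by have := @ball_const_gt0 R n; lra.
Qed.

Lemma nbhs_cube x (r : R) : 0 < r -> nbhs x (cube x r).
Proof. by move=> r0; apply/nbhs_ballP; exists r => //; exact: ball_cube. Qed.

Lemma not_closure_cube A x : ~ closure A x -> exists2 r : R, 0 < r & cube x r `&` A = set0.
Proof.
move=> nc; apply: contrapT => nr; apply: nc => B /nbhs_ballP[e /= e0 eB].
have /set0P : cube x e `&` A != set0 by apply/eqP => h; apply: nr; exists e.
by move=> [y [cy Ay]]; exists y; split=> //; apply: eB; exact: cube_ball.
Qed.

Lemma density_one_closure E : measurable E -> density_one E `<=` closure E.
Proof.
move=> mE x Ex; apply: contrapT => nc.
have [r r0 H] := not_closure_cube nc.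
apply: (density_one_not_null mE Ex r0); rewrite (_ : E `&` _ = set0) ?measure0//.
by rewrite -subset0 -H => y [Ey /eball_cube].
Qed.

(** Just below a point of nonpositive height there is a cube of side r/(n + 1) that misses [Omega]
    and occupies a fixed fraction of the ball. *)
Lemma density_one_Omega E : measurable E -> E `<=` Omega -> density_one E `<=` Omega.
Proof.
move=> mE EO x; rewrite density_oneP// => H; rewrite /Omega/= ltNge; apply/negP => x0.
pose k : R := n.+1%:R^-1 ^+ n.+1; have k0 : 0 < k by rewrite exprn_gt0// invr_gt0.
have [/= q q0 Hq] := H _ (divr_gt0 k0 (ltr0Sn R 1)).
pose r := q / 2; have r0 : 0 < r by rewrite divr_gt0.
have rq : r < q by rewrite /r; lra.
have := Hq r; rewrite /= sub0r normrN gtr0_norm// => /(_ rq r0).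
pose s := r / n.+1%:R; have s0 : 0 < s by rewrite divr_gt0.
pose w : space := (x.1, x.2 - s / 2).
have := vol_cube w (ltW (divr_gt0 s0 (ltr0Sn _ 1))).
rewrite mulrCA divff// mulr1 => vE.
have : (vol (cube w (s / 2)%R) <= vol (eball x r `\` E))%E.
  apply: le_measure; rewrite ?inE; first exact: measurable_cube.
    by apply: measurableD => //; exact: measurable_eball.
  move=> y [c1 /=]; rewrite ltr_norml => c2; split; last first.
    by move=> /EO; rewrite /Omega/=; lra.
  apply: cube_eball => //; rewrite -/s; split=> [i|]; last by rewrite ltr_norml; lra.
  by apply: lt_le_trans (c1 i) _; lra.
rewrite vE => /le_trans h /h; rewrite lee_fin /s exprMn mulrC -/k ler_pM2r ?exprn_gt0//.
by lra.
Qed.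

Lemma BVset_density_one E : finite_perimeter_set E -> BVset (density_one E).
Proof.
move=> [mE EO vE PE]; have mD := measurable_density_one mE.
have DE := ae_density_one mE.
split; [exact: mD|exact: density_one_Omega|exact: density_one_idem|split]; last first.
  by rewrite -/(perimeter _) (eq_perimeter mD mE DE).
apply/integrableP; split.
  by apply: measurable_funTS; apply/measurable_EFinP; exact: measurable_indic.
under eq_integral do rewrite /= ger0_norm//.
rewrite integral_indic//; last exact: measurable_Omega.
apply: (@le_lt_trans _ _ (vol (density_one E))); last by rewrite (eq_vol mD mE DE).
apply: le_measure; rewrite ?inE.
- by apply: measurableI; [exact: mD|exact: measurable_Omega].
- exact: mD.
- exact: subIsetl.
Qed.

Lemma measurable_eball_union (W : set space) (r : R) :
  measurable [set x | exists2 w, W w & enorm (x - w) < r].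
Proof.
apply: open_measurable_space.
rewrite (_ : [set x | _] = \bigcup_(w in W) [set x | enorm (x - w) < r]).
  apply: bigcup_open => w _.
  apply: (@open_comp _ _ (fun x : space => enorm (x - w)) [set t | t < r]); last exact: open_lt.
  move=> y _; apply: (@cvg_comp _ _ _ (fun x : space => x - w) enorm); last exact: enorm_continuous.
  by apply: cvgB; [exact: cvg_id|exact: cvg_cst].
by apply/seteqP; split=> x [w Ww xw]; exists w.
Qed.

(** The set where the distance is below [c] is a union of open balls around boundary points. An
    empty boundary is included: the infimum is then infinite and the union empty. *)
Lemma measurable_dist_bd E : measurable_fun setT (dist_bd E).
Proof.
apply: (measurability _ (ErealGenInftyO.measurableE R)) => //.
move=> /= _ [_ [c ->]] <-; rewrite setTI.
rewrite (_ : _ @^-1` _ = [set x | exists2 w, (Omega `&` bd E) w & enorm (x - w) < c]).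
  exact: measurable_eball_union.
apply/seteqP; split=> x /=.
  rewrite in_itv/= => /ereal_inf_lt[_ [w Ww <-]].
  by rewrite lte_fin => h; exists w.
move=> [w Ww h]; rewrite in_itv/=.
apply: le_lt_trans (_ : (_ <= (enorm (x - w))%:E)%E) _; last by rewrite lte_fin.
by apply: ereal_inf_lbound; exists w.
Qed.

Lemma dist_bd_ge0 E x : (0 <= dist_bd E x)%E.
Proof. by apply: le_ereal_inf_tmp => _ [w _ <-]; rewrite lee_fin sqrtr_ge0. Qed.

(** Every boundary point of [E] is a limit of points of [E], which stay out of the larger cube; a
    boundary point too close to the smaller cube would force one of them in. *)
Lemma cube_dist_bd E A x y (r : R) : E `<=` A -> 0 < r -> cube x r `&` A = set0 ->
  cube x (r / 2) y -> ((r / 2)%:E <= dist_bd E y)%E.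
Proof.
move=> EA r0 xA xy; apply: le_ereal_inf_tmp => _ [w [_ [cw _]] <-]; rewrite lee_fin.
rewrite leNgt; apply/negP => h; pose e := r / 2 - enorm (y - w).
have e0 : 0 < e by rewrite subr_gt0.
have [z [Ez cz]] := cw _ (nbhs_cube w e0).
have [xy1 xy2] := xy; have [wz1 wz2] := cz.
have tri (a p q t : R) : `|q - a| < r / 2 -> `|q - p| <= enorm (y - w) -> `|t - p| < e -> `|t - a| < r.
  move=> h1 h2 h3; have -> : t - a = (t - p) - (q - p) + (q - a) by ring.
  apply: le_lt_trans (ler_normD _ _) _; have := ler_normB (t - p) (q - p).
  by move: h1 h2 h3; rewrite /e; lra.
have : (cube x r `&` A) z; last by rewrite xA.
split; last exact: EA; split=> [i|].
  apply: tri (xy1 i) _ (wz1 i); have := coord_le_enorm (y - w) i.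
  by rewrite !mxE.
by apply: tri xy2 _ wz2; exact: (last_le_enorm (y - w)).
Qed.

End representatives.

(** * Comparison and barriers *)

(** Here [a] and [c] are the capillary energies of the minimizer and of its truncation, [J] the
    penalty of the truncation and [Z] the part of the penalty that truncation removes. Finiteness of
    the sum allows [J] to be cancelled. *)
Lemma penalty_eq0 (R : realType) (a c l : R) (J Z : \bar R) : 0 < l ->
  (0 <= J -> 0 <= Z -> J + Z < +oo -> a%:E + l%:E * (J + Z) <= c%:E + l%:E * J ->
  c%:E <= a%:E -> Z = 0)%E.
Proof.
move=> l0; case: J => [j||]//; case: Z => [z||]// j0 z0 _ h1 h2.
have {}h1 : a + l * (j + z) <= c + l * j by exact: h1.
have {}h2 : c <= a by exact: h2.
have {}z0 : 0 <= z by exact: z0.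
by congr EFin; apply/eqP; rewrite eq_le z0 andbT -(pmulr_rle0 _ l0); lra.
Qed.

Section comparison.
Context {R : realType} {n : nat}.
Local Notation space := ('rV[R]_n * R)%type.
Local Notation row := 'rV[R]_n.
Implicit Types x y w : space.
Implicit Types E F A G : set space.
Variable beta : row -> R.
Hypothesis mbeta : measurable_fun setT beta.
Hypothesis beta1 : {ae lebesgue_row n, forall z, `|beta z| <= 1}.

Lemma capillary_density_one E : finite_perimeter_set E ->
  capillary beta (density_one E) = capillary beta E.
Proof.
move=> [mE _ _ _]; apply: eq_capillary => //; first exact: measurable_density_one.
exact: ae_density_one.
Qed.

Lemma measurableY E F : measurable E -> measurable F -> measurable (E `+` F).
Proof. by move=> mE mF; apply: measurableU; exact: measurableD. Qed.

Lemma integral_symdiff_density_one E E0 (f : space -> \bar R) : measurable E -> measurable E0 ->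
  measurable_fun setT f -> (forall x, (0 <= f x)%E) ->
  (\int[vol]_(x in density_one E `+` E0) f x = \int[vol]_(x in E `+` E0) f x)%E.
Proof.
move=> mE mE0 mf f0; have mD := measurable_density_one mE.
rewrite [LHS]integral_mkcond [RHS]integral_mkcond.
apply: ae_eq_integral => //.
- by apply/(measurable_restrict _ (measurableY mD mE0) measurableT); rewrite setTI; exact: measurable_funTS.
- by apply/(measurable_restrict _ (measurableY mE mE0) measurableT); rewrite setTI; exact: measurable_funTS.
apply: filterS (ae_density_one mE) => x [DE ED] _; rewrite !patchE.
suff -> : (x \in density_one E `+` E0) = (x \in E `+` E0) by [].
by apply/idP/idP; rewrite !inE => -[[h1 h2]|[h1 h2]]; by [left; split; auto|right; split; auto].
Qed.

Lemma ATW_self E (lambda : R) : ATW beta E lambda E = capillary beta E.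
Proof.
have e : E `+` E = set0 by exact: setYK.
by rewrite /ATW e integral_set0 mule0 adde0.
Qed.

Lemma minimizer_subset_closure E0 Ep El (lambda : R) : 0 < lambda ->
  BVset E0 -> BVset Ep -> BVset El -> E0 `<=` Ep ->
  (forall F, BVset F -> Ep `<=` F -> (capillary beta Ep <= capillary beta F)%E) ->
  ATW_minimizer beta E0 lambda El -> El `<=` closure Ep.
Proof.
move=> l0 b0 bp bl E0p Hp [_ Hl] x Ex.
have f0 := vol_fin_BV b0; have fp := vol_fin_BV bp; have fl := vol_fin_BV bl.
have [mE0 _ _ _] := f0; have [mp _ _ _] := fp; have [ml _ _ _] := fl.
have [fI fU] := finite_perimeterI fl fp.
have [mI _ _ _] := fI; have [mU _ _ _] := fU.
have dl : density_one El = El by case: bl.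
have dp : density_one Ep = Ep by case: bp.
have md := measurable_dist_bd E0; have d0 := dist_bd_ge0 E0.
have CIl : (capillary beta (El `&` Ep) <= capillary beta El)%E.
  have cU : (capillary beta Ep <= capillary beta (El `|` Ep))%E.
    (* The union becomes a competitor through its density-one representative, which contains [Ep]
       because [Ep] is its own. *)
    rewrite -(capillary_density_one fU); apply: Hp; first exact: BVset_density_one.
    by rewrite -{1}dp; apply: subset_density_one => //; exact: subsetUr.
  have S := capillary_submodular mbeta beta1 fl fp.
  rewrite -(leeD2rE _ _ (capillary_fin mbeta beta1 fp)); apply: le_trans S.
  by apply: leeD2l.
have ms A : measurable A -> measurable (A `+` E0) by move=> mA; exact: measurableY.
have mdiff : measurable (El `\` Ep) by exact: measurableD.
(* As [E0] lies in [Ep], cutting [El] down to [Ep] removes exactly [El] minus [Ep] from the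
   symmetric difference with [E0]. *)
have split_int : (\int[vol]_(x in El `+` E0) dist_bd E0 x =
   \int[vol]_(x in (El `&` Ep) `+` E0) dist_bd E0 x + \int[vol]_(x in El `\` Ep) dist_bd E0 x)%E.
  rewrite -ge0_integral_setU//; last 3 first.
  - exact: ms.
  - exact: measurable_funTS.
  - by apply/disj_setPS => y [[[[? ?] _]|[/E0p ? _]] [_ ?]].
  congr (integral _ _ _); apply/seteqP; split=> y.
  - move=> [[ly ny]|[zy ny]]; last by left; right; split=> // -[].
    by have [py|npy] := pselect (Ep y); [left; left|right].
  - move=> [[[[ly py] ny]|[zy ny]]|[ly npy]]; first by left.
      by right; split=> // ly; apply: ny; split=> //; exact: E0p.
    by left; split=> // /E0p.
have ATWI : (capillary beta El + lambda%:E * \int[vol]_(x in El `+` E0) dist_bd E0 x <=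
    capillary beta (El `&` Ep) + lambda%:E * \int[vol]_(x in (El `&` Ep) `+` E0) dist_bd E0 x)%E.
  have := Hl _ (BVset_density_one fI).
  by rewrite /ATW capillary_density_one// integral_symdiff_density_one.
(* Comparison with [E0] itself, which carries no penalty. *)
have fin_int : (\int[vol]_(x in El `+` E0) dist_bd E0 x < +oo)%E.
  have := Hl _ b0; rewrite ATW_self /ATW => H.
  rewrite ltey; apply/eqP => e; move: H; rewrite e gt0_muley ?lte_fin//.
  have /fineK <- := capillary_fin mbeta beta1 fl; have /fineK <- := capillary_fin mbeta beta1 f0.
  by rewrite addey// leye_eq.
have zero : (\int[vol]_(x in El `\` Ep) dist_bd E0 x = 0)%E.
  have Z0 : (0 <= \int[vol]_(x in El `\` Ep) dist_bd E0 x)%E by exact: integral_ge0.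
  have J0 : (0 <= \int[vol]_(x in (El `&` Ep) `+` E0) dist_bd E0 x)%E by exact: integral_ge0.
  have cl := capillary_fin mbeta beta1 fl; have cI := capillary_fin mbeta beta1 fI.
  rewrite split_int in fin_int ATWI.
  rewrite -(fineK cl) -(fineK cI) in ATWI CIl.
  exact: (penalty_eq0 l0 J0 Z0 fin_int ATWI CIl).
(* Off the closure of [Ep] the distance is bounded below on a small cube, so [El] is null there;
   this contradicts density one at [x]. *)
apply: contrapT => nc; have [r r0 H] := not_closure_cube nc.
have r2 : 0 < r / 2 by rewrite divr_gt0.
have mC := measurable_cube x (r / 2).
have sub : El `&` cube x (r / 2) `<=` El `\` Ep.
  move=> y [ly cy]; split=> // py; have : (cube x r `&` Ep) y; last by rewrite H.
  split=> //; have [c1 c2] := cy; have h : r / 2 <= r by lra.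
  by split=> [i|]; [exact: lt_le_trans (c1 i) h|exact: lt_le_trans c2 h].
have mlC : measurable (El `&` cube x (r / 2)) by exact: measurableI.
have v0 : ((r / 2)%:E * vol (El `&` cube x (r / 2)%R) <= 0)%E.
  rewrite -zero -integral_cst//.
  apply: (@le_trans _ _ (\int[vol]_(x in El `&` cube x (r / 2)%R) dist_bd E0 x)%E).
    apply: ge0_le_integral => //.
    - by move=> y _; rewrite lee_fin ltW.
    - exact: measurable_funTS.
    - by move=> y [_ cy]; exact: cube_dist_bd E0p r0 H cy.
  by apply: ge0_subset_integral => //; exact: measurable_funTS.
apply: (density_one_not_null ml _ r2); first by rewrite dl; exact: Ex.
apply/eqP; rewrite eq_le measure_ge0 andbT.
apply: (@le_trans _ _ (vol (El `&` cube x (r / 2)))).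
  apply: le_measure; rewrite ?inE//.
    by apply: measurableI => //; exact: measurable_eball.
  by move=> y [ly /eball_cube cy].
by move: v0; rewrite pmule_rle0.
Qed.

End comparison.

Section barrier.
Context {R : realType} {n : nat}.
Local Notation space := ('rV[R]_n * R)%type.
Local Notation row := 'rV[R]_n.
Implicit Types x y w : space.
Implicit Types E F A G : set space.
Variable beta : row -> R.
Hypothesis mbeta : measurable_fun setT beta.
Hypothesis beta1 : {ae lebesgue_row n, forall z, `|beta z| <= 1}.
Variable b : R.
Hypotheses (b0 : 0 < b) (b1 : b < 1).
Hypothesis betab : {ae lebesgue_row n, forall z, beta z <= b}.

Definition barrier c : set space := Omega `&` sublevel b c.

Lemma barrier_sqnorm c x : barrier c x -> sqnorm x <= (c / slope b) ^+ 2 + (c / b) ^+ 2.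
Proof. by move=> [Ox Lx]; exact: sublevel_bounded. Qed.

Lemma barrier_box c : exists M, barrier c `<=` box M.
Proof.
pose m := (c / slope b) ^+ 2 + (c / b) ^+ 2; exists (1 + m) => x /barrier_sqnorm h.
have m0 : 0 <= m by rewrite addr_ge0 ?sqr_ge0.
apply: sqnorm_lt_box; first by lra.
by apply: le_lt_trans h _; rewrite -/m; nra.
Qed.

Lemma barrier_finite_perimeter c : finite_perimeter_set (barrier c).
Proof.
have mB : measurable (barrier c).
  by apply: measurableI; [exact: measurable_Omega|exact: measurable_sublevel].
have [M BM] := barrier_box c; split=> //.
- by move=> x [].
- apply: le_lt_trans (@vol_box_fin R n M); apply: le_measure; rewrite ?inE//.
  exact: measurable_box.
- exact: sublevel_perimeter.
Qed.

Lemma level_vertical (z : row) (t : R) : level b ((z, t) : space) = b * t + level b ((z, 0) : space).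
Proof. by rewrite /level /= mulr0 add0r. Qed.

(** The bound beta <= b is used only where the trace of [F] is lost, and there the point lies in
    [base_out]. *)
Lemma adhesion_cut c F : finite_perimeter_set F -> finite_perimeter_set (F `&` sublevel b c) ->
  adhesion beta F <= adhesion beta (F `&` sublevel b c) +
    b * fine (lebesgue_row n (vfill F `&` base_out b c)).
Proof.
move=> fF fFL; have [mF _ _ _] := fF; have [mFL _ _ _] := fFL.
have mVB : measurable (vfill F `&` base_out b c).
  by apply: measurableI; [exact: measurable_vfill|exact: measurable_base_out].
have vVB : (lebesgue_row n (vfill F `&` base_out b c) < +oo)%E.
  apply: le_lt_trans (vfill_finite fF); apply: le_measure; rewrite ?inE//.
  exact: measurable_vfill.
have iB := integrable_cst_indic b mVB vVB.
have iF := adhesion_integrable mbeta beta1 fF.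
have iFL := adhesion_integrable mbeta beta1 fFL.
have -> : b * fine (lebesgue_row n (vfill F `&` base_out b c)) =
    \int[lebesgue_row n]_z (b * \1_(vfill F `&` base_out b c) z).
  have i1 : (lebesgue_row n).-integrable setT (EFin \o (\1_(vfill F `&` base_out b c) : row -> R)).
    by have := integrable_cst_indic 1 mVB vVB; under eq_fun do rewrite mul1r.
  rewrite (RintegralZl b measurableT i1); congr (_ * _).
  by rewrite /Rintegral integral_indic// setIT.
have iS := integrableD measurableT iFL iB.
rewrite -subr_ge0 /adhesion -(RintegralD measurableT iFL iB) -(RintegralB measurableT iS iF).
have iG := integrableB measurableT iS iF.
set g := (fun z => _ - _) in iG *.
have mg : measurable_fun setT g by apply/measurable_EFinP; exact: measurable_int iG.
(* The integrand is nonnegative only almost everywhere; passing to its positive part keeps the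
   integral and gives a pointwise sign. *)
have -> : \int[lebesgue_row n]_z g z = \int[lebesgue_row n]_z Num.max (g z) 0.
  congr fine; apply: ae_eq_integral => //.
  - exact/measurable_EFinP.
  - apply/measurable_EFinP; exact: measurable_maxr.
  apply: filterS betab => z bz _; congr EFin; apply/esym/max_idPl; rewrite /g.
  have sub := vfillS mFL mF (@subIsetl _ F (sublevel b c)).
  have [Vz|nV] := pselect (vfill F z); last first.
    have nVB : ~ (vfill F `&` base_out b c) z by move=> [].
    rewrite (indic_out nV) (indic_out (fun h => nV (sub _ h))) (indic_out nVB).
    by rewrite !mulr0 addr0 subrr.
  have [VLz|nVL] := pselect (vfill (F `&` sublevel b c) z).
    rewrite (indic_in Vz) (indic_in VLz) addrAC subrr add0r.
    by rewrite mulr_ge0// ltW.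
  (* If the level at the base point were below [c], the cut would leave the slice untouched up to
     the height where the level reaches [c], and the trace would survive. *)
  have oz : base_out b c z.
    rewrite /base_out/= leNgt; apply/negP => h; apply: nVL; apply: vfill_sub Vz => //.
    exists ((c - level b ((z, 0) : space)) / b); first by rewrite divr_gt0// subr_gt0.
    move=> t /andP[t0]; rewrite ltr_pdivlMr// => tc Ft; split=> //.
    by rewrite /sublevel/= level_vertical; lra.
  rewrite (indic_in Vz) (indic_out nVL) (indic_in (A := vfill F `&` base_out b c))//.
  by rewrite mulr0 add0r !mulr1 subr_ge0.
by apply: Rintegral_ge0 => z _; rewrite le_max lexx orbT.
Qed.

Lemma barrier_minimal c F : finite_perimeter_set F ->
  (capillary beta (F `&` sublevel b c) <= capillary beta F)%E.
Proof.
move=> fF; have [mF FO vF PF] := fF; have mL := measurable_sublevel b c.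
have H := level_cut_perimeter b0 b1 c mF vF PF.
have mFL : measurable (F `&` sublevel b c) by exact: measurableI.
have mV := measurable_vfill mF; have mB := measurable_base_out b c.
have mVB : measurable (vfill F `&` base_out b c) by exact: measurableI.
have fFL : finite_perimeter_set (F `&` sublevel b c).
  split=> //; first by move=> x [/FO].
    by apply: le_lt_trans vF; apply: le_measure; rewrite ?inE.
  by apply: le_lt_trans PF; apply: le_trans H; rewrite leeDl// mule_ge0// lee_fin ltW.
have vVB : (lebesgue_row n (vfill F `&` base_out b c) < +oo)%E.
  by apply: le_lt_trans (vfill_finite fF); apply: le_measure; rewrite ?inE.
have A : adhesion beta F <= adhesion beta (F `&` sublevel b c) +
    b * fine (lebesgue_row n (vfill F `&` base_out b c)).
  exact: adhesion_cut.
rewrite (capillaryE mbeta beta1 fF) (capillaryE mbeta beta1 fFL).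
have fin (G : set space) : measurable G -> (perimeter G < +oo)%E -> exists p : R, perimeter G = p%:E.
  by move=> mG PG; exists (fine (perimeter G)); rewrite fineK// ge0_fin_numE ?PG//; exact: perimeter_ge0.
have [p1 e1] := fin _ mF PF; have [_ _ _ PFL] := fFL; have [p2 e2] := fin _ mFL PFL.
have fV : lebesgue_row n (vfill F `&` base_out b c) \is a fin_num by rewrite ge0_fin_numE.
move: H; rewrite e1 e2 -(fineK fV) -EFinM -EFinD -!EFinB !lee_fin.
by move: A; lra.
Qed.

(** The closure adds only points at height 0 or on the level [c], and each vertical line meets
    either set in at most one point. *)
Lemma closure_barrier c : vol (closure (barrier c) `\` barrier c) = 0%E.
Proof.
pose N : set space := [set x | x.2 = 0] `|` [set x | level b x = c].
have ml : measurable_fun setT (level b : space -> R) by exact: measurable_C1 (@C1_level R n b).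
have level_set (f : space -> R) (d : R) : measurable_fun setT f -> measurable [set x | f x = d].
  move=> mf; rewrite (_ : [set x | _] = [set x | f x <= d] `&` [set x | d <= f x]).
    by apply: measurableI; apply: measurable_set_le => //; exact: measurable_cst.
  by apply/seteqP; split=> x /= => [->|[h1 h2]]; [rewrite lexx|apply/le_anti; rewrite h1].
have mN1 : measurable [set x : space | x.2 = 0] by exact: level_set.
have mN2 : measurable [set x : space | level b x = c] by exact: level_set.
have mN : measurable N by exact: measurableU.
have point (t : R) (A : set R) : measurable A -> (forall u, A u -> u = t) -> lebesgue_line.-negligible A.
  move=> mA At; apply/negligibleP => //; apply/eqP; rewrite eq_le measure_ge0 andbT.
  rewrite -[X in (_ <= X)%E](lebesgue_measure_set1 t).
  apply: (@le_measure _ _ _ lebesgue_line); rewrite ?inE//.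
have cc : closed [set x : space | 0 <= x.2 /\ level b x <= c].
  apply: closedI.
    apply: (@closed_comp _ _ (fun x : space => x.2) [set t | 0 <= t]); last exact: closed_ge.
    by move=> x _; exact: cvg_snd.
  apply: (@closed_comp _ _ (level b) [set t | t <= c]); last exact: closed_le.
  by move=> x _; exact: (C1_continuous (@C1_level R n b)).
have sub : closure (barrier c) `\` barrier c `<=` N.
  move=> x [cx nx]; have : [set x : space | 0 <= x.2 /\ level b x <= c] x.
    move: cx; rewrite closureE; apply; split=> // y [Oy Ly]; split; exact: ltW.
  move=> [x0 xc]; have [e|x1] := eqVneq x.2 0; [by left|right].
  apply/eqP; apply/negPn/negP => ne; apply: nx; split.
    by rewrite /Omega/= lt_neqAle eq_sym x1.
  by rewrite /sublevel/= lt_neqAle ne.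
have N0 : vol.-negligible N.
  apply: negligibleU.
    apply: negligible_xsection => // z; apply: (point 0); first exact: measurable_xsection.
    by rewrite xsectionE.
  apply: negligible_xsection => // z; apply: (point ((c - level b ((z, 0) : space)) / b)).
    exact: measurable_xsection.
  move=> u; rewrite xsectionE/= level_vertical => h.
  by apply/eqP; rewrite eq_sym -(inj_eq (mulIf (lt0r_neq0 b0))) divfK ?lt0r_neq0// -h addrK mulrC.
have mc : measurable (closure (barrier c)).
  rewrite -[closure _]setCK; apply: measurableC; apply: open_measurable_space.
  by apply: closed_openC; exact: closed_closure.
have [mB _ _ _] := barrier_finite_perimeter c.
by apply/negligibleP; [exact: measurableD|exact: negligibleS sub N0].
Qed.

Lemma exists_barrier E : BVset E -> bounded_set E ->
  exists Ep, [/\ BVset Ep, bounded_set Ep, E `<=` Ep,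
    (forall F, BVset F -> Ep `<=` F -> (capillary beta Ep <= capillary beta F)%E) &
    vol (closure Ep `\` Ep) = 0%E].
Proof.
move=> bE [M [_ HM]]; have [mE EO dE _] := bE.
pose q := M + 1; have EM x : E x -> box q x.
  by move=> Ex; apply: (@box_le _ _ `|x|); [apply: HM => //; rewrite ltrDl|exact: norm_box].
(* An upper bound for the level on [box q], plus 1 to make the inequality strict. *)
pose c := b * q + slope b * Num.sqrt (1 + n.+1%:R * q ^+ 2) + 1.
have EB : E `<=` barrier c.
  move=> x Ex; split; first exact: EO.
  have bx := EM _ Ex; rewrite /sublevel/= /c.
  have h1 : b * x.2 <= b * q by rewrite ler_pM2l//; have [_] := bx; rewrite ler_norml => /andP[].
  have h2 : slope b * hroot 1 x <= slope b * Num.sqrt (1 + n.+1%:R * q ^+ 2).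
    rewrite ler_wpM2l ?slope_ge0// ler_wsqrtr// lerD2l.
    apply: le_trans (sqnorm_box bx); rewrite /sqnorm lerDl; exact: sqr_ge0.
  by rewrite /level; lra.
have fB := barrier_finite_perimeter c; have [mB BO _ _] := fB.
have mD := measurable_density_one mB.
exists (density_one (barrier c)); split.
- exact: BVset_density_one.
- have [M' BM'] := barrier_box c.
  have [K [rK HK]] := compact_bounded (@compact_box R n M').
  exists K; split=> // r Kr x Dx; apply: (HK r Kr).
  have := density_one_closure mB Dx; rewrite closureE; apply; split=> //.
  exact: closed_box.
- by rewrite -dE; exact: subset_density_one.
- move=> F bF DF; have fF := vol_fin_BV bF; have [mF FO _ _] := fF.
  rewrite (capillary_density_one beta fB); apply: le_trans (barrier_minimal c fF).
  have mFL : measurable (F `&` sublevel b c) by apply: measurableI => //; exact: measurable_sublevel.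
  (* Up to a null set the barrier lies in [F], and [F] lies in [Omega], so cutting [F] leaves
     exactly the barrier. *)
  rewrite (eq_capillary beta mB mFL)//.
  apply: filterS (ae_density_one mB) => x [_ DB]; split=> [Bx|[Fx Lx]].
    by split; [exact: DF (DB Bx)|exact: Bx.2].
  by split=> //; exact: FO.
- have [mc cN] : measurable (closure (density_one (barrier c)) `\` density_one (barrier c)) /\
      vol.-negligible (closure (density_one (barrier c)) `\` density_one (barrier c)).
    split.
      apply: measurableD => //.
      rewrite -[closure _]setCK; apply: measurableC; apply: open_measurable_space.
      by apply: closed_openC; exact: closed_closure.
    have mc : measurable (closure (barrier c) `\` barrier c).
      apply: measurableD => //.
      rewrite -[closure _]setCK; apply: measurableC; apply: open_measurable_space.
      by apply: closed_openC; exact: closed_closure.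
    have n1 : vol.-negligible (closure (barrier c) `\` barrier c).
      by apply/negligibleP => //; exact: closure_barrier.
    apply: negligibleS (negligibleU n1 (ae_density_one mB)) => x [cx nx].
    have cBx : closure (barrier c) x.
      have H := cx; rewrite [closure (density_one _)]closureE in H; apply: H; split; first exact: closed_closure.
      exact: density_one_closure.
    have [Bx|nB] := pselect (barrier c x); [right => h|by left].
    by apply: nx; apply/h.
  by apply/eqP; move: cN; rewrite negligibleP// => ->.
Qed.

End barrier.

Unset Implicit Arguments.

Theorem proposition6p11 (R : realType) (n : nat) (n_ge1 : (1 <= n)%N)
    (E0 : set ('rV[R]_n * R)) (E0_BV : BVset E0) (E0_nonempty : E0 !=set0)
    (E0_bounded : bounded_set E0)
    (beta : 'rV[R]_n -> R) (beta_Linfty : beta \in Lfun (lebesgue_row n) +oo%E)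
    (kappa : R) (kappa_bounds : 0 < kappa <= 1 / 2)
    (beta_bounds :
      {ae lebesgue_row n, forall y, -1 <= beta y <= 1 - 2 * kappa})
    (lambda : R) (lambda_ge1 : 1 <= lambda) :
  (* (a) *)
  (forall Eplus : set ('rV[R]_n * R),
    BVset Eplus -> constrained_minimizer beta E0 Eplus ->
    forall Elambda, ATW_minimizer beta E0 lambda Elambda ->
      Elambda `<=` closure Eplus)
  /\
  (* (b) *)
  (forall Eplus : set ('rV[R]_n * R),
    BVset Eplus -> bounded_set Eplus -> constrained_minimizer beta Eplus Eplus ->
    E0 `<=` Eplus ->
    forall Elambda, ATW_minimizer beta E0 lambda Elambda ->
      Elambda `<=` closure Eplus)
  /\
  (forall F0 : set ('rV[R]_n * R),
    BVset F0 -> F0 !=set0 -> bounded_set F0 ->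
    exists Eplus : set ('rV[R]_n * R),
      [/\ BVset Eplus, bounded_set Eplus, F0 `<=` Eplus,
          constrained_minimizer beta Eplus Eplus &
          vol (closure Eplus `\` Eplus) = 0%E]).
Proof.
have mbeta : measurable_fun setT beta.
  by move: beta_Linfty; rewrite inE => /andP[]; rewrite inE.
have beta1 : {ae lebesgue_row n, forall z, `|beta z| <= 1}.
  by apply: filterS beta_bounds => z /andP[h1 h2]; rewrite ler_norml; move: kappa_bounds; lra.
have l0 : 0 < lambda by exact: lt_le_trans ltr01 lambda_ge1.
(* Both comparison statements follow from this one, with [A] equal to [E0] and to [Ep] respectively:
   a superset of [Ep] is also a superset of [A]. *)
have part A Ep El : BVset Ep -> constrained_minimizer beta A Ep -> E0 `<=` Ep ->
    A `<=` Ep -> ATW_minimizer beta E0 lambda El -> El `<=` closure Ep.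
  move=> bp [_ cp] E0p Ap ml; have [bl _] := ml.
  apply: (minimizer_subset_closure mbeta beta1 l0 E0_BV bp bl E0p _ ml) => F bF EpF.
  by apply: cp; split=> //; exact: subset_trans EpF.
split; [|split].
- move=> Ep bp cp El; apply: (part E0) => //; by case: cp => -[].
- by move=> Ep bp _ cp E0p El; exact: (part Ep).
- move=> F0 bF0 _ bdF0.
  (* The barrier uses 1 - kappa and not 1 - 2 kappa: it still bounds beta, and it stays strictly
     between 0 and 1 even for kappa = 1/2. *)
  have b0 : 0 < 1 - kappa by move: kappa_bounds; lra.
  have b1 : 1 - kappa < 1 by move: kappa_bounds; lra.
  have betab : {ae lebesgue_row n, forall z, beta z <= 1 - kappa}.
    by apply: filterS beta_bounds => z; move: kappa_bounds; lra.
  have [Ep [bp bdp F0p mp vp]] := exists_barrier mbeta beta1 b0 b1 betab bF0 bdF0.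
  exists Ep; split; [exact: bp|exact: bdp|exact: F0p| |exact: vp].
  split; first by split; [exact: bp|move=> x].
  by move=> F [bF EpF]; exact: mp.
Qed.
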